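(* Let $p\in(2,\infty)$ and $\delta\ge\frac{p}{p-2}$. There exist a constant $C>0$ depending only on $p$, $\delta$ and the dimension $n$, and a constant $c_0=c_0(p)>0$, such that the following holds. Let $\Omega\subset\mathbb{R}^n$ be a bounded domain, let $w\in\partial\Omega$, $r>0$, $T>0$, $M>0$, and put $E:=\Omega\cap B(w,r)$, $E_T:=E\times(0,T)$. Let $u\in C(\overline{E_T})$ be a non-negative solution to $\partial_t u-\Delta_p u=0$ in $E_T$ which vanishes on $(\partial\Omega\cap B(w,r))\times[0,T)$ and satisfies $u\le M$ in $E_T$. Assume that the initial data $u_0=u(\cdot,0)$ satisfies $$u_0(x)\le M\frac{|x-w|^\delta}{r^\delta},\qquad x\in E .$$ Set $$\hat T:=\left[\frac{C}{M}\right]^{p-2}r^p,\qquad \tilde T:=\min\{\hat T/2,\,T\}.$$ Then $$u(x,t)\le c_0M\frac{|x-w|^\delta}{r^\delta}\qquad\text{for all }(x,t)\in E_{\tilde T}:=E\times(0,\tilde T).$$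
   Context: Here $\Delta_p u=\nabla\cdot(|\nabla u|^{p-2}\nabla u)$ with gradient and divergence in the space variable. A (weak) solution to $\partial_t u-\Delta_p u=0$ in $E\times(0,T)$ is a function $u\in L^p_{\rm loc}(0,T;W^{1,p}_{\rm loc}(E))$ with $$\int_{E\times(0,T)}\left(-u\,\partial_t\phi+|\nabla u|^{p-2}\nabla u\cdot\nabla\phi\right)dx\,dt=0\quad\text{for all }\phi\in C_0^\infty(E\times(0,T));$$ solutions are identified with their continuous representative. $B(w,r)$ is the open Euclidean ball. *)

(* Defs.v *)
From HB Require Import structures.
From mathcomp Require Import all_boot all_order all_algebra.
From mathcomp Require Import all_classical all_reals all_analysis.

Set Implicit Arguments.
Unset Strict Implicit.
Unset Printing Implicit Defensive.

Import Order.TTheory GRing.Theory Num.Theory.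
Import numFieldNormedType.Exports.

Local Open Scope classical_set_scope.
Local Open Scope ring_scope.

(* Borel sigma-algebra of R^n, generated by the coordinates as for tuples. *)
Definition rV_display : measure_display.
Proof. exact: default_measure_display. Qed.

Section measurable_rV.
Context {R : realType} {n : nat}.

Let coor : 'I_n -> 'rV[R]_n -> R := fun i x => x ord0 i.

Let rV_set0 : g_sigma_preimage coor set0.
Proof. exact: sigma_algebra0. Qed.

Let rV_setC A : g_sigma_preimage coor A -> g_sigma_preimage coor (~` A).
Proof. exact: sigma_algebraC. Qed.

Let rV_bigcup (F : (set 'rV[R]_n)^nat) :
  (forall i, g_sigma_preimage coor (F i)) ->
  g_sigma_preimage coor (\bigcup_i (F i)).
Proof. exact: sigma_algebra_bigcup. Qed.

HB.instance Definition _ := @isMeasurable.Build rV_display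
  'rV[R]_n (g_sigma_preimage coor) rV_set0 rV_setC rV_bigcup.

Lemma measurable_coord (i : 'I_n) :
  measurable_fun [set: 'rV[R]_n] (fun x => x ord0 i : R).
Proof.
move=> _ Y mY; rewrite setTI; apply: sub_sigma_algebra => /=.
rewrite -bigcup_seq/=; exists i => /=; first by rewrite mem_index_enum.
by exists Y => //; rewrite setTI.
Qed.

Lemma measurable_fun_rV d (T : measurableType d) (f : T -> 'rV[R]_n) :
  (forall i, measurable_fun [set: T] (fun t => f t ord0 i : R)) ->
  measurable_fun [set: T] f.
Proof.
move=> mf; apply: (@measurability _ _ _ _ _ f
  (\big[setU/set0]_(i < n) preimage_set_system setT (coor i) measurable)) => //.
move=> _ [B + <-]; rewrite -bigcup_seq => -[i _ [C mC <-]].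
by rewrite setTI; apply: (mf i).
Qed.

End measurable_rV.

(* The library's canonical sigma-finite structure on [m1 \x m2] is only found
   for subprobabilities, hence this direct proof. *)
Lemma product_sigma_finite d1 d2 (T1 : measurableType d1)
    (T2 : measurableType d2) (R : realType)
    (m1 : {sigma_finite_measure set T1 -> \bar R})
    (m2 : {sigma_finite_measure set T2 -> \bar R}) :
  sigma_finite setT (m1 \x m2)%E.
Proof.
have /sigma_finiteP[F [TF ndF Foo]] := sigma_finiteT m1.
have /sigma_finiteP[G [TG ndG Goo]] := sigma_finiteT m2.
exists (fun n => F n `*` G n).
  rewrite -setXTT TF TG predeqE => -[x y]; split.
    move=> [/= [n _ Fnx] [k _ Gky]]; exists (maxn n k) => //; split.
    - by move: x Fnx; exact/subsetPset/ndF/leq_maxl.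
    - by move: y Gky; exact/subsetPset/ndG/leq_maxr.
  by move=> [n _ []/= ? ?]; split; exists n.
move=> k; have [? ?] := Foo k; have [? ?] := Goo k.
split; first exact: measurableX.
by rewrite product_measure1E// lte_mul_pinfty// ge0_fin_numE.
Qed.

Section lebesgue_rV.
Context {R : realType}.

Definition rV_cons n (x : R * 'rV[R]_n) : 'rV[R]_n.+1 :=
  row_mx (x.1%:M : 'rV_1) x.2.

Definition rV_uncons n (y : 'rV[R]_n.+1) : R * 'rV[R]_n :=
  (y ord0 ord0, rsubmx (y : 'rV_(1 + n))).

Lemma rV_consK n : cancel (@rV_cons n) (@rV_uncons n).
Proof.
move=> [a x]; rewrite /rV_uncons /rV_cons row_mxKr; congr (_, _).
have -> : ord0 = lshift n ord0 :> 'I_(1 + n) by exact/val_inj.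
by rewrite (@row_mxEl _ 1 1 n) mxE eqxx.
Qed.

Lemma measurable_rV_cons n :
  measurable_fun [set: (measurableTypeR R * 'rV[R]_n)%type] (@rV_cons n).
Proof.
apply: measurable_fun_rV => i; rewrite /rV_cons.
case: (@split_ordP 1 n i) => j ->.
- apply: (eq_measurable_fun fst) => //.
  by move=> x _; rewrite (@row_mxEl _ 1 1 n) mxE (ord1 j).
- apply: (eq_measurable_fun (fun x : measurableTypeR R * 'rV[R]_n => x.2 ord0 j : R)).
    by move=> x _; rewrite (@row_mxEr _ 1 1 n).
  exact: (measurableT_comp (measurable_coord j)).
Qed.

Lemma measurable_rV_uncons n :
  measurable_fun [set: 'rV[R]_n.+1]
    (@rV_uncons n : _ -> (measurableTypeR R * 'rV[R]_n)%type).
Proof.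
apply: measurable_fun_pair; first exact: measurable_coord.
apply: measurable_fun_rV => i.
apply: (eq_measurable_fun (fun y : 'rV[R]_n.+1 => y ord0 (rshift 1 i) : R)).
  by move=> y _; rewrite mxE.
exact: measurable_coord.
Qed.

Section step.
Variables (n : nat) (mu : {sigma_finite_measure set 'rV[R]_n -> \bar R}).

Let mf := @measurable_rV_cons n.

Definition rV_measureS : set 'rV[R]_n.+1 -> \bar R :=
  pushforward (@lebesgue_measure R \x mu)%E (@rV_cons n).

Let mu0 : rV_measureS set0 = 0%E.
Proof. by rewrite /rV_measureS /pushforward preimage_set0 measure0. Qed.

Let mu_ge0 A : (0 <= rV_measureS A)%E.
Proof. by rewrite /rV_measureS /pushforward; exact: measure_ge0. Qed.

Let mu_sigma_additive : semi_sigma_additive rV_measureS.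
Proof.
rewrite /rV_measureS.
exact: measure_semi_sigma_additive.
Qed.

HB.instance Definition _ := isMeasure.Build _ _ _ rV_measureS
  mu0 mu_ge0 mu_sigma_additive.

Let mu_sigma_finite : sigma_finite setT rV_measureS.
Proof.
have [F FT Foo] := product_sigma_finite (@lebesgue_measure R) mu.
exists (fun i => @rV_uncons n @^-1` F i).
  by rewrite -preimage_bigcup -FT preimage_setT.
move=> i; have [mF Foo_i] := Foo i; split.
  by rewrite -[X in measurable X]setTI; exact: measurable_rV_uncons.
rewrite /rV_measureS /pushforward -comp_preimage.
rewrite [X in X @^-1` _](_ : _ = id) ?preimage_id//.
by apply/funext => x /=; rewrite rV_consK.
Qed.

HB.instance Definition _ := Measure_isSigmaFinite.Build _ _ _ rV_measureS
  mu_sigma_finite.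

End step.

Fixpoint lebesgue_rV n : {sigma_finite_measure set 'rV[R]_n -> \bar R} :=
  if n is m.+1 then rV_measureS (lebesgue_rV m) else \d_(0 : 'rV[R]_0).

End lebesgue_rV.

(* The norm and balls of the library on ['rV_n] are those of the sup norm; the
   Euclidean ones are given here. The topologies and the notions of bounded set
   coincide. *)
Section euclidean.
Context {R : realType} {n : nat}.
Implicit Types (x w : 'rV[R]_n) (r : R).

Definition enorm x : R := Num.sqrt (\sum_(i < n) x ord0 i ^+ 2).

Definition eball w r : set 'rV[R]_n := [set x | enorm (x - w) < r].

End euclidean.

Definition boundary {X : topologicalType} (A : set X) : set X :=
  closure A `\` A^°.

Definition domain {X : topologicalType} (A : set X) : Prop :=
  [/\ A !=set0, open A & connected A].

Section test_functions.
Context {R : realType} {V : normedModType R}.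
Implicit Types (f phi : V -> R) (U : set V).

Fixpoint Ck (k : nat) f : Prop :=
  continuous f /\
  if k is k'.+1 then
    forall v : V, (forall x, derivable f x v) /\ Ck k' ('D_v f)
  else True.

Definition smooth f : Prop := forall k, Ck k f.

Definition tsupport f : set V := closure [set x | f x != 0].

(* Functions of C_0^oo(U), extended by zero to the whole space. *)
Definition test_function U phi : Prop :=
  [/\ smooth phi, compact (tsupport phi) & tsupport phi `<=` U].

End test_functions.

Section parabolic_p_laplace.
Context {R : realType} {n : nat}.

Definition dspace_time : set ('rV[R]_n * measurableTypeR R) -> \bar R :=
  (lebesgue_rV n \x @lebesgue_measure R)%E.

HB.instance Definition _ := Measure.on dspace_time.

Definition Lp_loc (p : R) (U : set 'rV[R]_n) (f : 'rV[R]_n -> R) : Prop :=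
  forall K, compact K -> K `<=` U ->
    measurable_fun K f /\
    (\int[lebesgue_rV n]_(x in K) (`|f x| `^ p)%:E < +oo)%E.

Definition weak_gradient (U : set 'rV[R]_n) (f : 'rV[R]_n -> R)
    (g : 'rV[R]_n -> 'rV[R]_n) : Prop :=
  forall (i : 'I_n) (phi : 'rV[R]_n -> R), test_function U phi ->
    (\int[lebesgue_rV n]_(x in U) (f x * 'D_(delta_mx ord0 i) phi x)%:E =
     - \int[lebesgue_rV n]_(x in U) (g x ord0 i * phi x)%:E)%E.

(* [f] belongs to W^{1,p}_loc(U) and [g] is its weak gradient. *)
Definition W1p_loc (p : R) (U : set 'rV[R]_n) (f : 'rV[R]_n -> R)
    (g : 'rV[R]_n -> 'rV[R]_n) : Prop :=
  [/\ Lp_loc p U f,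
      forall i, Lp_loc p U (fun x => g x ord0 i) &
      weak_gradient U f g].

(* [u] belongs to L^p_loc(0,T; W^{1,p}_loc(U)) and [Du] is its weak gradient in
   the space variable; Bochner measurability is expressed, as usual, by joint
   measurability of [u] and [Du]. *)
Definition Lp_loc_W1p_loc (p : R) (U : set 'rV[R]_n) (T : R)
    (u : 'rV[R]_n * R -> R) (Du : 'rV[R]_n * R -> 'rV[R]_n) : Prop :=
  [/\ measurable_fun (U `*` `]0, T[) u,
      forall i, measurable_fun (U `*` `]0, T[) (fun z => Du z ord0 i : R),
      {ae @lebesgue_measure R, forall t, 0 < t < T ->
        W1p_loc p U (fun x => u (x, t)) (fun x => Du (x, t))} &
      forall (K : set 'rV[R]_n) (t1 t2 : R), compact K -> K `<=` U ->
        0 < t1 -> t2 < T ->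
        (\int[dspace_time]_(z in K `*` `[t1, t2])
          (`|u z| `^ p + enorm (Du z) `^ p)%:E < +oo)%E].

(* d/dt u - div (|Du|^(p-2) Du) = 0 in U x (0, T) *)
Definition p_parabolic_solution (p : R) (U : set 'rV[R]_n) (T : R)
    (u : 'rV[R]_n * R -> R) : Prop :=
  exists2 Du : 'rV[R]_n * R -> 'rV[R]_n,
    Lp_loc_W1p_loc p U T u Du &
    forall phi : 'rV[R]_n * R -> R, test_function (U `*` `]0, T[) phi ->
      (\int[dspace_time]_(z in U `*` `]0%R, T[)
        (- u z * 'D_(0, 1) phi z +
         enorm (Du z) `^ (p - 2) *
           \sum_(i < n) Du z ord0 i * 'D_(delta_mx ord0 i, 0) phi z)%:E = 0)%E.

End parabolic_p_laplace.

(* Main.v *)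
(* The barrier [v(x,t) = M (1 + t / That) (|x-w| / r)^delta + eps] is a
   classical supersolution for [t <= That] because [delta >= p / (p - 2)], and
   [u <= v] on the parabolic boundary of [E_T]; it remains to compare a weak
   solution with a classical supersolution.

   Testing the equation against kernels [eta_h(. - z)] shows that the averages
   [u_h], [a_h], [F_h] of [u], [a = Du] and [F = |Du|^(p-2) Du] satisfy
   [d_t u_h = div F_h] and [grad u_h = a_h] near the contact set
   [{u >= v, t <= tau}], which is compact in [E_T]. One then integrates
   [d_t ((u_h - v)_+^3 (tau - t)_+^2)] and
   [div (3 (u_h - v)_+^2 (tau - t)_+^2 (F_h - F(grad v)))] over a neighbourhood
   of that set. The only sign that mollification destroys is that of
   [(a_h - xi) . (F_h - F(xi))]; its failure is controlled by averaging the
   monotonicity of the flux over two independent points, the error being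
   [(a(y) - a(y')) . (F(y) - F(y'))] for [y], [y'] close together, which is small
   in the mean because continuous functions are dense in L1. *)

Require Import Defs.
From HB Require Import structures.
From mathcomp Require Import all_boot all_order all_algebra.
From mathcomp Require Import all_classical all_reals all_analysis.
From mathcomp Require Import finmap measurable_realfun ring lra.

Set Implicit Arguments.
Unset Strict Implicit.
Unset Printing Implicit Defensive.

Import Order.TTheory GRing.Theory Num.Theory.
Import numFieldNormedType.Exports.

Local Open Scope classical_set_scope.
Local Open Scope ring_scope.

(** * Translation invariance and Borel sets of space-time *)

(** The weak formulation accepts only smooth test functions and gives no time derivative of [u], so
    (u - v)_+ cannot be inserted in it. Mollifying in all variables at once leaves pointwise
    identities between C^1 functions; but the flux is nonlinear, so F_h is not the flux of a_h. The
    square is the smallest integer power of a positive part that is C^1, and the cube is its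
    primitive up to a factor. The weight (tau - t)_+^2 removes the times after tau, and its decrease
    produces the term 2 (u_h - v)_+^3 (tau - t)_+, whose integral is forced to be small although it
    stays bounded below if u > v somewhere. The eps makes the inequality on the parabolic boundary
    strict, which keeps the contact set away from it. The barrier is smooth in the cylinder because
    its centre w, a boundary point of an open set, is outside Omega. The condition on delta is a
    count of powers of |x - w|: v_t carries the power delta, the divergence of the flux of grad v
    the power (delta - 1)(p - 1) - 1, and the difference delta (p - 2) - p of the two must be
    nonnegative for their quotient to stay bounded near w. *)

Lemma pushforward_product d1 d2 (T1 : measurableType d1)
    (T2 : measurableType d2) (R : realType)
    (m1 : {sigma_finite_measure set T1 -> \bar R})
    (m2 : {sigma_finite_measure set T2 -> \bar R})
    (f1 : T1 -> T1) (f2 : T2 -> T2) :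
  measurable_fun setT f1 -> measurable_fun setT f2 ->
  (forall A, measurable A -> m1 (f1 @^-1` A) = m1 A) ->
  (forall A, measurable A -> m2 (f2 @^-1` A) = m2 A) ->
  forall A, measurable A ->
  (m1 \x m2)%E ((fun z => (f1 z.1, f2 z.2)) @^-1` A) = (m1 \x m2)%E A.
Proof.
move=> mf1 mf2 f1m f2m A mA.
pose f (z : T1 * T2) := (f1 z.1, f2 z.2).
have mf : measurable_fun setT f.
  by apply: measurable_fun_pair; apply: measurableT_comp.
pose g : {mfun (T1 * T2)%type >-> (T1 * T2)%type} :=
  HB.pack f (isMeasurableFun.Build _ _ _ _ f mf).
(* By uniqueness of the product measure it is enough to compare the two measures on rectangles. *)
rewrite [RHS](@product_measure_unique _ _ _ _ _ m1 m2
  (pushforward (m1 \x m2)%E g : {measure set (T1 * T2) -> \bar R}))//.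
move=> B C mB mC; rewrite /pushforward /=.
have mB1 : measurable (f1 @^-1` B).
  by rewrite -[X in measurable X]setTI; exact: mf1.
have mC2 : measurable (f2 @^-1` C).
  by rewrite -[X in measurable X]setTI; exact: mf2.
transitivity ((m1 \x m2)%E ((f1 @^-1` B) `*` (f2 @^-1` C))) => //.
by rewrite product_measure1E//; congr (_ * _)%E; [exact: f1m|exact: f2m].
Qed.

Lemma ge0_integral_preserving d (T : measurableType d) (R : realType)
    (mu : {measure set T -> \bar R}) (g : T -> T) (f : T -> \bar R) :
  measurable_fun setT g ->
  (forall A, measurable A -> mu (g @^-1` A) = mu A) ->
  measurable_fun setT f -> (forall z, 0 <= f z)%E ->
  (\int[mu]_z f (g z) = \int[mu]_z f z)%E.
Proof.
move=> mg gmu mf f0.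
pose h : {mfun T >-> T} := HB.pack g (isMeasurableFun.Build _ _ _ _ g mg).
transitivity (\int[pushforward mu h]_z f z)%E.
  by rewrite ge0_integral_pushforward// ?preimage_setT.
by apply: eq_measure_integral => A mA _; exact: gmu.
Qed.

Section translation.
Context {R : realType}.

Lemma lebesgue_measure_translate (a : R) (A : set R) : measurable A ->
  @lebesgue_measure R ((fun x => x + a) @^-1` A) = @lebesgue_measure R A.
Proof.
move=> mA.
pose f (x : measurableTypeR R) : measurableTypeR R := x + a.
have mf : measurable_fun setT f by exact: measurable_funD.
pose g : {mfun (measurableTypeR R) >-> (measurableTypeR R)} :=
  HB.pack f (isMeasurableFun.Build _ _ _ _ f mf).
rewrite [RHS](@lebesgue_measure_unique R
  (pushforward lebesgue_measure g : {measure set (measurableTypeR R) -> \bar R}))//.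
move=> _ [[b c] /= bc <-]; rewrite /pushforward /=.
rewrite (_ : f @^-1` _ = `](b - a), (c - a)]%classic); last first.
  by apply/seteqP; split => x /=; rewrite !in_itv/= /f => /andP[? ?]; apply/andP; split; lra.
rewrite !lebesgue_measure_itv/= !lte_fin ltrBlDr subrK.
by case: ifP => // _; rewrite -!EFinD; congr EFin; lra.
Qed.

Lemma measurable_translate n (a : 'rV[R]_n) :
  measurable_fun setT (fun x : 'rV[R]_n => x + a).
Proof.
apply: measurable_fun_rV => i.
apply: (eq_measurable_fun (fun x : 'rV[R]_n => x ord0 i + a ord0 i : R)).
  by move=> x _; rewrite mxE.
by apply: measurable_funD => //; exact: measurable_coord.
Qed.

(** Through [rV_cons], a translation of R^(n+1) is the product of one of R and one of R^n, so
    [pushforward_product] carries the induction. *)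
Lemma lebesgue_rV_translate n (a : 'rV[R]_n) (A : set 'rV[R]_n) :
  measurable A ->
  lebesgue_rV n ((fun x => x + a) @^-1` A) = lebesgue_rV n A.
Proof.
elim: n a A => [|n IH] a A mA.
  congr (lebesgue_rV 0 _).
  by apply/seteqP; split=> x /=; rewrite (_ : x + a = x)//; apply/rowP; case.
rewrite /= /rV_measureS /pushforward.
pose f1 (x : measurableTypeR R) : measurableTypeR R := x + a ord0 ord0.
pose f2 (x : 'rV[R]_n) := x + rsubmx (a : 'rV_(1 + n)).
rewrite -[RHS](@pushforward_product _ _ _ _ _ (@lebesgue_measure R)
  (lebesgue_rV n) f1 f2).
- have E z : rV_cons (f1 z.1, f2 z.2) = rV_cons z + a.
    rewrite /rV_cons /f1 /f2 /=; apply/rowP => i; rewrite [RHS]mxE.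
    case: (@split_ordP 1 n i) => j ->.
      rewrite !(@row_mxEl _ 1 1 n) !mxE (ord1 j) eqxx /= !mulr1n.
      by congr (_ + a _ _); apply/val_inj.
    by rewrite !(@row_mxEr _ 1 1 n) !mxE.
  by congr ((_ \x _)%E _); apply/funext => z; rewrite /preimage/= -E.
- exact: measurable_funD.
- exact: measurable_translate.
- by move=> B mB; exact: lebesgue_measure_translate.
- exact: IH.
- rewrite -[X in measurable X]setTI; exact: measurable_rV_cons.
Qed.

End translation.

Section space_time.
Context {R : realType} {n : nat}.
Notation Z := ('rV[R]_n * measurableTypeR R)%type.

Let spacetime_sigma_finite : sigma_finite setT (@dspace_time R n).
Proof. exact: product_sigma_finite. Qed.

HB.instance Definition _ := Measure_isSigmaFinite.Build _ _ _
  (@dspace_time R n) spacetime_sigma_finite.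

Lemma measurable_spacetime_translate (a : Z) :
  measurable_fun setT (fun z : Z => (z + a : Z)).
Proof.
apply: measurable_fun_pair.
  exact: (measurableT_comp (measurable_translate a.1) (@measurable_fst _ _ _ _)).
by apply: measurable_funD => //; exact: measurable_snd.
Qed.

Lemma dspace_time_translate (a : Z) (A : set Z) : measurable A ->
  dspace_time ((fun z => z + a) @^-1` A) = dspace_time A.
Proof.
move=> mA.
rewrite /dspace_time -[RHS](@pushforward_product _ _ _ _ _ (lebesgue_rV n)
  (@lebesgue_measure R) (fun x => x + a.1) (fun t => t + a.2))//.
- exact: measurable_translate.
- exact: measurable_funD.
- by move=> B mB; exact: lebesgue_rV_translate.
- by move=> B mB; exact: lebesgue_measure_translate.
Qed.

Lemma ge0_integral_translate (a : Z) (f : Z -> \bar R) :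
  measurable_fun setT f -> (forall z, 0 <= f z)%E ->
  (\int[dspace_time]_z f (z + a)%R = \int[dspace_time]_z f z)%E.
Proof.
move=> mf f0.
exact: (ge0_integral_preserving (measurable_spacetime_translate a)
  (dspace_time_translate a) mf f0).
Qed.

End space_time.

Section open_sets.
Context {R : realType}.

Lemma measurable_ball_rV n (x : 'rV[R]_n) e : measurable (ball x e).
Proof.
have [e0|e0] := lerP e 0.
  rewrite (_ : ball x e = set0)//; apply/seteqP; split => // y [].
  by rewrite ltNge e0.
rewrite (_ : ball x e = \bigcap_(i in [set: 'I_n])
  ((fun y : 'rV[R]_n => y ord0 i) @^-1` ball (x ord0 i) e)); last first.
  apply/seteqP; split => y /=; first by case=> _ H i _; exact: H.
  by move=> H; split => // i j; rewrite (ord1 i); exact: H.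
apply: fin_bigcap_measurable => [|i _]; first exact: finite_finset.
rewrite -[X in measurable X]setTI; apply: measurable_coord => //.
exact: measurable_ball.
Qed.

(** Sup-norm balls are cubes, so their volume is exact. It serves to show that balls have finite and
    positive measure. *)
Lemma lebesgue_rV_ball n (x : 'rV[R]_n) e : 0 < e ->
  lebesgue_rV n (ball x e) = ((e *+ 2) ^+ n)%:E.
Proof.
move=> e0; elim: n x => [|n IH] x.
  rewrite expr0 /= diracE mem_set//; split => // i [].
  by case.
rewrite /= /rV_measureS /pushforward.
rewrite (_ : _ @^-1` _ = ball (x ord0 ord0) e `*`
  ball (rsubmx (x : 'rV_(1 + n))) e); last first.
  have E : x = rV_cons (x ord0 ord0, rsubmx (x : 'rV_(1 + n))).
    apply/rowP => i; rewrite /rV_cons.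
    case: (@split_ordP 1 n i) => j ->.
      rewrite (@row_mxEl _ 1 1 n) mxE (ord1 j) eqxx mulr1n.
      by congr (x _ _); exact/val_inj.
    by rewrite (@row_mxEr _ 1 1 n) mxE.
  apply/seteqP; split => -[a y] /=.
    case=> _ H; split => /=.
      have := H ord0 (lshift n (ord0 : 'I_1)); rewrite /rV_cons (@row_mxEl _ 1 1 n) mxE eqxx.
      by rewrite (_ : lshift n (ord0 : 'I_1) = ord0)//; exact/val_inj.
    split => // i j; rewrite (ord1 i).
    have := H ord0 (rshift 1 j); rewrite /rV_cons (@row_mxEr _ 1 1 n).
    by rewrite mxE.
  move=> [/= Ha [_ Hy]]; split => // i j; rewrite (ord1 i) {}[in X in ball X]E.
  rewrite /rV_cons; case: (@split_ordP 1 n j) => k ->.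
    by rewrite !(@row_mxEl _ 1 1 n) !mxE (ord1 k) eqxx !mulr1n.
  by rewrite !(@row_mxEr _ 1 1 n); exact: Hy.
rewrite product_measure1E; last 2 first.
- exact: measurable_ball.
- exact: measurable_ball_rV.
rewrite [X in (X * _)%E]lebesgue_measure_ball ?ltW//.
rewrite [X in (_ * X)%E](IH (rsubmx (x : 'rV_(1 + n)))).
by rewrite -EFinM exprS.
Qed.

End open_sets.

Section open_sets_space_time.
Context {R : realType} {n : nat}.
Notation Z := ('rV[R]_n * R)%type.

Lemma dspace_time_ball (z : Z) e : 0 < e ->
  dspace_time (ball z e) = ((e *+ 2) ^+ n.+1)%:E.
Proof.
move=> e0; rewrite /dspace_time (_ : ball z e = ball z.1 e `*` ball z.2 e)//.
rewrite product_measure1E; last 2 first.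
- exact: measurable_ball_rV.
- exact: measurable_ball.
rewrite [X in (_ * X)%E]lebesgue_measure_ball ?ltW//.
by rewrite [X in (X * _)%E]lebesgue_rV_ball// -EFinM exprSr.
Qed.

Lemma measurable_ball_spacetime (z : Z) e :
  measurable (ball z e : set ('rV[R]_n * measurableTypeR R)).
Proof.
rewrite (_ : ball z e = ball z.1 e `*` ball z.2 e)//.
by apply: measurableX; [exact: measurable_ball_rV|exact: measurable_ball].
Qed.

(** The sigma-algebra is the one generated by coordinates; it contains the open sets because each is
    a countable union of balls with rational centres and radii 1/(k+1). *)
Lemma open_measurable_spacetime (U : set Z) : open U ->
  measurable (U : set ('rV[R]_n * measurableTypeR R)).
Proof.
move=> oU.
pose q (a : 'rV[rat]_n * rat * nat) : Z := (map_mx ratr a.1.1, ratr a.1.2).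
pose B a := if `[< ball (q a) a.2.+1%:R^-1 `<=` U >]
  then ball (q a) a.2.+1%:R^-1 else set0.
rewrite (_ : U = \bigcup_a B a); last first.
  apply/seteqP; split => z; last first.
    by move=> [a _]; rewrite /B; case: ifPn => // /asboolP; apply.
  move=> Uz; have /nbhs_ballP[e /= e0 eU] := open_nbhs_nbhs (conj oU Uz).
  (* A ball around a rational centre that contains z lies in the ball of twice its radius around z;
     hence the half. *)
  have /ltr_add_invr[k] : 0 < e / 2 by rewrite divr_gt0.
  rewrite add0r => ke.
  have k0 : 0 < k.+1%:R^-1 :> R by rewrite invr_gt0.
  have Q (x : R) : exists r : rat, ball (ratr r : R) k.+1%:R^-1 x.
    have [|r] := @rat_in_itvoo R (x - k.+1%:R^-1) (x + k.+1%:R^-1).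
      by rewrite ltrD2l gtrN.
    rewrite in_itv/= => /andP[xr rx]; exists r.
    by rewrite ball_itv/= in_itv/= ltrBlDr rx -ltrBlDr xr.
  have [f Hf] := choice Q.
  pose a : 'rV[rat]_n * rat * nat := (\row_i f (z.1 ord0 i), f z.2, k).
  have za : ball (q a) k.+1%:R^-1 z.
    split => /=; last exact: Hf.
    by split => // i j; rewrite !mxE (ord1 i); exact: Hf.
  exists a => //; rewrite /B; case: asboolP => // -[] y ay.
  apply: eU; apply: (@le_ball _ _ _ (k.+1%:R^-1 + k.+1%:R^-1)).
    by rewrite [leRHS]splitr lerD ?ltW.
  by apply: ball_triangle ay; exact: ball_sym.
apply: countable_bigcupT_measurable => // a; rewrite /B; case: ifP => _.
  exact: measurable_ball_spacetime.
exact: measurable0.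
Qed.

Lemma closed_measurable_spacetime (U : set Z) : closed U ->
  measurable (U : set ('rV[R]_n * measurableTypeR R)).
Proof.
move=> cU; rewrite -[X in measurable X]setCK; apply: measurableC.
by apply: open_measurable_spacetime; exact: closed_openC.
Qed.

Lemma compact_measurable_spacetime (U : set Z) : compact U ->
  measurable (U : set ('rV[R]_n * measurableTypeR R)).
Proof.
move=> cU; apply: closed_measurable_spacetime.
by apply: compact_closed => //; exact: norm_hausdorff.
Qed.

Lemma compact_spacetime_lty (K : set Z) : compact K ->
  (dspace_time K < +oo)%E.
Proof.
move=> cK; have [M [_ MK]] := compact_bounded cK.
have KB : K `<=` ball (0 : Z) (`|M| + 2).
  move=> z Kz; rewrite -ball_normE /ball_/= sub0r normrN.
  rewrite (@le_lt_trans _ _ (`|M| + 1)) ?ltrD2l ?ltr1n//.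
  by apply: (MK _ _ z Kz); rewrite (le_lt_trans (ler_norm M))// ltrDl.
apply: (@le_lt_trans _ _ (dspace_time (ball (0 : Z) (`|M| + 2)))).
  apply: le_measure => //; apply: mem_set.
    exact: compact_measurable_spacetime.
  exact: measurable_ball_spacetime.
rewrite dspace_time_ball ?ltry//.
Qed.

Lemma continuous_measurable_spacetime (f : Z -> R) : continuous f ->
  measurable_fun setT (f : 'rV[R]_n * measurableTypeR R -> measurableTypeR R).
Proof.
move=> cf; apply: (measurability _ (RGenOpens.measurableE R)) => /=.
move=> _ [_ [a [b ->] <-]]; rewrite setTI; apply: open_measurable_spacetime.
by move/continuousP : cf; apply; exact: interval_open.
Qed.

End open_sets_space_time.

(** * Continuous functions are dense in L1 *)

Section L1_approximation.
Context d (T : measurableType d) (R : realType).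
Variables (mu : {measure set T -> \bar R}) (D : set T) (C : set (T -> R)).
Hypotheses (mD : measurable D) (Dfin : (mu D < +oo)%E).
Hypothesis Cm : forall f, C f -> measurable_fun setT f.
Hypothesis Ccst : forall k, C (cst k).
Hypothesis CD : forall f g, C f -> C g -> C (fun z => f z + g z).
Hypothesis CZ : forall k f, C f -> C (fun z => k * f z).
Hypothesis Cmax : forall f g, C f -> C g -> C (fun z => Num.max (f z) (g z)).

(** Membership in the L1 closure of [C] over [D]. The hypotheses make [C] a vector lattice with
    constants, the setting in which approximability spreads from the generators of the sigma-algebra
    to all integrable functions. *)
Definition L1approx (f : T -> R) := forall e, 0 < e ->
  exists2 g, C g & (\int[mu]_(z in D) (`|f z - g z|)%:E <= e%:E)%E.

Let mdist (f g : T -> R) (E : set T) :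
  measurable_fun setT f -> measurable_fun setT g ->
  measurable_fun E (fun z => (`|f z - g z|)%:E).
Proof.
move=> mf mg; apply/measurable_EFinP; apply: measurable_funTS.
by apply: measurableT_comp => //; exact: measurable_funB.
Qed.

Let integral_dist_le (f g f' g' h : T -> R) (a b : R) :
  measurable_fun setT f -> measurable_fun setT g ->
  measurable_fun setT f' -> measurable_fun setT g' ->
  measurable_fun setT h ->
  (forall z, D z -> `|h z| <= `|f z - g z| + `|f' z - g' z|) ->
  (\int[mu]_(z in D) (`|f z - g z|)%:E <= a%:E)%E ->
  (\int[mu]_(z in D) (`|f' z - g' z|)%:E <= b%:E)%E ->
  (\int[mu]_(z in D) (`|h z|)%:E <= (a + b)%:E)%E.
Proof.
move=> mf mg mf' mg' mh H fa gb; rewrite EFinD; apply: le_trans (leeD fa gb).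
rewrite -ge0_integralD//; [|exact: mdist|exact: mdist].
apply: ge0_le_integral => //.
- by apply/measurable_EFinP; apply: measurable_funTS; exact: measurableT_comp.
- by apply: emeasurable_funD; exact: mdist.
Qed.

Lemma L1approx_trans (f : T -> R) : measurable_fun setT f ->
  (forall e, 0 < e -> exists g, [/\ measurable_fun setT g, L1approx g &
    (\int[mu]_(z in D) (`|f z - g z|)%:E <= e%:E)%E]) ->
  L1approx f.
Proof.
move=> mf H e e0; have e20 : 0 < e / 2 by rewrite divr_gt0.
have [g [mg /(_ _ e20)[h Ch gh] fg]] := H _ e20; exists h => //.
rewrite (splitr e); apply: (integral_dist_le (f := f) (g := g) (f' := g) (g' := h)
  (h := fun z => f z - h z)) => //; try exact: Cm.
- by apply: measurable_funB => //; exact: Cm.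
- by move=> z _; rewrite (le_trans _ (ler_normD _ _))// addrA subrK.
Qed.

Lemma L1approxD (f g : T -> R) :
  measurable_fun setT f -> measurable_fun setT g ->
  L1approx f -> L1approx g -> L1approx (fun z => f z + g z).
Proof.
move=> mf mg H1 H2 e e0; have e20 : 0 < e / 2 by rewrite divr_gt0.
have [f' Cf ff] := H1 _ e20; have [g' Cg gg] := H2 _ e20.
exists (fun z => f' z + g' z); first exact: CD.
rewrite (splitr e); apply: (integral_dist_le (f := f) (g := f') (f' := g) (g' := g')
  (h := fun z => f z + g z - (f' z + g' z))) => //; try exact: Cm.
- apply: measurable_funB; apply: measurable_funD => //; exact: Cm.
- by move=> z _; rewrite opprD addrACA ler_normD.
Qed.

Lemma L1approx_max (f g : T -> R) :
  measurable_fun setT f -> measurable_fun setT g ->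
  L1approx f -> L1approx g -> L1approx (fun z => Num.max (f z) (g z)).
Proof.
move=> mf mg H1 H2 e e0; have e20 : 0 < e / 2 by rewrite divr_gt0.
have [f' Cf ff] := H1 _ e20; have [g' Cg gg] := H2 _ e20.
exists (fun z => Num.max (f' z) (g' z)); first exact: Cmax.
rewrite (splitr e); apply: (integral_dist_le (f := f) (g := f') (f' := g) (g' := g')
  (h := fun z => Num.max (f z) (g z) - Num.max (f' z) (g' z))) => //;
  try exact: Cm.
- apply: measurable_funB; apply: measurable_maxr => //; exact: Cm.
- move=> z _; have := ler_norm (f z - f' z); have := ler_norm (g z - g' z).
  have := lerNnormlW (lexx `|f z - f' z|); have := lerNnormlW (lexx `|g z - g' z|).
  rewrite ler_norml /Num.max; case: ifPn; case: ifPn; rewrite -?leNgt => *;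
    apply/andP; split; lra.
Qed.

Lemma L1approxZ k (f : T -> R) : measurable_fun setT f ->
  L1approx f -> L1approx (fun z => k * f z).
Proof.
move=> mf H e e0; have k0 : 0 < `|k| + 1 by rewrite ltr_wpDl.
have /H[g Cg fg] : 0 < e / (`|k| + 1) by rewrite divr_gt0.
exists (fun z => k * g z); first exact: CZ.
under eq_integral do rewrite -mulrBr normrM EFinM.
rewrite ge0_integralZl//; first last.
  by apply: mdist => //; exact: Cm.
apply: (@le_trans _ _ ((`|k| + 1)%:E * (e / (`|k| + 1))%:E)%E).
  apply: lee_pmul => //; last by rewrite lee_fin lerDl.
  by apply: integral_ge0 => z _; rewrite lee_fin.
by rewrite -EFinM lee_fin mulrCA divff ?mulr1// gt_eqF.
Qed.

Lemma L1approx_cst k : L1approx (cst k).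
Proof.
move=> e e0; exists (cst k) => //.
under eq_integral do rewrite /= subrr normr0.
by rewrite integral0 lee_fin ltW.
Qed.

Lemma L1approx_C f : C f -> L1approx f.
Proof.
move=> Cf e e0; exists f => //.
under eq_integral do rewrite subrr normr0.
by rewrite integral0 lee_fin ltW.
Qed.

Lemma L1approx_sum (I : Type) (s : seq I) (F : I -> T -> R) :
  (forall i, measurable_fun setT (F i)) -> (forall i, L1approx (F i)) ->
  L1approx (fun z => \sum_(i <- s) F i z).
Proof.
move=> mF aF; elim: s => [|i s IH].
  by under eq_fun do rewrite big_nil; exact: L1approx_cst.
under eq_fun do rewrite big_cons; apply: L1approxD => //.
exact: measurable_sum.
Qed.

(** Dominated convergence: the constant [M] is a summable majorant because [D] has finite
    measure. *)
Lemma L1approx_lim (f : T -> R) (F : (T -> R)^nat) (M : R) :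
  measurable_fun setT f -> (forall k, measurable_fun setT (F k)) ->
  (forall k, L1approx (F k)) ->
  (forall z, F ^~ z @ \oo --> f z) -> (forall k z, `|f z - F k z| <= M) ->
  L1approx f.
Proof.
move=> mf mF aF Ff FM; apply: L1approx_trans => // e e0.
have : (fun k => \int[mu]_(z in D) (`|f z - F k z|)%:E)%E @ \oo -->
    (\int[mu]_(z in D) (cst 0 z))%E.
  apply: (@dominated_cvg _ _ _ mu _ mD _ _ (cst M%:E)) => //.
  - by move=> k; exact: mdist.
  - move=> z _; apply: cvg_EFin; first exact: nearW.
    rewrite -(normr0 R) -(subrr (f z)); apply: cvg_norm; apply: cvgB => //.
    exact: cvg_cst.
  - apply/integrableP; split => //.
    rewrite (eq_integral (cst `|M|%:E))// integral_cst//.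
    by rewrite lte_mul_pinfty.
  - by move=> k z _; rewrite /= normr_id lee_fin.
rewrite integral0 => /fine_cvgP[+ /cvgrPdist_le/(_ _ e0)].
move=> /[dup] H [k1 _ Hk1] [k2 _ Hk2].
exists (F (maxn k1 k2)); split => //.
have := Hk2 (maxn k1 k2) (leq_maxr _ _).
rewrite sub0r normrN => /(le_trans (ler_norm _)).
rewrite -lee_fin fineK//; exact: (Hk1 (maxn k1 k2) (leq_maxl _ _)).
Qed.

Definition L1approx_sets : set (set T) :=
  [set A | measurable A /\ L1approx \1_A].

(** Finite unions come from the maximum of two indicators, complements from 1 minus an indicator,
    and countable unions are bounded limits of finite ones. *)
Lemma sigma_algebra_L1approx_sets : sigma_algebra setT L1approx_sets.
Proof.
have mI A : measurable A -> measurable_fun setT (\1_A : T -> R).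
  by move=> mA; exact: measurable_indic.
have aU A B : L1approx_sets A -> L1approx_sets B -> L1approx_sets (A `|` B).
  move=> [mA aA] [mB aB]; split; first exact: measurableU.
  rewrite (_ : \1_(A `|` B) = fun z => Num.max (\1_A z) (\1_B z)).
    by apply: L1approx_max => //; exact: mI.
  apply/funext => z; rewrite !indicE in_setU.
  case: (z \in A); case: (z \in B) => /=; rewrite ?maxxx//.
    by rewrite max_l.
  by rewrite max_r.
split.
- by split => //; rewrite indic0; exact: L1approx_cst.
- move=> A [mA aA]; split; first exact: measurableD.
  rewrite setTD (_ : \1_(~` A) = fun z => cst 1 z + -1 * \1_A z).
    apply: L1approxD => //.
    + by apply: measurable_funM => //; exact: mI.
    + exact: L1approx_cst.
    + by apply: L1approxZ => //; exact: mI.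
  apply/funext => z; rewrite !indicE in_setC.
  by case: (z \in A) => /=; lra.
- move=> A LA; have mA i : measurable (A i) by have [] := LA i.
  have L k : L1approx_sets (\big[setU/set0]_(i < k) A i).
    elim: k => [|k IH]; last by rewrite big_ord_recr; exact: aU.
    by rewrite big_ord0; split => //; rewrite indic0; exact: L1approx_cst.
  have mU : measurable (\bigcup_k A k) by exact: bigcupT_measurable.
  split => //.
  apply: (@L1approx_lim _ (fun k => \1_(\big[setU/set0]_(i < k) A i)) 1).
  + exact: mI.
  + by move=> k; apply: mI; have [] := L k.
  + by move=> k; have [] := L k.
  + move=> z; have [zU|zU] := pselect ((\bigcup_k A k) z).
      have [i _ Aiz] := zU.
      apply: cvg_near_cst; exists i.+1 => // k /= ik.
      rewrite !indicE !mem_set// -bigcup_mkord.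
      by exists i.
    apply: cvg_near_cst; exists 0%N => // k /= _.
    rewrite !indicE !memNset// -bigcup_mkord => -[i _ Aiz].
    by apply: zU; exists i.
  + move=> k z; rewrite !indicE; case: (_ \in _); case: (_ \in _) => /=;
      rewrite ?subrr ?subr0 ?sub0r ?normrN ?normr0 ?normr1//.
Qed.

(** The half-lines ]a, +oo[ generate the Borel sets, and the indicator of {f > a} is the limit of
    the ramps min(1, (k+1) (f - a)_+), which belong to [C]. *)
Lemma L1approx_preimage (f : T -> R) (Y : set R) : C f ->
  measurable Y -> L1approx_sets (f @^-1` Y).
Proof.
move=> Cf mY.
have mf := Cm Cf.
suff : [set Y | L1approx_sets (f @^-1` Y)] Y by [].
have : (@ocitv R).-sigma.-measurable Y := mY.
rewrite RGenOInfty.measurableE.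
apply: smallest_sub.
  have [h1 h2 h3] := sigma_algebra_L1approx_sets.
  split => /=.
  - by rewrite preimage_set0.
  - move=> A /h2; by rewrite !setTD preimage_setC.
  - by move=> A HA; rewrite preimage_bigcup; exact: h3.
move=> _ [a ->] /=; split.
  by rewrite -[X in measurable X]setTI; apply: mf => //; exact: measurable_itv.
(* The ramp of slope k+1, its minimum with 1 written through maxima and opposites, the operations
   under which [C] is closed. *)
pose F k z := - Num.max (- 1) (- Num.max 0 (k.+1%:R * (f z - a))).
have CF k : C (F k).
  have -> : F k = (fun z => -1 * Num.max (cst (- 1) z) (-1 * Num.max (cst 0 z)
      (k.+1%:R * (f z + cst (- a) z)))).
    by apply/funext => z; rewrite /F !mulN1r.
  by apply/CZ/Cmax => //; apply/CZ/Cmax => //; apply/CZ/CD.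
have Fle k z : 0 <= F k z <= 1.
  rewrite /F /Num.max; case: ifPn; case: ifPn; rewrite -?leNgt => *;
    apply/andP; split; lra.
have mS : measurable (f @^-1` `]a, +oo[).
  by rewrite -[X in measurable X]setTI; apply: mf => //; exact: measurable_itv.
apply: (@L1approx_lim _ F 1) => //.
- by move=> k; exact: Cm.
- by move=> k; exact: L1approx_C.
- move=> z; rewrite indicE; have [az|za] := ltP a (f z).
    rewrite mem_set/= ?in_itv/= ?andbT//.
    have fa0 : 0 < f z - a by rewrite subr_gt0.
    have [i _ Hi] := near_infty_natSinv_lt (PosNum fa0).
    apply: cvg_near_cst; exists i => // k /Hi /=.
    rewrite -[X in X < _]mul1r ltr_pdivrMr// mulrC => k1.
    have h : Num.max 0 (k.+1%:R * (f z - a)) = k.+1%:R * (f z - a).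
      by apply/max_r/ltW/(lt_trans ltr01 k1).
    by rewrite /F h max_l ?opprK// lerN2 ltW.
  rewrite memNset/=; last by apply/negP; rewrite in_itv/= andbT -leNgt.
  apply: cvg_near_cst; exists 0%N => // k _ /=.
  have h : Num.max 0 (k.+1%:R * (f z - a)) = 0.
    by apply/max_l; rewrite mulr_ge0_le0// subr_le0.
  by rewrite /F h oppr0 max_r ?oppr0// lerN10.
- move=> k z; rewrite indicE; have /andP[? ?] := Fle k z.
  by rewrite ler_norml; case: (_ \in _) => /=; apply/andP; split; lra.
Qed.

Hypothesis Cgen : forall A, measurable A -> L1approx_sets A.

Import HBSimple.

Lemma L1approx_integrable (f : T -> R) : measurable_fun setT f ->
  mu.-integrable D (EFin \o f) -> L1approx f.
Proof.
move=> mf intf; apply: L1approx_trans => // e e0.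
have [g [_ _ /fine_cvgP[[k1 _ Hk1] /cvgrPdist_le/(_ _ e0)[k2 _ Hk2]]]] :=
  approximation_sfun_integrable mD intf.
exists (g (maxn k1 k2)); split.
- exact: measurable_funP.
- rewrite (_ : SimpleFun.sort _ = fun x => \sum_(y <- fset_set (range (g (maxn k1 k2))))
    y * \1_(g (maxn k1 k2) @^-1` [set y]) x).
    apply: L1approx_sum => y.
      by apply: measurable_funM => //; apply: measurable_indic.
    apply: L1approxZ; first exact: measurable_indic.
    by apply Cgen.
  by apply/funext => x; rewrite fimfunE fsbig_finite.
- have := Hk2 (maxn k1 k2) (leq_maxr _ _).
  rewrite sub0r normrN => /(le_trans (ler_norm _)).
  rewrite -lee_fin fineK//; exact: (Hk1 (maxn k1 k2) (leq_maxl _ _)).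
Qed.

End L1_approximation.

Section density_space_time.
Context {R : realType} {n : nat}.
Notation Z := ('rV[R]_n * R)%type.
Notation mZ := ('rV[R]_n * measurableTypeR R)%type.

Lemma continuous_coord1 (i : 'I_n) : continuous (fun z : Z => z.1 ord0 i : R).
Proof.
move=> z; apply: (@continuous_comp _ _ _ (fst : Z -> 'rV[R]_n)
  (fun x : 'rV[R]_n => x ord0 i)); first exact: cvg_fst.
exact: coord_continuous.
Qed.

(** The product sigma-algebra is generated by preimages under the coordinates, which are continuous,
    so [L1approx_preimage] reaches all generators. *)
Lemma continuous_L1_dense (D : set mZ) (f : mZ -> R) : measurable D ->
  (dspace_time D < +oo)%E -> measurable_fun setT f ->
  dspace_time.-integrable D (EFin \o f) ->
  forall e, 0 < e -> exists2 g : Z -> R, continuous g &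
    (\int[dspace_time]_(z in D) (`|f z - g z|)%:E <= e%:E)%E.
Proof.
move=> mD Dfin.
pose C : set (mZ -> R) := [set g | continuous (g : Z -> R)].
have Cm g : C g -> measurable_fun setT g.
  by move=> cg; exact: continuous_measurable_spacetime.
have Ccst k : C (cst k) by move=> z; exact: cvg_cst.
have CD g h : C g -> C h -> C (fun z => g z + h z).
  by move=> cg ch z; apply: cvgD; [exact: cg|exact: ch].
have CZ k g : C g -> C (fun z => k * g z).
  by move=> cg z; apply: cvgM; [exact: cvg_cst|exact: cg].
have Cmax g h : C g -> C h -> C (fun z => Num.max (g z) (h z)).
  by move=> cg ch z; apply: continuous_max; [exact: cg|exact: ch].
have LP := @L1approx_preimage _ mZ R dspace_time D C mD Dfin Cm Ccst CD CZ Cmax.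
have [L0 LC LU] := @sigma_algebra_L1approx_sets _ mZ R dspace_time D C mD Dfin
  Cm Ccst CD CZ Cmax.
move=> mf If.
apply: (@L1approx_integrable _ mZ R dspace_time D C mD Cm Ccst CD CZ _ f mf If).
apply: smallest_sub; first by [].
move=> _ [[A + <-]|[A mA <-]]; last first.
  by rewrite setTI; apply: LP => // z; exact: cvg_snd.
rewrite setTI; move: A; apply: smallest_sub.
  split => /=.
  - by rewrite preimage_set0.
  - by move=> A /LC; rewrite !setTD preimage_setC.
  - by move=> A HA; rewrite preimage_bigcup; exact: LU.
move=> A /=; rewrite -bigcup_seq => -[i _ [Y mY <-]].
rewrite setTI -comp_preimage; apply: LP => //.
exact: continuous_coord1.
Qed.

End density_space_time.

(** * Directional derivatives and smooth kernels *)

Section directional_derivative.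
Context {R : realType} {V : normedModType R}.

(** Turns a directional derivative into a derivative in one real variable, where the chain rule is
    available without total differentiability of [f]. *)
Lemma is_derive_line (f : V -> R) (x v : V) df :
  is_derive x v f df <-> is_derive (0 : R) 1 (fun h : R => f (h *: v + x)) df.
Proof.
have E : (fun h : R => h^-1 *: (((fun h : R => f (h *: v + x)) \o shift 0) (h *: 1) -
    (fun h : R => f (h *: v + x)) 0)) =
    (fun h => h^-1 *: ((f \o shift x) (h *: v) - f x)).
  by apply/funext => h /=; rewrite addr0 scale0r add0r [_%:A]mulr1.
have dE : 'D_1 (fun h : R => f (h *: v + x)) 0 = 'D_v f x.
  exact: (congr1 (fun F : R -> R => lim (F @ 0^')) E).
split=> -[D <-].
  by apply: DeriveDef => //; exact: (iffLR (derivable1P f x v) D).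
by rewrite dE; apply: DeriveDef => //; exact: (iffRL (derivable1P f x v) D).
Qed.

Lemma is_derive_comp (g : R -> R) (w : V -> R) (x v : V) dw dg :
  is_derive x v w dw -> is_derive (w x) 1 g dg ->
  is_derive x v (fun y => g (w y)) (dg * dw).
Proof.
move=> /is_derive_line dw' dg'; apply/is_derive_line.
apply: (@is_derive1_comp _ g (fun h : R => w (h *: v + x)) 0 dg dw) => //.
by rewrite /= scale0r add0r.
Qed.

(** Affinity is asked for along one line; with c = 0 this differentiates any function that does not
    change in the direction [v]. *)
Lemma is_derive_affine (l : V -> R) (x v : V) c :
  (forall h, l (h *: v + x) = h * c + l x) -> is_derive x v l c.
Proof.
move=> H; apply/is_derive_line.
rewrite (_ : (fun h : R => _) = (fun h : R => h * c + l x)); last exact/funext.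
by apply: is_derive_eq; rewrite /= ?(scaler0, add0r, addr0, mulr0, mul0r, scale0r) [_%:A]mulr1.
Qed.

Lemma is_derive_near (f g : V -> R) (x v : V) d :
  (\forall y \near x, f y = g y) -> is_derive x v f d -> is_derive x v g d.
Proof. exact: near_eq_is_derive. Qed.

Lemma is_derive_mulr (f g : V -> R) (x v : V) df dg :
  is_derive x v f df -> is_derive x v g dg ->
  is_derive x v (fun y => f y * g y) (f x * dg + g x * df).
Proof. by move=> H1 H2; have := is_deriveM H1 H2. Qed.

Lemma is_derive_addr (f g : V -> R) (x v : V) df dg :
  is_derive x v f df -> is_derive x v g dg ->
  is_derive x v (fun y => f y + g y) (df + dg).
Proof. by move=> H1 H2; have := is_deriveD H1 H2. Qed.

Lemma is_derive_subr (f g : V -> R) (x v : V) df dg :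
  is_derive x v f df -> is_derive x v g dg ->
  is_derive x v (fun y => f y - g y) (df - dg).
Proof. by move=> H1 H2; have := is_deriveB H1 H2. Qed.

Lemma is_derive_eqr (f : V -> R) (x v : V) a b :
  is_derive x v f a -> a = b -> is_derive x v f b.
Proof. by move=> ? <-. Qed.

End directional_derivative.

Section smoothness.
Context {R : realType} {V : normedModType R}.
Implicit Types f g : V -> R.

Lemma Ck_continuous k f : Ck k f -> continuous f.
Proof. by case: k => [|k] []. Qed.

Lemma CkW k f : Ck k.+1 f -> Ck k f.
Proof.
elim: k f => [|k IH] f; first by case.
by move=> [cf df]; split => // v; have [dfv /IH] := df v.
Qed.

Lemma Ck_cst k c : Ck k (cst c : V -> R).
Proof.
elim: k c => [|k IH] c; first by split => // x; exact: cvg_cst.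
split; first by move=> x; exact: cvg_cst.
move=> v; split; first by move=> x; exact: derivable_cst.
rewrite (_ : 'D_v (cst c) = cst 0); first exact: IH.
by apply/funext => x; rewrite derive_cst.
Qed.

Lemma CkD k f g : Ck k f -> Ck k g -> Ck k (fun x => f x + g x).
Proof.
elim: k f g => [|k IH] f g.
  by move=> [cf _] [cg _]; split => // x; apply: cvgD; [exact: cf|exact: cg].
move=> [cf df] [cg dg]; split.
  by move=> x; apply: cvgD; [exact: cf|exact: cg].
move=> v; have [dfv kf] := df v; have [dgv kg] := dg v; split.
  by move=> x; exact: derivableD.
rewrite (_ : 'D_v _ = fun x => 'D_v f x + 'D_v g x); first exact: IH.
by apply/funext => x; exact: deriveD.
Qed.

Lemma CkM k f g : Ck k f -> Ck k g -> Ck k (fun x => f x * g x).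
Proof.
elim: k f g => [|k IH] f g.
  by move=> [cf _] [cg _]; split => // x; apply: cvgM; [exact: cf|exact: cg].
move=> kf kg; have [cf df] := kf; have [cg dg] := kg; split.
  by move=> x; apply: cvgM; [exact: cf|exact: cg].
move=> v; have [dfv kf'] := df v; have [dgv kg'] := dg v; split.
  by move=> x; exact: derivableM.
rewrite (_ : 'D_v _ = fun x => f x * 'D_v g x + g x * 'D_v f x).
  by apply: CkD; apply: IH => //; exact: CkW.
by apply/funext => x; exact: deriveM.
Qed.

Lemma smoothM f g : smooth f -> smooth g -> smooth (fun x => f x * g x).
Proof. by move=> sf sg k; exact: CkM. Qed.

Lemma smooth_prod (I : Type) (s : seq I) (F : I -> V -> R) :
  (forall i, smooth (F i)) -> smooth (fun x => \prod_(i <- s) F i x).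
Proof.
move=> sF; elim: s => [|i s IH].
  by under eq_fun do rewrite big_nil; move=> k; exact: Ck_cst.
by under eq_fun do rewrite big_cons; exact: smoothM.
Qed.

Lemma smooth_derive f v : smooth f -> smooth ('D_v f).
Proof. by move=> sf k; have [_ /(_ v)[]] := sf k.+1. Qed.

Lemma smooth_derivable f x v : smooth f -> derivable f x v.
Proof. by move=> sf; have [_ /(_ v)[]] := sf 1%N. Qed.

Lemma smooth_continuous f : smooth f -> continuous f.
Proof. by move=> sf; exact: Ck_continuous (sf 0%N). Qed.

End smoothness.

Section smooth_composition.
Context {R : realType} {V : normedModType R}.

(** [c] is the linear part of [l]. The derivative along [v] is g'(l x) times the constant c v, a
    function of the same shape, and this closes the induction on the order. *)
Lemma smooth_comp_affine (g : R -> R) (l : V -> R) (c : V -> R) :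
  smooth g -> continuous l -> (forall x v h, l (h *: v + x) = h * c v + l x) ->
  smooth (fun x => g (l x)).
Proof.
move=> + cl lc; move=> sg k; elim: k g sg => [|k IH] g sg.
  split => // x; apply: continuous_comp; first exact: cl.
  exact: (smooth_continuous sg).
split.
  move=> x; apply: continuous_comp; first exact: cl.
  exact: (smooth_continuous sg).
move=> v.
have D x : is_derive x v (fun x => g (l x)) ('D_1 g (l x) * c v).
  apply: is_derive_comp; first by apply: is_derive_affine => h; exact: lc.
  by apply: derivableP; exact: smooth_derivable.
split; first by move=> x; have [] := D x.
rewrite (_ : 'D_v _ = fun x => 'D_1 g (l x) * cst (c v) x).
  apply: CkM; last exact: Ck_cst.
  by have := IH _ (smooth_derive (1 : R) sg).
by apply/funext => x; have [_ ->] := D x.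
Qed.

End smooth_composition.

Section bump.
Context {R : realType}.
Implicit Types (P : {poly R}) (x : R).

(** The polynomial parameter closes the family under differentiation: with y = 1/x, the derivative
    of P(y) exp(-y) is y^2 (P - P')(y) exp(-y). Smoothness then needs a single differentiation. *)
Definition exp_inv P x : R := if 0 < x then P.[x^-1] * expR (- x^-1) else 0.

(** From y^k <= k! exp y. The factor y^2 is the one that appears in the difference quotient of
    [exp_inv P] at 0, which for h > 0 is h times the quantity bounded here at y = 1/h. *)
Lemma expR_dominates_poly P : exists2 c : R, 0 <= c &
  forall y, 0 <= y -> `|P.[y] * y ^+ 2 * expR (- y)| <= c.
Proof.
exists (\sum_(i < size P) `|P`_i| * (i.+2)`!%:R).
  by apply: sumr_ge0 => i _; rewrite mulr_ge0.
move=> y y0; rewrite horner_coef mulr_suml mulr_suml.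
apply: (le_trans (ler_norm_sum _ _ _)); apply: ler_sum => i _.
have -> : P`_i * y ^+ i * y ^+ 2 * expR (- y) =
    P`_i * (y ^+ i.+2 * expR (- y)) by rewrite -(addn2 i) exprD; ring.
rewrite normrM; apply: ler_wpM2l => //.
rewrite ger0_norm; last by rewrite mulr_ge0 ?exprn_ge0 ?expR_ge0.
rewrite expRN ler_pdivrMr ?expR_gt0// mulrC -ler_pdivrMr; last first.
  by rewrite ltr0n fact_gt0.
by apply: le_trans (expR_ge1Dxn i.+1 y0); rewrite lerDr.
Qed.

Lemma is_derive_exp_inv P x :
  is_derive x 1 (exp_inv P) (exp_inv ('X^2 * (P - P^`())) x).
Proof.
have [x0|x0|->] := ltgtP x 0.
- rewrite {2}/exp_inv ltNge (ltW x0)/=.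
  apply: (@near_eq_is_derive _ _ _ (cst 0)).
  near=> y; rewrite /exp_inv /= ltNge; suff -> : y <= 0 by [].
  by apply/ltW; near: y; exact: lt_nbhsl.
- have dV : is_derive x 1 (fun y : R => y^-1) (- x ^- 2).
    apply: is_derive_eqr.
      by apply: is_deriveV; rewrite gt_eqF.
    by rewrite scaleNr [_%:A]mulr1.
  have dP := is_derive_comp dV (is_derive_poly P (x^-1)).
  have dN : is_derive x 1 (fun y : R => - y^-1) (x ^- 2).
    by apply: is_derive_eqr; rewrite opprK.
  have dE := is_derive_comp dN (is_derive_expR (- x^-1)).
  have dPE := is_derive_mulr dP dE.
  have {}dPE := is_derive_eqr (b := exp_inv ('X^2 * (P - P^`())) x) dPE _.
  apply: is_derive_near (dPE _).
    near=> y; rewrite /exp_inv; suff -> : 0 < y by [].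
    by near: y; exact: lt_nbhsr.
  rewrite /exp_inv x0 !hornerE /= -exprVn.
  ring.
- rewrite {2}/exp_inv ltxx.
  have [c c0 Hc] := expR_dominates_poly P.
  suff H : h^-1 *: (exp_inv P (h *: 1 + 0) - exp_inv P 0) @[h --> 0^'] --> (0 : R).
    apply: DeriveDef; first by apply/cvg_ex; exists 0.
    by apply/cvg_lim.
  apply/cvgrPdist_le => e e0; near=> h.
  rewrite sub0r normrN addr0 [_%:A]mulr1 /exp_inv ltxx subr0.
  case: ifPn => [h0|_]; last by rewrite scaler0 normr0 ltW.
  have hn : h != 0 by rewrite gt_eqF.
  have := Hc h^-1 (ltW _); rewrite invr_gt0 => /(_ h0) H.
  rewrite (_ : h^-1 *: _ = h * (P.[h^-1] * h^-1 ^+ 2 * expR (- h^-1))); last first.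
    by rewrite /GRing.scale /= expr2; field.
  rewrite normrM (le_trans (ler_wpM2l _ H))//.
  rewrite gtr0_norm// (@le_trans _ _ (h * (c + 1)))//.
    by rewrite ler_wpM2l ?ltW// ltrDl.
  rewrite -ler_pdivlMr ?ltr_wpDl// -(gtr0_norm h0).
  by near: h; apply: dnbhs0_le; rewrite divr_gt0// ltr_wpDl.
Unshelve. all: by end_near. Qed.

Lemma smooth_exp_inv P : smooth (exp_inv P).
Proof.
move=> k; elim: k P => [|k IH] P.
  split => // x; apply: differentiable_continuous.
  by apply/derivable1_diffP; have [] := is_derive_exp_inv P x.
split.
  move=> x; apply: differentiable_continuous.
  by apply/derivable1_diffP; have [] := is_derive_exp_inv P x.
move=> v.
have D x : is_derive x v (exp_inv P) (exp_inv ('X^2 * (P - P^`())) x * v).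
  apply: (@is_derive_comp _ R (exp_inv P) id x v v).
  exact: is_derive_exp_inv.
split; first by move=> x; have [] := D x.
rewrite (_ : 'D_v _ = fun x => exp_inv ('X^2 * (P - P^`())) x * cst v x).
  by apply: CkM => //; exact: Ck_cst.
by apply/funext => x; have [_ ->] := D x.
Qed.

(** On ]-1, 1[ this is exp(-2 / (1 - x^2)), the usual mollifier profile. *)
Definition bump (x : R) : R := exp_inv 1 (1 - x) * exp_inv 1 (1 + x).

Lemma bump_ge0 x : 0 <= bump x.
Proof.
by rewrite /bump /exp_inv; do 2 case: ifP => _;
  rewrite ?(mul0r, mulr0, hornerC, mul1r)// mulr_ge0// expR_ge0.
Qed.

Lemma bump0_gt0 : 0 < bump 0.
Proof. by rewrite /bump /exp_inv subr0 addr0 ltr01 !hornerC !mul1r mulr_gt0 ?expR_gt0. Qed.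

Lemma bumpN x : bump (- x) = bump x.
Proof. by rewrite /bump opprK mulrC. Qed.

Lemma bump_eq0 x : 1 <= `|x| -> bump x = 0.
Proof.
rewrite /bump /exp_inv ler_normr => /orP[x1|x1].
  by rewrite subr_gt0 ltNge x1 mul0r.
suff -> : (0 < 1 + x) = false by rewrite mulr0.
by apply/negbTE; rewrite -leNgt; lra.
Qed.

Lemma smooth_bump : smooth bump.
Proof.
apply: smoothM.
  apply: (smooth_comp_affine (c := fun v => - v) (smooth_exp_inv 1)).
    by move=> x; apply: cvgB; [exact: cvg_cst|exact: cvg_id].
  by move=> x v h; rewrite /GRing.scale/=; ring.
apply: (smooth_comp_affine (c := id) (smooth_exp_inv 1)).
  by move=> x; apply: cvgD; [exact: cvg_cst|exact: cvg_id].
by move=> x v h; rewrite /GRing.scale/=; ring.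
Qed.

End bump.

(** * Uniform continuity around compact sets *)

Section uniform_continuity.
Context {R : realType} {V : normedModType R}.

(** Only [x] has to be in [K]: continuity at the points of [K] is meant in the whole space, so [y]
    may leave [K]. Compactness is used as near-covering, each point contributing half of its radius
    of continuity. *)
Lemma compact_uniform_continuity (K : set V) (f : V -> R) : compact K ->
  (forall x, K x -> {for x, continuous f}) ->
  forall e, 0 < e -> exists2 d, 0 < d &
    forall x y, K x -> `|x - y| < d -> `|f x - f y| < e.
Proof.
move=> /compact_near_coveringP cK cf e e0.
have : \forall d \near (0 : R)^'+,
    K `<=` [set x | forall y, `|x - y| < d -> `|f x - f y| < e].
  apply: cK => x Kx.
  have /cvgrPdist_lt/(_ (e / 2)) : f y @[y --> x] --> f x by exact: cf.
  rewrite divr_gt0// => /(_ isT)/nbhs_ballP[r /= r0 xr].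
  have r20 : 0 < r / 2 by rewrite divr_gt0.
  exists (ball x (r / 2), [set d | 0 < d < r / 2]) => /=.
    split; first exact: nbhsx_ballx.
    near=> d; apply/andP; split; near: d; first exact: nbhs_right_gt.
    exact: nbhs_right_lt.
  move=> [x' d] [/= xx' /andP[d0 dr]] y x'y.
  have H1 : `|f x - f x'| < e / 2.
    by apply: xr; apply: le_ball xx'; lra.
  have H2 : `|f x - f y| < e / 2.
    apply: xr; rewrite (splitr r); apply: ball_triangle xx' _.
    by rewrite -ball_normE /ball_/= (lt_trans x'y).
  rewrite (splitr e) (le_lt_trans _ (ltrD H1 H2))//.
  rewrite -[X in _ <= X + _]normrN opprB.
  by rewrite (le_trans _ (ler_normD _ _))// addrA subrK.
move=> H; near (0 : R)^'+ => d; exists d; first by near: d; exact: nbhs_right_gt.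
move=> x y Kx; suff : K `<=` [set x | forall y, `|x - y| < d -> `|f x - f y| < e].
  by move=> /(_ x Kx)/(_ y).
by near: d.
Unshelve. all: by end_near. Qed.

Lemma compact_continuous_bounded (K : set V) (f : V -> R) : compact K ->
  (forall x, K x -> {for x, continuous f}) ->
  exists2 M, 0 <= M & forall x, K x -> `|f x| <= M.
Proof.
move=> cK cf.
have : compact (f @` K).
  apply: continuous_compact => //; apply: continuous_in_subspaceT => x.
  by move=> /set_mem; exact: cf.
move=> /compact_bounded[M [_ HM]]; exists (`|M| + 1) => [|x Kx].
  by rewrite addr_ge0.
apply: (HM (`|M| + 1)); first by rewrite (le_lt_trans (ler_norm _))// ltrDl.
by exists x.
Qed.

End uniform_continuity.

Section compact_support.
Context {R : realType} {n : nat}.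
Notation Z := ('rV[R]_n * R)%type.

Lemma compact_normball (z : Z) e : compact [set y : Z | `|z - y| <= e].
Proof.
have cZ : compact [set y : Z | `|y| <= `|z| + `|e|].
  have -> : [set y : Z | `|y| <= `|z| + `|e|] =
      [set x : 'rV[R]_n | `|x| <= `|z| + `|e|] `*` [set t : R | `|t| <= `|z| + `|e|].
    by apply/seteqP; split => -[x t] /=; rewrite prod_normE/= ge_max => /andP.
  apply: compact_setX.
    apply: bounded_closed_compact.
      exists (`|z| + `|e|); split; first exact: num_real.
      by move=> M /ltW HM x /= /le_trans; apply.
    apply: (@closed_comp _ _ (fun x : 'rV[R]_n => `|x|) [set t | t <= _]).
      by move=> x _; exact: norm_continuous.
    exact: closed_le.
  rewrite (_ : mkset _ = `[- (`|z| + `|e|), `|z| + `|e|]%classic).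
    exact: segment_compact.
  by apply/seteqP; split => t /=; rewrite in_itv/= ler_norml.
apply: subclosed_compact cZ _.
  apply: (@closed_comp _ _ (fun y : Z => `|z - y|) [set t | t <= _]).
    move=> y _; apply: (@cvg_norm _ Z); apply: (@cvgB _ Z).
      exact: cvg_cst.
    exact: cvg_id.
  exact: closed_le.
move=> y /= yz; rewrite -{1}(subKr z y) (le_trans (ler_normB _ _))// lerD2l.
by rewrite (le_trans yz)// ler_norm.
Qed.

Lemma compact_support_uniform (f : Z -> R) r : continuous f ->
  (forall z, r <= `|z| -> f z = 0) ->
  forall e, 0 < e -> exists2 d, 0 < d &
    forall x y, `|x - y| < d -> `|f x - f y| < e.
Proof.
move=> cf f0 e e0.
have [d d0 H] := @compact_uniform_continuity _ _ _ f (@compact_normball 0 r)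
  (fun x _ => cf x) e e0.
exists d => // x y xy; have [xr|xr] := ltP `|x| r.
  by apply: H => //; rewrite /= sub0r normrN ltW.
have [yr|yr] := ltP `|y| r; last by rewrite !f0// subrr normr0.
rewrite -normrN opprB; apply: H; first by rewrite /= sub0r normrN ltW.
by rewrite -normrN opprB.
Qed.

Lemma compact_support_bounded (f : Z -> R) r : continuous f ->
  (forall z, r <= `|z| -> f z = 0) ->
  exists2 M, 0 <= M & forall x, `|f x| <= M.
Proof.
move=> cf f0.
have [M M0 H] := @compact_continuous_bounded _ _ _ f (@compact_normball 0 r)
  (fun x _ => cf x).
exists M => // x; have [xr|xr] := ltP `|x| r; last by rewrite f0// normr0.
by apply: H; rewrite /= sub0r normrN ltW.
Qed.

End compact_support.

(** * Positive normalised functionals and monotone pairings *)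

Section expectation.
Context {R : realType} {T : Type}.
Variables (A : set (T -> R)) (E : (T -> R) -> R) (S : set T).
Hypothesis A1 : A (cst 1).
Hypothesis AD : forall f g, A f -> A g -> A (fun y => f y + g y).
Hypothesis AZ : forall k f, A f -> A (fun y => k * f y).
Hypothesis E1 : E (cst 1) = 1.
Hypothesis ED : forall f g, A f -> A g -> E (fun y => f y + g y) = E f + E g.
Hypothesis EZ : forall k f, A f -> E (fun y => k * f y) = k * E f.
Hypothesis Ele : forall f g, A f -> A g -> (forall y, S y -> f y <= g y) ->
  E f <= E g.

Let Acst k : A (cst k).
Proof. by have := AZ k A1; congr (A _); apply/funext => y; rewrite /= mulr1. Qed.

Let Ecst k : E (cst k) = k.
Proof.
rewrite -[RHS]mulr1 -E1 -EZ//; congr E.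
by apply/funext => y; rewrite /= mulr1.
Qed.

Lemma expectation_sum n (c : 'I_n -> R) (f : 'I_n -> T -> R) :
  (forall i, A (f i)) -> A (fun y => \sum_(i < n) c i * f i y) /\
  E (fun y => \sum_(i < n) c i * f i y) = \sum_(i < n) c i * E (f i).
Proof.
move=> Af; elim: n c f Af => [|n IH] c f Af.
  rewrite big_ord0; under eq_fun do rewrite big_ord0.
  by split; [exact: Acst|exact: Ecst].
rewrite big_ord_recr/=; under eq_fun do rewrite big_ord_recr/=.
have [H1 H2] := IH (fun i => c (widen_ord (leqnSn n) i))
  (fun i => f (widen_ord (leqnSn n) i)) (fun i => Af _).
split; first by apply: AD => //; exact: AZ.
by rewrite ED// ?H2 ?EZ//; exact: AZ.
Qed.

Let Ele_affine (f g h f' : T -> R) (c c' : R) :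
  A f -> A g -> A h -> A f' ->
  (forall y, S y -> f y + c - (g y + h y) <= f' y + c') ->
  E f + c - (E g + E h) <= E f' + c'.
Proof.
move=> Af Ag Ah Af' H.
have Agh := AD Ag Ah; have AN := AZ (-1) Agh.
have Ac := AD Af (Acst c); have Ac' := AD Af' (Acst c').
have := Ele (AD Ac AN) Ac'; rewrite !ED// EZ// ED// !Ecst mulN1r; apply.
by move=> y Sy; rewrite mulN1r; exact: H.
Qed.

(* The defect [E (a . F) - E a . E F] is half the mean, over two independent
   copies, of [(a - a') . (F - F')]. *)
Lemma expectation_monotone_pairing n (a F : 'I_n -> T -> R) (G psi : T -> R)
    (xi Xi : 'I_n -> R) (k : R) :
  (forall i, A (a i)) -> (forall i, A (F i)) -> A G -> A psi ->
  (forall y, G y = \sum_(i < n) a i y * F i y) ->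
  (forall y y', S y -> S y' ->
    \sum_(i < n) (a i y - a i y') * (F i y - F i y') <= psi y + psi y' + k) ->
  (forall y, S y -> 0 <= \sum_(i < n) (a i y - xi i) * (F i y - Xi i)) ->
  - (E psi + k / 2) <= \sum_(i < n) (E (a i) - xi i) * (E (F i) - Xi i).
Proof.
move=> Aa AF AG Apsi GE H1 H2.
have expand (x y u v : 'I_n -> R) : \sum_(i < n) (x i - y i) * (u i - v i) =
    \sum_(i < n) x i * u i - \sum_(i < n) v i * x i - \sum_(i < n) y i * u i
    + \sum_(i < n) y i * v i.
  rewrite -!sumrB -big_split/=; apply: eq_bigr => i _; ring.
have comm (x y : 'I_n -> R) : \sum_(i < n) x i * y i = \sum_(i < n) y i * x i.
  by apply: eq_bigr => i _; rewrite mulrC.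
(* Mean over y with y' fixed. *)
have S1 y' : S y' -> E G + G y' - (\sum_(i < n) F i y' * E (a i)
    + \sum_(i < n) a i y' * E (F i)) <= E psi + (psi y' + k).
  move=> Sy'.
  have [A2 <-] := expectation_sum (fun i => F i y') Aa.
  have [A3 <-] := expectation_sum (fun i => a i y') AF.
  apply: Ele_affine => // y Sy.
  by have := H1 _ _ Sy Sy'; rewrite expand -!GE; lra.
(* Mean over y' of the previous inequality; both cross sums become the pairing of E a with E F. *)
have S2 : E G + E G - (\sum_(i < n) E (a i) * E (F i) +
    \sum_(i < n) E (F i) * E (a i)) <= E psi + (E psi + k).
  have [A2 <-] := expectation_sum (fun i => E (a i)) AF.
  have [A3 <-] := expectation_sum (fun i => E (F i)) Aa.
  apply: Ele_affine => // y Sy; have := S1 _ Sy.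
  rewrite (comm (fun i => F i y)) (comm (fun i => a i y)); lra.
(* Mean of the monotonicity against the fixed pair (xi, Xi). Half of [S2] plus [S3] is the claim. *)
have S3 : E (cst 0) + 0 - (\sum_(i < n) - Xi i * E (a i) +
    \sum_(i < n) - xi i * E (F i)) <= E G + \sum_(i < n) xi i * Xi i.
  have [A2 <-] := expectation_sum (fun i => - Xi i) Aa.
  have [A3 <-] := expectation_sum (fun i => - xi i) AF.
  apply: Ele_affine => // y Sy; have := H2 _ Sy; rewrite expand -GE.
  under [X in _ -> _ - (X + _) <= _]eq_bigr do rewrite mulNr.
  under [X in _ -> _ - (_ + X) <= _]eq_bigr do rewrite mulNr.
  rewrite !sumrN /=; lra.
rewrite expand; move: S2 S3; rewrite Ecst.
under [X in _ -> _ - (X + _) <= _ -> _]eq_bigr do rewrite mulNr.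
under [X in _ -> _ - (_ + X) <= _ -> _]eq_bigr do rewrite mulNr.
rewrite !sumrN (comm (fun i => E (F i)) (fun i => E (a i))); lra.
Qed.

End expectation.

(** * Mollification *)

Section integrable_real_functions.
Context d (T : measurableType d) (R : realType).
Variable mu : {measure set T -> \bar R}.
Implicit Types f g : T -> R.

Definition summable_fun f := mu.-integrable setT (EFin \o f).

Lemma summable_measurable f : summable_fun f -> measurable_fun setT f.
Proof. by move=> /measurable_int/measurable_EFinP. Qed.

Lemma summableD f g : summable_fun f -> summable_fun g ->
  summable_fun (fun y => f y + g y).
Proof. by move=> If Ig; have := integrableD measurableT If Ig. Qed.

Lemma summableB f g : summable_fun f -> summable_fun g ->
  summable_fun (fun y => f y - g y).
Proof. by move=> If Ig; have := integrableB measurableT If Ig. Qed.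

Lemma summableZ k f : summable_fun f -> summable_fun (fun y => k * f y).
Proof. by move=> If; have := integrableZl measurableT k If. Qed.

Lemma summableZr k f : summable_fun f -> summable_fun (fun y => f y * k).
Proof.
move=> If; have := summableZ k If; congr summable_fun.
by apply/funext => y; rewrite mulrC.
Qed.

Lemma summable_norm f : summable_fun f -> summable_fun (fun y => `|f y|).
Proof. by move=> If; have := integrable_norm If. Qed.

Lemma summable0 : summable_fun (fun _ => 0).
Proof. exact: integrable0. Qed.

Lemma summable_sum I (s : seq I) (f : I -> T -> R) :
  (forall i, summable_fun (f i)) -> summable_fun (fun y => \sum_(i <- s) f i y).
Proof.
move=> If; elim: s => [|i s IH].
  by under eq_fun do rewrite big_nil; exact: summable0.
by under eq_fun do rewrite big_cons; exact: summableD.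
Qed.

Lemma summable_le f g : measurable_fun setT f -> summable_fun g ->
  (forall y, `|f y| <= g y) -> summable_fun f.
Proof.
move=> mf Ig fg; apply: le_integrable Ig => //; first exact/measurable_EFinP.
by move=> y _ /=; rewrite lee_fin (le_trans (fg y))// ler_norm.
Qed.

Lemma summableM_bounded f g M : summable_fun f -> measurable_fun setT g ->
  (forall y, `|g y| <= M) -> summable_fun (fun y => f y * g y).
Proof.
move=> If mg gM; apply: (@summable_le _ (fun y => `|f y| * M)).
- by apply: measurable_funM => //; exact: summable_measurable.
- exact/summableZr/summable_norm.
- by move=> y; rewrite normrM ler_wpM2l.
Qed.

End integrable_real_functions.

Section support.
Context {R : realType} {V : normedModType R}.

Lemma derive_out (f : V -> R) (v x : V) r : (forall y, r <= `|y| -> f y = 0) ->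
  r < `|x| -> 'D_v f x = 0.
Proof.
move=> f0 rx; rewrite -[RHS](derive_cst (0 : R) x v); apply: near_eq_derive.
near=> y; rewrite /= f0//; near: y.
have : `|y| @[y --> x] --> `|x| by apply: cvg_norm; exact: cvg_id.
by move/cvgr_ge; exact.
Unshelve. all: by end_near. Qed.

Lemma is_derive_path (f f' : V -> R) (v p : V) (s : R) :
  (forall y, is_derive y v f (f' y)) ->
  is_derive s 1 (fun s : R => f (s *: v + p)) (f' (s *: v + p)).
Proof.
move=> df.
have H := iffLR (is_derive_line _ _ _ _) (df (s *: v + p)).
have W : is_derive s 1 (fun h : R => h - s) (1 : R).
  by apply: is_derive_affine => h; rewrite [_%:A]mulr1 mulr1 addrA.
have H' : is_derive (s - s) 1 (fun h : R => f (h *: v + (s *: v + p)))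
    (f' (s *: v + p)) by rewrite subrr.
have := is_derive_comp W H'; rewrite mulr1; congr is_derive.
by apply/funext => h; rewrite scalerBl addrA subrK.
Qed.

Lemma derive_translate (f : V -> R) (v y z : V) : (forall x, derivable f x v) ->
  'D_v (fun y => f (y - z)) y = 'D_v f (y - z).
Proof.
move=> df; suff [_ ->] : is_derive y v (fun y => f (y - z)) ('D_v f (y - z)) by [].
apply/is_derive_line.
have := iffLR (is_derive_line _ _ _ _) (derivableP (df (y - z))).
by congr is_derive; apply/funext => h; rewrite addrA.
Qed.

Lemma continuous_affine (l : V -> R) a b : continuous l ->
  continuous (fun x => a * (l x - b)).
Proof.
move=> cl x; apply: cvgM; first exact: cvg_cst.
by apply: cvgB; [exact: cl|exact: cvg_cst].
Qed.

End support.

(** * The smooth kernel of space-time *)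

Section kernel.
Context {R : realType} {n : nat}.
Notation Z := ('rV[R]_n * R)%type.
Implicit Types (h : R) (z w : Z).

Definition space_bump h (x : 'rV[R]_n) : R :=
  \prod_(i < n) bump (h^-1 * x ord0 i).

Definition kernel h z : R := space_bump h z.1 * bump (h^-1 * z.2).

Lemma smooth_space_bump h (w : 'rV[R]_n) :
  smooth (fun x => space_bump h (x - w)).
Proof.
apply: smooth_prod => i.
apply: (smooth_comp_affine (c := fun v : 'rV[R]_n => h^-1 * v ord0 i) smooth_bump).
  have -> : (fun x : 'rV[R]_n => h^-1 * (x - w) ord0 i) =
      (fun x : 'rV[R]_n => h^-1 * (x ord0 i - w ord0 i)).
    by apply/funext => x; rewrite !mxE.
  by apply: continuous_affine; exact: coord_continuous.
by move=> x v k; rewrite !mxE; ring.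
Qed.

Lemma smooth_kernel h w : smooth (fun z => kernel h (z - w)).
Proof.
apply: smoothM.
  apply: smooth_prod => i.
  apply: (smooth_comp_affine (c := fun v : Z => h^-1 * v.1 ord0 i) smooth_bump).
    have -> : (fun x : Z => h^-1 * (x - w).1 ord0 i) =
        (fun x : Z => h^-1 * (x.1 ord0 i - w.1 ord0 i)).
      by apply/funext => x; rewrite !mxE.
    by apply: continuous_affine; exact: continuous_coord1.
  by move=> x v k; rewrite !mxE; ring.
apply: (smooth_comp_affine (c := fun v : Z => h^-1 * v.2) smooth_bump).
  by apply: continuous_affine => x; exact: cvg_snd.
by move=> x v k /=; rewrite /GRing.scale/=; ring.
Qed.

Lemma kernel_ge0 h z : 0 <= kernel h z.
Proof. by rewrite mulr_ge0 ?bump_ge0// prodr_ge0// => i _; exact: bump_ge0. Qed.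

Lemma kernel0_gt0 h : 0 < kernel h 0.
Proof.
rewrite mulr_gt0 ?mulr0 ?bump0_gt0// prodr_gt0// => i _.
by rewrite mxE mulr0 bump0_gt0.
Qed.

Lemma kernelN h z : kernel h (- z) = kernel h z.
Proof.
rewrite /kernel /space_bump /= mulrN bumpN; congr (_ * _).
by apply: eq_bigr => i _; rewrite mxE mulrN bumpN.
Qed.

Let scaled_ge1 h (a : R) : 0 < h -> h <= `|a| -> 1 <= `|h^-1 * a|.
Proof.
by move=> h0 ha; rewrite normrM gtr0_norm ?invr_gt0// mulrC ler_pdivlMr// mul1r.
Qed.

Lemma space_bump_out h (x : 'rV[R]_n) : 0 < h -> h <= `|x| -> space_bump h x = 0.
Proof.
move=> h0; rewrite [X in _ <= X]/Num.norm /= mx_normrE => /bigmax_geP[|[[j i] _ /= hi]].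
  by rewrite leNgt h0.
rewrite /space_bump (bigD1 i)//= bump_eq0 ?mul0r//.
by apply: scaled_ge1 => //; rewrite (ord1 j) in hi.
Qed.

Lemma kernel_out h z : 0 < h -> h <= `|z| -> kernel h z = 0.
Proof.
move=> h0; rewrite prod_normE /= le_max => /orP[hz|hz].
  by rewrite /kernel space_bump_out ?mul0r.
by rewrite /kernel bump_eq0 ?mulr0//; exact: scaled_ge1.
Qed.

Lemma closed_normball (V : normedModType R) (z : V) r : closed [set y : V | `|z - y| <= r].
Proof.
apply: (@closed_comp _ _ (fun y : V => `|z - y|) [set t | t <= r]).
  move=> y _; apply: cvg_norm; apply: cvgB; first exact: cvg_cst.
  exact: cvg_id.
exact: closed_le.
Qed.

Lemma test_function_kernel h z (U : set Z) : 0 < h ->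
  [set y : Z | `|z - y| <= h] `<=` U -> test_function U (fun y => kernel h (y - z)).
Proof.
move=> h0 hU.
have S : tsupport (fun y => kernel h (y - z)) `<=` [set y : Z | `|z - y| <= h].
  rewrite /tsupport; rewrite [X in _ `<=` X](closure_id _).1; last first.
    exact: closed_normball.
  apply: closure_subset => y /=; apply: contra_neqP => /negP.
  by rewrite -ltNge distrC => /ltW; exact: kernel_out.
split; first exact: smooth_kernel.
  apply: subclosed_compact (@compact_normball R n z h) S.
  exact: closed_closure.
exact: subset_trans S hU.
Qed.

Lemma smooth_kernel0 h : smooth (kernel h).
Proof.
by have := smooth_kernel h 0; congr smooth; apply/funext => z; rewrite subr0.
Qed.

Lemma derive_kernel h z y v :
  'D_v (fun y => kernel h (y - z)) y = 'D_v (kernel h) (y - z).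
Proof. by apply: derive_translate => x; apply: smooth_derivable; exact: smooth_kernel0. Qed.

End kernel.

Section mollification.
Context {R : realType} {n : nat}.
Notation Z := ('rV[R]_n * R)%type.
Notation mZ := ('rV[R]_n * measurableTypeR R)%type.
Variable mu : {measure set mZ -> \bar R}.
Implicit Types (phi f : mZ -> R).

(** The kernel is centred at [z] as a function of y, so that it can serve as a test function; a
    derivative in [z] then falls on [phi] with a minus sign. *)
Definition mollify phi f (z : Z) : R := \int[mu]_y (f y * phi (y - z : Z)).

Section kernel_function.
Variables (phi : Z -> R) (r : R).
Hypotheses (cphi : continuous phi) (phi0 : forall z, r <= `|z| -> phi z = 0).

Lemma measurable_kernel_shift (z : Z) :
  measurable_fun setT ((fun y => phi (y - z)) : mZ -> R).
Proof.
apply: (@continuous_measurable_spacetime R n (fun y => phi (y - z))) => y.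
apply: (@continuous_comp _ _ _ (fun y : Z => y - z) phi); last exact: cphi.
by apply: cvgB; [exact: cvg_id|exact: cvg_cst].
Qed.

Lemma summable_mollify f (z : Z) : summable_fun mu f ->
  summable_fun mu (fun y => f y * phi (y - z : Z)).
Proof.
move=> If; have [M M0 HM] := compact_support_bounded cphi phi0.
by apply: (summableM_bounded (M := M) If) => //; exact: measurable_kernel_shift.
Qed.

Lemma mollify_dist_le f (z w : Z) e : summable_fun mu f ->
  (forall y, `|phi (y - z) - phi (y - w)| <= e) ->
  `|mollify phi f z - mollify phi f w| <= (\int[mu]_y `|f y|) * e.
Proof.
move=> If H; have Iz := summable_mollify z If; have Iw := summable_mollify w If.
rewrite /mollify -RintegralB//.
have I := summableB Iz Iw.
rewrite (le_trans (le_normr_Rintegral measurableT I))//.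
rewrite -RintegralZr//; last exact: (summable_norm If).
apply: le_Rintegral => //.
- exact: (summable_norm I).
- exact: (summableZr e (summable_norm If)).
- by move=> y _; rewrite -mulrBr normrM ler_wpM2l.
Qed.

Lemma continuous_mollify f : summable_fun mu f -> continuous (mollify phi f).
Proof.
move=> If z; apply/cvgrPdist_le => e e0.
have c0 : 0 < \int[mu]_y `|f y| + 1 by rewrite ltr_wpDl// Rintegral_ge0.
have /(compact_support_uniform cphi phi0)[d d0 Hd] :
  0 < e / (\int[mu]_y `|f y| + 1) by rewrite divr_gt0.
have N : nbhs z (ball z d) by exact: nbhsx_ballx.
apply: filterS N => w; rewrite -ball_normE /ball_/= => zw.
rewrite (@le_trans _ _ ((\int[mu]_y `|f y|) * (e / (\int[mu]_y `|f y| + 1))))//.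
  apply: mollify_dist_le => // y; apply/ltW/Hd.
  by rewrite opprB addrC addrA subrK distrC.
by rewrite mulrCA ger_pMr// ler_pdivrMr// mul1r lerDl.
Qed.

End kernel_function.

(** Differentiation under the integral along the line s v + z, dominated by |f| times a bound of
    phi'. *)
Lemma is_derive_mollify (phi phi' : Z -> R) (v z : Z) r f :
  summable_fun mu f ->
  continuous phi -> (forall z, r <= `|z| -> phi z = 0) ->
  continuous phi' -> (forall z, r <= `|z| -> phi' z = 0) ->
  (forall y, is_derive y v phi (phi' y)) ->
  is_derive z v (mollify phi f) (- mollify phi' f z).
Proof.
move=> If cphi phi0 cphi' phi'0 dphi; apply/is_derive_line.
pose g (s : R) (y : mZ) := f y * phi (y - (s *: v + z) : Z).
have Dg (s : R) (y : mZ) :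
    is_derive s 1 (g ^~ y) (- (f y * phi' (y - (s *: v + z) : Z))).
  have W : is_derive s 1 (fun s : R => - s) (- 1 : R).
    by apply: is_derive_affine => h; rewrite [_%:A]mulr1 mulrN1 opprD.
  have := is_derive_comp W (@is_derive_path _ _ phi phi' v (y - z) (- s) dphi).
  move=> /(is_derive_mulr (is_derive_cst (f y : R) s (1 : R))).
  rewrite mulr0 addr0 mulrN1 mulrN.
  rewrite (_ : - s *: v + (y - z) = y - (s *: v + z)); last first.
    by rewrite scaleNr opprD addrCA.
  congr is_derive; apply/funext => h.
  by rewrite /g scaleNr opprD addrCA.
have [M M0 HM] := compact_support_bounded cphi' phi'0.
have I1 : (`]-1, 1[%classic : set R) 0 by rewrite /= in_itv/= ltrN10 ltr01.
have Ig s : (`]-1, 1[%classic : set R) s -> mu.-integrable setT (EFin \o g s).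
  by move=> _; exact: (summable_mollify cphi phi0).
have derg (s : R) (y : mZ) : (`]-1, 1[%classic : set R) s -> setT y -> derivable (g ^~ y) s 1.
  by move=> _ _; have [] := Dg s y.
have G0 (y : mZ) : 0 <= `|f y| * M by rewrite mulr_ge0.
have IG : mu.-integrable setT (EFin \o (fun y => `|f y| * M)).
  exact: (summableZr M (summable_norm If)).
have Gub (s : R) (y : mZ) : (`]-1, 1[%classic : set R) s -> setT y ->
    `|partial1of2 g s y| <= `|f y| * M.
  move=> _ _; rewrite partial1of2E; have [_ ->] := Dg s y.
  by rewrite normrN normrM ler_wpM2l.
have D := derivable_under_integral measurableT I1 Ig derg G0 IG Gub.
have E := differentiation_under_integral measurableT I1 Ig derg G0 IG Gub.
apply: DeriveDef; first exact: D.
rewrite -derive1E [LHS]E /mollify -[RHS]mulN1r -RintegralZl//; last first.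
  exact: (summable_mollify cphi' phi'0).
apply: eq_Rintegral => y _; rewrite partial1of2E; have [_ ->] := Dg 0 y.
by rewrite scale0r add0r mulN1r.
Qed.

End mollification.

(** * Integrals against a translation invariant measure *)

Section translation_invariant_measure.
Context {R : realType} {n : nat}.
Notation Z := ('rV[R]_n * R)%type.
Notation mZ := ('rV[R]_n * measurableTypeR R)%type.
Variable mu : {sigma_finite_measure set mZ -> \bar R}.
Hypothesis mu_translate : forall (a : mZ) (f : mZ -> \bar R),
  measurable_fun setT f -> (forall z, 0 <= f z)%E ->
  (\int[mu]_z f (z + a)%R = \int[mu]_z f z)%E.
Hypothesis mu_ball : forall r, (mu [set y : Z | `|0 - y| <= r]%R < +oo)%E.

Let mball r : measurable ([set y : Z | `|0 - y| <= r] : set mZ).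
Proof. apply: closed_measurable_spacetime; exact: closed_normball. Qed.

Lemma summable_indic_ball r : summable_fun mu (\1_[set y : Z | `|0 - y| <= r]).
Proof.
apply/integrableP; split; first exact/measurable_EFinP/measurable_indic.
under eq_integral do rewrite /= ger0_norm//.
by rewrite (integral_indic _ measurableT (mball r)) setIT; exact: mu_ball.
Qed.

Lemma summable_compact_support (f : Z -> R) r : continuous f ->
  (forall z, r <= `|z| -> f z = 0) -> summable_fun mu f.
Proof.
move=> cf f0; have [M M0 HM] := compact_support_bounded cf f0.
apply: (@summable_le _ mZ R mu (f : mZ -> R) (fun y => M * \1_[set y : Z | `|0 - y| <= r] y)).
- exact: continuous_measurable_spacetime.
- exact/summableZ/summable_indic_ball.
- move=> y; rewrite indicE; have [yr|yr] := leP r `|y|.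
    by rewrite f0// normr0 mulr_ge0.
  by rewrite mem_set/= ?mulr1// sub0r normrN ltW.
Qed.

Lemma Rintegral_translate (a : Z) (f : mZ -> R) : measurable_fun setT f ->
  \int[mu]_z f (z + a : Z) = \int[mu]_z f z.
Proof.
move=> mf; rewrite /Rintegral; congr fine.
rewrite [LHS]integralE [RHS]integralE.
have mf' : measurable_fun setT (EFin \o f) by exact/measurable_EFinP.
have E1 := @mu_translate a _ (measurable_funepos mf') (fun z => funepos_ge0 _ z).
have E2 := @mu_translate a _ (measurable_funeneg mf') (fun z => funeneg_ge0 _ z).
congr (_ - _)%E; [apply: etrans E1|apply: etrans E2]; apply: eq_integral => z _.
  by rewrite !funeposE.
by rewrite !funenegE.
Qed.

Lemma summable_translate (a : Z) (f : mZ -> R) : summable_fun mu f ->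
  summable_fun mu (fun z => f (z + a : Z)).
Proof.
move=> If; have mf := summable_measurable If.
have mfa : measurable_fun setT (fun z : mZ => f (z + a : Z)).
  exact: (measurableT_comp mf (measurable_spacetime_translate a)).
move/integrableP : If => [_ If]; apply/integrableP; split.
  exact/measurable_EFinP.
apply: le_lt_trans If; rewrite -(@mu_translate a (fun z => `|(EFin \o f) z|)%E)//.
by apply/measurable_EFinP; exact: measurableT_comp.
Qed.

(** Translation invariance gives every difference quotient of [g] integral zero, and the quotients
    converge boundedly to g' on a fixed ball. This replaces integration by parts in all directions,
    time included. *)
Lemma Rintegral_derive0 (g g' : Z -> R) (v : Z) r :
  continuous g -> continuous g' ->
  (forall z, r <= `|z| -> g z = 0) -> (forall z, r <= `|z| -> g' z = 0) ->
  (forall z, is_derive z v g (g' z)) -> \int[mu]_z g' z = 0.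
Proof.
move=> cg cg' g0 g'0 dg.
have Ig := summable_compact_support cg g0.
have mg := summable_measurable Ig.
have [M M0 HM] := compact_support_bounded cg' g'0.
pose s k : R := k.+1%:R^-1.
have s0 k : 0 < s k by rewrite invr_gt0.
have s1 k : s k <= 1 by rewrite invf_le1// ler1n.
pose D k (z : mZ) : R := (s k)^-1 * (g (z + s k *: v : Z) - g z).
have ID k : summable_fun mu (D k).
  by apply/summableZ/summableB => //; exact: summable_translate.
have D0 k : \int[mu]_z D k z = 0.
  rewrite RintegralZl//; last by apply: summableB => //; exact: summable_translate.
  rewrite RintegralB//; last exact: summable_translate.
  by rewrite Rintegral_translate// subrr mulr0.
(* By the mean value theorem a quotient is a value of g' on the segment. *)
have DM k z : `|D k z| <= M.
  rewrite /D normrM gtr0_norm ?invr_gt0// mulrC ler_pdivrMr//.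
  have [||c _] := @MVT_segment R (fun h : R => g (h *: v + z))
    (fun h : R => g' (h *: v + z)) 0 (s k) (ltW (s0 k)).
  - by move=> x _; exact: is_derive_path.
  - apply: continuous_subspaceT => x; apply: differentiable_continuous.
    by apply/derivable1_diffP; have [] := @is_derive_path _ _ g g' v z x dg.
  - rewrite scale0r add0r subr0 [s k *: v + z]addrC => ->.
    by rewrite normrM (gtr0_norm (s0 k)) ler_wpM2r// ltW.
have Dsupp k z : r + `|v| <= `|z| -> D k z = 0.
  move=> rz; rewrite /D !g0 ?subrr ?mulr0//.
    by rewrite (le_trans _ rz)// lerDl.
  rewrite -[z + _]opprK opprD normrN.
  have : `|z| - `|s k *: v| <= `|- z - s k *: v|.
    by rewrite lerBlDr -{1}(normrN z) -{1}(subrK (s k *: v) (- z)) ler_normD.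
  apply: le_trans; rewrite lerBrDr (le_trans _ rz)// lerD2l.
  by rewrite normrZ gtr0_norm// ler_piMl.
have : (fun k => \int[mu]_z (D k z)%:E)%E @ \oo --> (\int[mu]_z (g' z)%:E)%E.
  apply: (@dominated_cvg _ _ _ mu _ measurableT _ _
    (fun z => (M * \1_[set y : Z | `|0 - y| <= r + `|v|] z)%:E)) => //.
  - by move=> k; apply/measurable_EFinP; exact: summable_measurable.
  - move=> z _; apply: cvg_EFin; first exact: nearW.
    have [dz <-] := dg z.
    have H : h^-1 *: (g (h *: v + z) - g z) @[h --> 0^'] --> 'D_v g z := dz.
    have S : s k @[k --> \oo] --> 0^'.
      move=> P; rewrite /dnbhs /within /= => /nbhs_ballP[e /= e0 HP].
      apply: filterS (near_infty_natSinv_lt (PosNum e0)) => k ke.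
      apply: HP; last by rewrite gt_eqF.
      by rewrite -ball_normE /ball_/= sub0r normrN gtr0_norm.
    have := cvg_comp _ _ S H; rewrite (_ : _ \o _ = fine \o (fun k => (D k z)%:E))//.
    by apply/funext => k /=; rewrite /D [z + _]addrC.
  - exact: (summableZ M (summable_indic_ball (r + `|v|))).
  - move=> k z _; rewrite lee_fin indicE; have [zr|zr] := leP (r + `|v|) `|z|.
      by rewrite Dsupp// normr0 mulr_ge0.
    by rewrite mem_set/= ?mulr1// sub0r normrN ltW.
have -> : (fun k => \int[mu]_z (D k z)%:E)%E = cst 0%E.
  apply/funext => k; rewrite -[LHS]fineK; last exact: (integrable_fin_num measurableT (ID k)).
  by congr EFin; exact: D0.
move=> /(cvg_unique _ (cvg_cst _)) => /(_ (@ereal_hausdorff R)) H.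
by rewrite /Rintegral -H.
Unshelve. all: by end_near. Qed.

Lemma integral_kernel_shift (phi : Z -> R) r (z : Z) : continuous phi ->
  (forall z, r <= `|z| -> phi z = 0) ->
  summable_fun mu (fun y => phi (y - z)) /\
  \int[mu]_y phi (y - z) = \int[mu]_y phi y.
Proof.
move=> cphi phi0; have Iphi := summable_compact_support cphi phi0.
split; first exact: (summable_translate (- z) Iphi).
exact: (Rintegral_translate (- z) (summable_measurable Iphi)).
Qed.

(** Tonelli, for which both functions are nonnegative; evenness of [phi] turns the inner integral
    over z into that of a translate of [phi]. *)
Lemma integral_mollify (phi : Z -> R) (f : mZ -> R) r : continuous phi ->
  (forall z, r <= `|z| -> phi z = 0) -> (forall z, 0 <= phi z) ->
  (forall z, phi (- z) = phi z) -> summable_fun mu f -> (forall z, 0 <= f z) ->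
  summable_fun mu (mollify mu phi f) /\
  \int[mu]_z mollify mu phi f z = (\int[mu]_y phi y) * \int[mu]_y f y.
Proof.
move=> cphi phi0 phi_ge0 phiN If f_ge0.
have Iphi := summable_compact_support cphi phi0.
have mphi := summable_measurable Iphi.
have mf := summable_measurable If.
pose F (zy : mZ * mZ) := (f zy.2 * phi (zy.2 - zy.1 : Z))%:E.
have mF : measurable_fun setT F.
  apply/measurable_EFinP; apply: measurable_funM.
    exact: (measurableT_comp mf (@measurable_snd _ _ mZ mZ)).
  apply: (measurableT_comp mphi).
  apply: measurable_fun_pair => /=.
    apply: measurable_fun_rV => i.
    apply: (eq_measurable_fun (fun x : mZ * mZ => x.2.1 ord0 i - x.1.1 ord0 i : R)).
      by move=> x _; rewrite !mxE.
    apply: measurable_funB; apply: (measurableT_comp (measurable_coord i)).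
      exact: (measurableT_comp (@measurable_fst _ _ _ _) (@measurable_snd _ _ mZ mZ)).
    exact: (measurableT_comp (@measurable_fst _ _ _ _) (@measurable_fst _ _ mZ mZ)).
  apply: measurable_funB.
    exact: (measurableT_comp (@measurable_snd _ _ _ _) (@measurable_snd _ _ mZ mZ)).
  exact: (measurableT_comp (@measurable_snd _ _ _ _) (@measurable_fst _ _ mZ mZ)).
have F0 zy : (0 <= F zy)%E by rewrite lee_fin mulr_ge0.
have FE z : (\int[mu]_y F (z, y))%E = (mollify mu phi f z)%:E.
  rewrite /mollify /Rintegral fineK//.
  apply: integrable_fin_num => //; exact: (summable_mollify cphi phi0).
have GE y : (\int[mu]_z F (z, y))%E = (f y * \int[mu]_z phi z)%:E.
  rewrite -(integral_kernel_shift y cphi phi0).2.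
  have I1 := (integral_kernel_shift y cphi phi0).1.
  rewrite -RintegralZl// /Rintegral fineK; last first.
    by apply: integrable_fin_num => //; exact: summableZ.
  apply: eq_integral => z _; rewrite /F /=.
  by rewrite -phiN opprB.
have := @fubini_tonelli _ _ mZ mZ R mu mu F mF F0.
rewrite /fubini_F /fubini_G.
under eq_integral do rewrite FE.
under [in RHS]eq_integral do rewrite GE.
move=> E.
have IG := summableZr (\int[mu]_z phi z) If.
have fG := integrable_fin_num measurableT IG.
have mm : measurable_fun setT (mollify mu phi f : mZ -> R).
  by apply: continuous_measurable_spacetime; exact: (continuous_mollify cphi phi0).
split.
  apply/integrableP; split; first exact/measurable_EFinP.
  under eq_integral => z _.
    rewrite /= ger0_norm; last by apply: Rintegral_ge0 => y _; rewrite mulr_ge0.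
    over.
  by rewrite [X in (X < _)%E]E ltey_eq fG.
rewrite mulrC -RintegralZr//.
by rewrite /Rintegral; congr fine.
Qed.


End translation_invariant_measure.

(** * The p-flux *)

Section Rintegral_sum.
Context d (T : measurableType d) (R : realType).
Variable mu : {measure set T -> \bar R}.

Lemma Rintegral_sum I (s : seq I) (f : I -> T -> R) :
  (forall i, summable_fun mu (f i)) ->
  \int[mu]_y (\sum_(i <- s) f i y) = \sum_(i <- s) \int[mu]_y f i y.
Proof.
move=> If; elim: s => [|i s IH].
  by under eq_Rintegral do rewrite big_nil; rewrite big_nil Rintegral_cst// mul0r.
under eq_Rintegral do rewrite big_cons.
have Is := summable_sum s If.
rewrite RintegralD//; last exact: If.
by rewrite IH big_cons.
Qed.

End Rintegral_sum.

Section p_flux.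
Context {R : realType} {n : nat}.
Variable p : R.
Hypothesis p2 : 2 < p.
Implicit Types x y : 'rV[R]_n.

Definition pflux x (i : 'I_n) : R := enorm x `^ (p - 2) * x ord0 i.

Lemma enorm_ge0 x : 0 <= enorm x. Proof. exact: sqrtr_ge0. Qed.

Lemma enorm_sqr x : enorm x ^+ 2 = \sum_(i < n) x ord0 i ^+ 2.
Proof. by rewrite sqr_sqrtr// sumr_ge0// => i _; exact: sqr_ge0. Qed.

Lemma coord_le_enorm x i : `|x ord0 i| <= enorm x.
Proof.
rewrite -sqrtr_sqr ler_wsqrtr// (bigD1 i)//= lerDl sumr_ge0// => j _.
exact: sqr_ge0.
Qed.

Let powB1 (a : R) : 0 <= a -> a `^ (p - 2) * a = a `^ (p - 1).
Proof.
move=> a0; rewrite mulrC (_ : p - 2 = (p - 1) - 1); last by ring.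
by rewrite mulr_powRB1// subr_gt0 (lt_trans _ p2)// ltr1n.
Qed.

Lemma pflux_le x i : `|pflux x i| <= enorm x `^ (p - 1).
Proof.
rewrite /pflux normrM ger0_norm ?powR_ge0// -powB1 ?enorm_ge0//.
by rewrite ler_wpM2l ?powR_ge0// coord_le_enorm.
Qed.

Lemma pflux_pairing x : \sum_(i < n) x ord0 i * pflux x i = enorm x `^ p.
Proof.
rewrite -mulr_powRB1 ?enorm_ge0//; last by rewrite (lt_trans _ p2).
rewrite -powB1 ?enorm_ge0// mulrCA -expr2 enorm_sqr mulr_sumr.
by apply: eq_bigr => i _; rewrite /pflux expr2 mulrCA.
Qed.

(** With s = |x|^(p-2) and t = |y|^(p-2), twice the pairing is (s - t)(|x|^2 - |y|^2) + (s + t)|x -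
    y|^2, and the two factors of the first product have the same sign. *)
Lemma pflux_monotone x y :
  0 <= \sum_(i < n) (x ord0 i - y ord0 i) * (pflux x i - pflux y i).
Proof.
set s := enorm x `^ (p - 2); set t := enorm y `^ (p - 2).
have -> : \sum_(i < n) (x ord0 i - y ord0 i) * (pflux x i - pflux y i) =
    ((s - t) * (enorm x ^+ 2 - enorm y ^+ 2) +
    (s + t) * \sum_(i < n) (x ord0 i - y ord0 i) ^+ 2) / 2.
  rewrite !enorm_sqr -sumrB !mulr_sumr -big_split /= mulr_suml.
  by apply: eq_bigr => i _; rewrite /pflux -/s -/t; field.
rewrite divr_ge0// addr_ge0//; last first.
  rewrite mulr_ge0//; first by rewrite addr_ge0// powR_ge0.
  by rewrite sumr_ge0// => i _; exact: sqr_ge0.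
have p20 : 0 <= p - 2 by rewrite subr_ge0 ltW.
have [xy|/ltW xy] := leP (enorm x) (enorm y).
  rewrite mulr_le0// subr_le0.
    by rewrite ge0_ler_powR// nnegrE enorm_ge0.
  by rewrite ler_sqr ?nnegrE ?enorm_ge0.
rewrite mulr_ge0// subr_ge0.
  by rewrite ge0_ler_powR// nnegrE enorm_ge0.
by rewrite ler_sqr ?nnegrE ?enorm_ge0.
Qed.

Definition truncate (N : R) x : 'rV[R]_n := if enorm x <= N then x else 0.

Definition energy_above (N : R) x : R := if enorm x <= N then 0 else enorm x `^ p.

Lemma energy_above_ge0 N x : 0 <= energy_above N x.
Proof. by rewrite /energy_above; case: ifP => // _; exact: powR_ge0. Qed.

(** If both norms are at most N, the fluxes are bounded by N^(p-1) and the pairing is linear in the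
    difference of the vectors. Otherwise the larger norm m exceeds N, so m^p is counted by
    [energy_above]; the factor 2 + 2n counts the terms |x|^p and |y|^p and two cross sums of n
    terms, each at most m^p. *)
Lemma pflux_defect_le N x y : 0 <= N ->
  \sum_(i < n) (x ord0 i - y ord0 i) * (pflux x i - pflux y i) <=
  2 * N `^ (p - 1) *
    \sum_(i < n) `|truncate N x ord0 i - truncate N y ord0 i|
  + (2 + 2 * n%:R) * (energy_above N x + energy_above N y).
Proof.
move=> N0; have h2 := p2; have p10 : 0 <= p - 1 by lra.
have C0 : 0 <= 2 + 2 * n%:R :> R by rewrite addr_ge0// mulr_ge0.
have [/andP[xN yN]|xyN] := boolP ((enorm x <= N) && (enorm y <= N)).
  rewrite /truncate xN yN -[leLHS]addr0 lerD//; last first.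
    by rewrite mulr_ge0// addr_ge0// energy_above_ge0.
  rewrite mulr_sumr ler_sum// => i _.
  rewrite (le_trans (ler_norm _))// normrM mulrC ler_wpM2r//.
  rewrite (le_trans (ler_normB _ _))// [leRHS]mulrDl mul1r.
  by rewrite lerD// (le_trans (pflux_le _ _))// ge0_ler_powR// nnegrE enorm_ge0.
rewrite -[leLHS]add0r lerD//.
  by rewrite mulr_ge0 ?mulr_ge0 ?powR_ge0// sumr_ge0.
pose m := Num.max (enorm x) (enorm y).
have xm : enorm x <= m by rewrite le_max lexx.
have ym : enorm y <= m by rewrite le_max lexx orbT.
have m0 : 0 <= m := le_trans (enorm_ge0 x) xm.
have p0 : 0 <= p by lra.
have E : m `^ p <= energy_above N x + energy_above N y.
  have mN : N < m.
    by move: xyN; rewrite negb_and -!ltNge lt_max.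
  have [xy|/ltW xy] := leP (enorm x) (enorm y).
    have my : m = enorm y by rewrite /m max_r.
    have -> : energy_above N y = m `^ p by rewrite /energy_above -my leNgt mN.
    by rewrite lerDr energy_above_ge0.
  have mx : m = enorm x by rewrite /m max_l.
  have -> : energy_above N x = m `^ p by rewrite /energy_above -mx leNgt mN.
  by rewrite lerDl energy_above_ge0.
apply: le_trans (ler_wpM2l C0 E).
have cross u v : enorm u <= m -> enorm v <= m ->
    - \sum_(i < n) u ord0 i * pflux v i <= n%:R * m `^ p.
  move=> um vm; rewrite -sumrN.
  rewrite (_ : n%:R * _ = \sum_(i < n) m `^ p); last first.
    by rewrite sumr_const card_ord mulr_natl.
  rewrite ler_sum// => i _; rewrite (le_trans (ler_norm _))// normrN normrM.
  rewrite -mulr_powRB1//; last lra.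
  apply: ler_pM => //; first exact: le_trans (coord_le_enorm _ _) um.
  by rewrite (le_trans (pflux_le _ _))// ge0_ler_powR// nnegrE enorm_ge0.
have -> : \sum_(i < n) (x ord0 i - y ord0 i) * (pflux x i - pflux y i) =
    enorm x `^ p + enorm y `^ p - \sum_(i < n) x ord0 i * pflux y i
    - \sum_(i < n) y ord0 i * pflux x i.
  rewrite -!pflux_pairing -big_split -!sumrB /=.
  by apply: eq_bigr => i _; ring.
have := cross x y xm ym; have := cross y x ym xm.
have : enorm x `^ p <= m `^ p by rewrite ge0_ler_powR// nnegrE enorm_ge0.
have : enorm y `^ p <= m `^ p by rewrite ge0_ler_powR// nnegrE enorm_ge0.
lra.
Qed.

End p_flux.

Section modulus.
Context {R : realType} {n : nat}.
Notation Z := ('rV[R]_n * R)%type.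
Notation mZ := ('rV[R]_n * measurableTypeR R)%type.
Variable p : R.
Hypothesis p2 : 2 < p.
Variable mu : {measure set mZ -> \bar R}.
Hypothesis mu_dense : forall (D : set mZ) (f : mZ -> R), measurable D ->
  (mu D < +oo)%E -> measurable_fun setT f ->
  mu.-integrable D (EFin \o f) ->
  forall e, 0 < e -> exists2 g : Z -> R, continuous g &
    (\int[mu]_(z in D) (`|f z - g z|)%:E <= e%:E)%E.
Hypothesis mu_ball : forall r, (mu [set y : Z | `|0 - y| <= r]%R < +oo)%E.

Let B r : set mZ := [set y : Z | `|0 - y| <= r].

Let mball r : measurable (B r).
Proof. apply: closed_measurable_spacetime; exact: closed_normball. Qed.

Lemma measurable_enorm : measurable_fun setT (@enorm R n).
Proof.
apply: measurableT_comp.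
  by apply: continuous_measurable_fun; exact: sqrt_continuous.
apply: measurable_sum => i; apply: measurable_funX; exact: measurable_coord.
Qed.

Variable a : mZ -> 'rV[R]_n.
Hypothesis ma : measurable_fun setT a.
Hypothesis Ia : summable_fun mu (fun z => enorm (a z) `^ p).

Let m_enorm : measurable_fun setT (fun z => enorm (a z)).
Proof. exact: (measurableT_comp measurable_enorm ma). Qed.

Let mle N : measurable_fun setT (fun z => enorm (a z) <= N).
Proof. exact: measurable_fun_ler. Qed.

Lemma energy_above_small e : 0 < e -> exists2 N, 0 <= N &
  summable_fun mu (fun z => energy_above p N (a z)) /\
  \int[mu]_z energy_above p N (a z) <= e.
Proof.
move=> e0.
have mE N : measurable_fun setT (fun z => energy_above p N (a z)).
  by apply: measurable_fun_ifT => //; exact: summable_measurable Ia.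
have leE N z : `|energy_above p N (a z)| <= enorm (a z) `^ p.
  rewrite ger0_norm ?energy_above_ge0// /energy_above.
  by case: ifP => // _; exact: powR_ge0.
have IE N : summable_fun mu (fun z => energy_above p N (a z)).
  exact: (summable_le (mE N) Ia (leE N)).
have : (fun N : nat => \int[mu]_z (energy_above p N%:R (a z))%:E)%E @ \oo -->
    (\int[mu]_z (cst 0 z))%E.
  apply: (@dominated_cvg _ _ _ mu _ measurableT _ _
    (fun z => (enorm (a z) `^ p)%:E)) => //.
  - by move=> N; exact/measurable_EFinP.
  - move=> z _; apply: cvg_near_cst; near=> N.
    rewrite /energy_above; suff -> : enorm (a z) <= N%:R by [].
    by near: N; exact: nbhs_infty_ger.
  - by move=> N z _; rewrite lee_fin; exact: leE.
rewrite integral0 => /fine_cvgP[_ /cvgrPdist_le/(_ _ e0)[N _ /(_ N (leqnn N))]].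
rewrite sub0r normrN => /(le_trans (ler_norm _)) H.
by exists N%:R => //; split.
Unshelve. all: by end_near. Qed.

(* [psi] is the L1 distance from [a], truncated at a large height, to a continuous
   field, plus the energy above that height; the continuous field contributes
   only to [k]. *)
Lemma pflux_modulus r e : 0 < e -> exists psi : mZ -> R,
  [/\ summable_fun mu psi, (forall z, 0 <= psi z), \int[mu]_z psi z <= e &
   forall k, 0 < k -> exists2 d, 0 < d & forall y y', `|y| <= r -> `|y'| <= r ->
     `|y - y' : Z| < d ->
     \sum_(i < n) (a y ord0 i - a y' ord0 i) *
       (pflux p (a y) i - pflux p (a y') i) <= psi y + psi y' + k].
Proof.
move=> e0.
pose c : R := 2 + 2 * n%:R.
have c0 : 0 < c by rewrite ltr_wpDr// mulr_ge0.
have [|N N0 [IE HE]] := @energy_above_small (e / 2 / c).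
  by rewrite !divr_gt0.
pose aN i z : R := truncate N (a z) ord0 i.
have maN i : measurable_fun setT (aN i).
  rewrite /aN /truncate.
  rewrite (_ : (fun z => _) = fun z => if enorm (a z) <= N then a z ord0 i else 0).
    by apply: measurable_fun_ifT => //; exact: (measurableT_comp (measurable_coord i) ma).
  by apply/funext => z; case: ifP => //; rewrite mxE.
have aNle i z : `|aN i z| <= N.
  rewrite /aN /truncate; case: ifPn => [|_]; last by rewrite mxE normr0.
  exact: le_trans (coord_le_enorm _ _).
have IaN i : mu.-integrable (B r) (EFin \o aN i).
  apply: measurable_bounded_integrable.
  - exact: mball.
  - exact: mu_ball.
  - exact: measurable_funTS (maN i).
  by exists N; split => // [|M /ltW NM z _]; [exact: num_real|exact: le_trans NM].
pose M : R := 2 * N `^ (p - 1).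
have M0 : 0 <= M by rewrite mulr_ge0// powR_ge0.
(* Makes M n e' at most e / 2; the added ones keep the divisor positive when N or n is zero. *)
pose e' := e / 2 / ((M + 1) * (n%:R + 1)).
have n10 : 0 < n%:R + 1 :> R by rewrite ltr_wpDl.
have M10 : 0 < M + 1 by rewrite ltr_wpDl.
have e'0 : 0 < e' by rewrite !divr_gt0// mulr_gt0.
have /choice[b Hb] : forall i, exists g : Z -> R, continuous g /\
    (\int[mu]_(z in B r) (`|aN i z - g z|)%:E <= e'%:E)%E.
  move=> i; have [g cg Hg] := mu_dense (mball r) (mu_ball r) (maN i) (IaN i) e'0.
  by exists g.
(* The approximation is controlled on the ball of radius r, so the distance is cut off there to be
   summable on the whole space. *)
pose delta i z := `|aN i z - b i z| * \1_(B r) z.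
have mb i : measurable_fun setT (b i : mZ -> R).
  by apply: continuous_measurable_spacetime; have [] := Hb i.
have md i : measurable_fun setT (delta i).
  apply: measurable_funM; last exact: measurable_indic.
  by apply: measurableT_comp => //; exact: measurable_funB.
have Ed i : (\int[mu]_z (delta i z)%:E <= e'%:E)%E.
  have [_] := Hb i; rewrite integral_mkcond; apply: le_trans.
  rewrite le_eqVlt; apply/orP; left; apply/eqP; apply: eq_integral => z _.
  rewrite /delta indicE patchE; case: ifP => _; last by rewrite mulr0.
  by rewrite mulr1.
have d0 i z : 0 <= delta i z by rewrite mulr_ge0.
have Id i : summable_fun mu (delta i).
  apply/integrableP; split; first exact/measurable_EFinP.
  under eq_integral do rewrite /= ger0_norm//.
  exact: le_lt_trans (Ed i) (ltry _).
have Rd i : \int[mu]_z delta i z <= e'.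
  by rewrite /Rintegral -lee_fin fineK//; exact: (integrable_fin_num measurableT (Id i)).
exists (fun z => M * (\sum_(i < n) delta i z) + c * energy_above p N (a z)).
have IS := summable_sum (index_enum 'I_n) Id.
split.
- by apply: summableD; exact: summableZ.
- move=> z; rewrite addr_ge0// mulr_ge0 ?energy_above_ge0 ?(ltW c0)//.
  by rewrite sumr_ge0.
- rewrite RintegralD//; [|exact: summableZ..].
  rewrite !RintegralZl// (splitr e) lerD//; last first.
    by rewrite mulrC -ler_pdivlMr.
  rewrite Rintegral_sum//.
  apply: (@le_trans _ _ (M * (n%:R * e'))).
    rewrite ler_wpM2l// (@le_trans _ _ (\sum_(i < n) e'))// ?ler_sum//.
    by rewrite sumr_const card_ord mulr_natl.
  apply: (@le_trans _ _ ((M + 1) * ((n%:R + 1) * e'))).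
    apply: ler_pM => //; first by rewrite mulr_ge0// ltW.
      by rewrite lerDl.
    by rewrite ler_wpM2r ?lerDl// ltW.
  by rewrite mulrA /e' mulrC divfK// gt_eqF// mulr_gt0.
- move=> k k0.
  have k'0 : 0 < k / ((M + 1) * (n%:R + 1)) by rewrite divr_gt0// mulr_gt0.
  have /choice[d Hd] : forall i, exists d, 0 < d /\ forall y y', `|y| <= r ->
      `|y - y' : Z| < d -> `|b i y - b i y'| < k / ((M + 1) * (n%:R + 1)).
    move=> i; have [|d dd Hd] := @compact_uniform_continuity _ _ _ (b i)
      (@compact_normball R n 0 r) _ _ k'0.
      by move=> x _; have [cb _] := Hb i; exact: cb.
    by exists d; split => // y y' yr; apply: Hd; rewrite /= sub0r normrN.
  exists (\big[Num.min/1]_(i < n) d i).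
    by apply: lt_bigmin => // i _; have [] := Hd i.
  move=> y y' yr y'r yy'.
  apply: (le_trans (pflux_defect_le p2 (a y) (a y') N0)).
  rewrite -/M -/c.
  have By : ((y : mZ) \in B r) by apply/mem_set; rewrite /B/= sub0r normrN.
  have By' : ((y' : mZ) \in B r) by apply/mem_set; rewrite /B/= sub0r normrN.
  have S : \sum_(i < n) `|truncate N (a y) ord0 i - truncate N (a y') ord0 i| <=
      \sum_(i < n) delta i y + \sum_(i < n) delta i y' +
      n%:R * (k / ((M + 1) * (n%:R + 1))).
    rewrite (_ : n%:R * _ = \sum_(i < n) (k / ((M + 1) * (n%:R + 1)))); last first.
      by rewrite sumr_const card_ord mulr_natl.
    rewrite -!big_split/=; apply: ler_sum => i _.
    rewrite /delta !indicE By By' !mulr1 -/(aN i y) -/(aN i y').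
    have [_ /(_ y y' yr)] := Hd i.
    move=> /(_ _)/ltW Hb'.
    have {}Hb' : `|b i y - b i y'| <= k / ((M + 1) * (n%:R + 1)).
      by apply: Hb'; rewrite (lt_le_trans yy')// bigmin_le_cond.
    rewrite (_ : aN i y - aN i y' = (aN i y - b i y) - (aN i y' - b i y') +
      (b i y - b i y')); last by ring.
    rewrite (le_trans (ler_normD _ _))// lerD//.
    exact: ler_normB.
  move: S; set A := (M + 1) * (n%:R + 1); set q := k / A => S.
  have := ler_wpM2l M0 S.
  have : M * (n%:R * q) <= k.
    apply: (@le_trans _ _ ((M + 1) * ((n%:R + 1) * q))).
      apply: ler_pM => //; first by rewrite mulr_ge0// ltW.
        by rewrite lerDl.
      by rewrite ler_wpM2r ?lerDl// ltW.
    by rewrite mulrA -/A /q mulrC divfK// gt_eqF// mulr_gt0.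
  lra.
Qed.

End modulus.

(** * The weak formulation tested against kernels *)

Section kernel_slices.
Context {R : realType} {n : nat}.
Notation Z := ('rV[R]_n * R)%type.

Lemma derive_kernel_out h (z y v : Z) : 0 < h -> h < `|z - y| ->
  'D_v (fun y => kernel h (y - z)) y = 0.
Proof.
move=> h0 hzy; rewrite derive_kernel; apply: (@derive_out _ _ _ _ _ h).
  by move=> x; exact: kernel_out.
by rewrite distrC.
Qed.

Lemma kernel_shift_out h (z y : Z) : 0 < h -> h < `|z - y| ->
  kernel h (y - z) = 0.
Proof. by move=> h0 /ltW; rewrite distrC; exact: kernel_out. Qed.

Lemma test_function_kernel_slice h (z : Z) t (U : set 'rV[R]_n) : 0 < h ->
  [set y | `|z.1 - y| <= h] `<=` U ->
  test_function U (fun x => kernel h ((x, t) - z)).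
Proof.
move=> h0 hU.
have S : tsupport (fun x => kernel h ((x, t) - z)) `<=` [set y | `|z.1 - y| <= h].
  rewrite /tsupport; rewrite [X in _ `<=` X](closure_id _).1; last first.
    exact: closed_normball.
  apply: closure_subset => y /=; apply: contra_neqP => /negP.
  rewrite -ltNge => hy; apply: kernel_shift_out => //.
  by rewrite prod_normE/= lt_max hy.
split.
- apply: (@smoothM _ _ (fun x => space_bump h (x - z.1))).
    exact: smooth_space_bump.
  by move=> k; exact: (@Ck_cst _ _ k (bump (h^-1 * (t - z.2)))).
- apply: bounded_closed_compact; last exact: closed_closure.
  exists (`|z.1| + h); split; first exact: num_real.
  move=> M /ltW HM y /S /= yx; rewrite (le_trans _ HM)//.
  by rewrite -(subKr z.1 y) (le_trans (ler_normB _ _))// lerD2l.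
exact: subset_trans S hU.
Qed.

Lemma derive_kernel_slice h (z : Z) (e : 'rV[R]_n) x t :
  'D_e (fun x => kernel h ((x, t) - z)) x =
  'D_(e, (0 : R)) (fun y => kernel h (y - z)) (x, t).
Proof.
suff [_ ->] : is_derive x e (fun x => kernel h ((x, t) - z))
  ('D_(e, (0 : R)) (fun y => kernel h (y - z)) (x, t)) by [].
have D : is_derive (x, t) (e, (0 : R)) (fun y => kernel h (y - z))
    ('D_(e, (0 : R)) (fun y => kernel h (y - z)) (x, t)).
  by apply: derivableP; apply: smooth_derivable; exact: smooth_kernel.
apply/is_derive_line; have := iffLR (is_derive_line _ _ _ _) D.
congr is_derive; apply/funext => k; congr (kernel h (_ - z)).
by congr (_, _) => /=; rewrite scaler0 add0r.
Qed.

Lemma continuous_derive_kernel h (z v : Z) :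
  continuous ('D_v (fun y => kernel h (y - z))).
Proof. by apply: smooth_continuous; apply: smooth_derive; exact: smooth_kernel. Qed.

Lemma continuous_kernel0 h : continuous (kernel h : Z -> R).
Proof. by apply: smooth_continuous; exact: smooth_kernel0. Qed.

End kernel_slices.

(** Assembles an identity known on almost every slice. The weak gradient of [u] is given at almost
    every time, and is needed in space-time. *)
Lemma fubini_eq_opp d1 d2 (T1 : measurableType d1) (T2 : measurableType d2)
    (R : realType) (m1 : {sigma_finite_measure set T1 -> \bar R})
    (m2 : {sigma_finite_measure set T2 -> \bar R}) (f g : T1 * T2 -> R) :
  (m1 \x m2)%E.-integrable setT (EFin \o f) ->
  (m1 \x m2)%E.-integrable setT (EFin \o g) ->
  {ae m2, forall y, (\int[m1]_x (f (x, y))%:E = - \int[m1]_x (g (x, y))%:E)%E} ->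
  (\int[(m1 \x m2)%E]_z (f z)%:E = - \int[(m1 \x m2)%E]_z (g z)%:E)%E.
Proof.
move=> If Ig fg.
have IN := integrableN Ig.
have Ef := integral21_prod_meas1 If; have EN := integral21_prod_meas1 IN.
have mf := measurable_fubini_G If; have mN := measurable_fubini_G IN.
rewrite -integralN; last exact: integrable_add_def.
rewrite [RHS](_ : _ = (\int[m2]_x fubini_G m1 (-%E \o (EFin \o g)) x)%E); last by rewrite EN.
rewrite [LHS](_ : _ = (\int[m2]_x fubini_G m1 (EFin \o f) x)%E); last by rewrite Ef.
apply: ae_eq_integral => //.
apply: filterS2 fg (ae_integrable2 Ig) => y fgy Iy _.
rewrite /fubini_G/= fgy -integralN//.
exact: integrable_add_def.
Qed.

Lemma powR_le1D (R : realType) (x q p : R) : 0 <= x -> 0 <= q -> q <= p ->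
  x `^ q <= 1 + x `^ p.
Proof.
move=> x0 q0 qp; have [x1|/ltW x1] := leP x 1.
  rewrite (@le_trans _ _ 1) ?lerDl ?powR_ge0//.
  by have := ge0_ler_powR q0 x0 (ler01 : 0 <= 1 :> R) x1; rewrite powR1.
by rewrite (@le_trans _ _ (x `^ p)) ?lerDr// ler_powR.
Qed.

Lemma open_setX (X Y : topologicalType) (A : set X) (B : set Y) :
  open A -> open B -> open (A `*` B).
Proof.
move=> oA oB; rewrite (_ : A `*` B = fst @^-1` A `&` snd @^-1` B)//.
by apply: openI; apply: open_comp => // x _; [exact: cvg_fst|exact: cvg_snd].
Qed.

Section mollified_solution.
Context {R : realType} {n : nat}.
Notation Z := ('rV[R]_n * R)%type.
Notation mZ := ('rV[R]_n * measurableTypeR R)%type.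
Notation mu := (@dspace_time R n).
Variables (p : R) (U : set 'rV[R]_n) (T M : R).
Hypothesis p2 : 2 < p.
Variables (u : Z -> R) (Du : Z -> 'rV[R]_n).
Hypothesis Wu : Lp_loc_W1p_loc p U T u Du.
Hypothesis weak_eq : forall phi : Z -> R, test_function (U `*` `]0, T[) phi ->
  (\int[dspace_time]_(z in U `*` `]0%R, T[)
    (- u z * 'D_(0, 1) phi z + enorm (Du z) `^ (p - 2) *
       \sum_(i < n) Du z ord0 i * 'D_(delta_mx ord0 i, 0) phi z)%:E = 0)%E.
Variables (K1 : set 'rV[R]_n) (t1 t2 : R).
Hypothesis oU : open U.
Hypotheses (cK1 : compact K1) (K1U : K1 `<=` U) (t10 : 0 < t1) (t2T : t2 < T).

Let K : set mZ := K1 `*` `[t1, t2].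

Hypothesis uM : forall z, K z -> `|u z| <= M.

(* Cutting [u] and [Du] off to a compact cylinder makes them summable on the whole
   space, and does not affect integrals against kernels supported in it. *)
Definition local_sol : mZ -> R := u \_ (K1 `*` `[t1, t2]).
Definition local_grad : mZ -> 'rV[R]_n :=
  fun z => if z \in K1 `*` `[t1, t2] then Du z else 0.

Let KQ : K `<=` U `*` `]0, T[.
Proof.
move=> z [Kz] /=; rewrite !in_itv/= => /andP[t1z zt2]; split; first exact: K1U.
by rewrite (lt_le_trans t10 t1z) (le_lt_trans zt2 t2T).
Qed.

Let mQ : measurable (U `*` `]0, T[ : set mZ).
Proof.
by apply: open_measurable_spacetime; apply: open_setX => //; exact: interval_open.
Qed.

Let mK : measurable K.
Proof.
apply: compact_measurable_spacetime; apply: compact_setX => //.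
exact: segment_compact.
Qed.

Let Klty : (mu K < +oo)%E.
Proof.
apply: compact_spacetime_lty; apply: compact_setX => //.
exact: segment_compact.
Qed.

Let IK : summable_fun mu (\1_K).
Proof.
apply/integrableP; split; first exact/measurable_EFinP/measurable_indic.
under eq_integral do rewrite /= ger0_norm//.
by rewrite (integral_indic _ measurableT mK) setIT.
Qed.

Lemma local_grad_coord i :
  (fun z => local_grad z ord0 i) = (fun z => Du z ord0 i) \_ K.
Proof. by apply/funext => z; rewrite /local_grad patchE; case: ifP => // _; rewrite mxE. Qed.

Lemma local_sol_measurable : measurable_fun setT local_sol.
Proof.
have [mu_ _ _ _] := Wu.
by apply/(measurable_restrictT _ mK); apply: (measurable_funS mQ KQ mu_).
Qed.

Lemma local_grad_measurable : measurable_fun setT local_grad.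
Proof.
have [_ mDu _ _] := Wu.
apply: measurable_fun_rV => i; rewrite local_grad_coord.
by apply/(measurable_restrictT _ mK); apply: (measurable_funS mQ KQ (mDu i)).
Qed.

Lemma local_sol_summable : summable_fun mu local_sol.
Proof.
apply: (@summable_le _ mZ R mu _ (fun y => M * \1_K y)).
- exact: local_sol_measurable.
- exact/summableZ.
- move=> y; rewrite /local_sol patchE indicE; case: ifPn => yK.
    by rewrite mulr1 uM//; apply/set_mem.
  by rewrite normr0 mulr0.
Qed.

Lemma local_grad_energy : summable_fun mu (fun z => enorm (local_grad z) `^ p).
Proof.
have [_ _ _ HK] := Wu.
have mE : measurable_fun setT (fun z => enorm (local_grad z)).
  exact: (measurableT_comp (@measurable_enorm R n) local_grad_measurable).
have mF : measurable_fun setT (fun z => enorm (local_grad z) `^ p).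
  exact: (measurableT_comp (measurable_powR p) mE).
apply/integrableP; split; first exact/measurable_EFinP.
apply: le_lt_trans (HK K1 t1 t2 cK1 K1U t10 t2T).
rewrite [leRHS]integral_mkcond; apply: ge0_le_integral => //.
- by apply: measurableT_comp => //; exact/measurable_EFinP.
- have [mu_ mDu _ _] := Wu.
  apply/(measurable_restrictT _ mK)/measurable_EFinP/measurable_funD.
    apply: (measurableT_comp (measurable_powR p)).
    by apply: measurableT_comp => //; exact: (measurable_funS mQ KQ mu_).
  apply: (measurableT_comp (measurable_powR p)).
  apply: (measurableT_comp (@measurable_enorm R n)).
  apply: (eq_measurable_fun local_grad); last exact: measurable_funTS local_grad_measurable.
  by move=> z zK; rewrite /local_grad zK.
- move=> z _; rewrite patchE /local_grad /=; case: ifPn => zK.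
    by rewrite lee_fin ger0_norm ?powR_ge0// lerDr powR_ge0.
  rewrite (_ : enorm 0 = 0) ?powR0 ?normr0//; first by rewrite gt_eqF// (lt_trans _ p2).
  by rewrite /enorm big1 ?sqrtr0// => i _; rewrite mxE expr0n.
Qed.

(** Outside [K] the left side is 0, so the constant of [powR_le1D] can be replaced by the summable
    indicator of [K]. It makes the gradient (q = 1) and the flux (q = p - 1) summable. *)
Let power_le q z : 0 < q -> q <= p ->
  enorm (local_grad z) `^ q <= \1_K z + enorm (local_grad z) `^ p.
Proof.
move=> q0 qp; rewrite indicE; case: (boolP (z \in K)) => zK.
  by apply: powR_le1D => //; rewrite ?enorm_ge0 ?ltW.
rewrite /local_grad (negbTE zK).
rewrite (_ : enorm 0 = 0).
  by rewrite !powR0 ?add0r// gt_eqF// (lt_le_trans q0).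
by rewrite /enorm big1 ?sqrtr0// => i _; rewrite mxE expr0n.
Qed.

Lemma local_grad_summable i : summable_fun mu (fun z => local_grad z ord0 i).
Proof.
apply: (@summable_le _ mZ R mu _
  (fun z => \1_K z + enorm (local_grad z) `^ p)).
- exact: (measurableT_comp (measurable_coord i) local_grad_measurable).
- by apply: summableD IK local_grad_energy.
- move=> z; rewrite (le_trans (coord_le_enorm _ _))//.
  have := @power_le 1 z ltr01; rewrite powRr1 ?enorm_ge0//; apply.
  by move: p2; lra.
Qed.

Lemma local_flux_summable i : summable_fun mu (fun z => pflux p (local_grad z) i).
Proof.
apply: (@summable_le _ mZ R mu _
  (fun z => \1_K z + enorm (local_grad z) `^ p)).
- apply: measurable_funM.
    apply: (measurableT_comp (measurable_powR (p - 2))).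
    exact: (measurableT_comp (@measurable_enorm R n) local_grad_measurable).
  exact: (measurableT_comp (measurable_coord i) local_grad_measurable).
- by apply: summableD IK local_grad_energy.
- move=> z; rewrite (le_trans (pflux_le _ _ _))//.
  by rewrite power_le//; move: p2; lra.
Qed.

Section one_kernel.
Variables (h : R) (z : Z).
Hypotheses (h0 : 0 < h) (zK : [set y : Z | `|z - y| <= h] `<=` K).

Let outside y : ~ K y -> h < `|z - y|.
Proof. by move=> Ky; rewrite ltNge; apply/negP => /zK. Qed.

Let mD v : measurable_fun setT ('D_v (fun y => kernel h (y - z)) : mZ -> R).
Proof. by apply: continuous_measurable_spacetime; exact: continuous_derive_kernel. Qed.

Let bD v : exists N, forall y : mZ, `|'D_v (fun y => kernel h (y - z)) y| <= N.
Proof.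
have c : continuous ('D_v (kernel h : Z -> R)).
  by apply: smooth_continuous; apply: smooth_derive; exact: smooth_kernel0.
have o y : h + 1 <= `|y| -> 'D_v (kernel h : Z -> R) y = 0.
  move=> hy; apply: (@derive_out _ _ _ _ _ h); last by rewrite (lt_le_trans _ hy)// ltrDl.
  by move=> ? ?; exact: kernel_out.
have [N N0 HN] := compact_support_bounded c o.
by exists N => y; rewrite derive_kernel.
Qed.

Let ID f v : summable_fun mu f ->
  summable_fun mu (fun y => f y * 'D_v (fun y => kernel h (y - z)) y).
Proof. by move=> If; have [N HN] := bD v; exact: (summableM_bounded If (mD v) HN). Qed.

Lemma local_weak_time :
  \int[mu]_y (local_sol y * 'D_(0, 1) (fun y => kernel h (y - z)) y) =
  \sum_(i < n) \int[mu]_y (pflux p (local_grad y) i *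
     'D_(delta_mx ord0 i, 0) (fun y => kernel h (y - z)) y).
Proof.
have It := ID (0, 1) local_sol_summable.
have Ix i := ID (delta_mx ord0 i, 0) (local_flux_summable i).
rewrite -Rintegral_sum//; apply/eqP; rewrite eq_sym -subr_eq0; apply/eqP.
rewrite -RintegralB//; last exact: summable_sum.
have /weak_eq : test_function (U `*` `]0, T[) (fun y => kernel h (y - z)).
  by apply: test_function_kernel => //; exact: subset_trans zK KQ.
rewrite integral_mkcond /Rintegral => /(congr1 fine); apply: etrans; congr fine; apply: eq_integral => y _.
rewrite patchE; case: ifPn => yQ.
  case: (boolP (y \in K)) => yK.
    rewrite /local_sol /local_grad /pflux patchE yK.
    rewrite [in RHS]addrC mulNr mulr_sumr; congr (_ - _)%:E.
    by apply: eq_bigr => i _; rewrite mulrA.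
  have Ky := outside (fun k => negP yK (mem_set k)).
  rewrite !derive_kernel_out// !mulr0 big1 ?big1 ?mulr0 ?subr0 ?addr0//.
    by move=> i _; rewrite derive_kernel_out// mulr0.
  by move=> i _; rewrite derive_kernel_out// mulr0.
have Ky : h < `|z - y|.
  by apply: outside => /KQ/mem_set yQ'; rewrite yQ' in yQ.
rewrite !derive_kernel_out// !mulr0 big1 ?mulr0 ?subr0//.
by move=> i _; rewrite derive_kernel_out// mulr0.
Qed.

(** At a time within h of z.2 the slice of the kernel is a test function in [U]; at other times both
    sides vanish. *)
Lemma local_weak_space i :
  \int[mu]_y (local_sol y * 'D_(delta_mx ord0 i, 0) (fun y => kernel h (y - z)) y) =
  - \int[mu]_y (local_grad y ord0 i * kernel h (y - z)).
Proof.
have IDu := ID (delta_mx ord0 i, 0) local_sol_summable.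
have Ik := summable_mollify (@continuous_kernel0 R n h) (fun y => @kernel_out R n h y h0)
  z (local_grad_summable i).
rewrite /Rintegral -fineN; congr fine.
apply: (@fubini_eq_opp _ _ _ _ R (lebesgue_rV n) (@lebesgue_measure R) _ _ IDu Ik).
have [_ _ Wt _] := Wu; 
apply: (@filterS _ _ (ae_filter_ringOfSetsType (@lebesgue_measure R)) _ _ _ Wt) => t {}Wt.
have [zt|zt] := leP `|z.2 - t| h; last first.
  have o x : h < `|z - (x, t)| by rewrite prod_normE/= lt_max zt orbT.
  under eq_integral do rewrite derive_kernel_out// mulr0.
  under [in RHS]eq_integral do rewrite kernel_shift_out// mulr0.
  by rewrite !integral0 oppe0.
have zxK x : `|z.1 - x| <= h -> K (x, t).
  by move=> zx; apply: zK => /=; rewrite prod_normE/= ge_max zx.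
have [K1z tI] : K (z.1, t) by apply: zxK; rewrite subrr normr0 ltW.
have /Wt[_ _ /(_ i (fun x => kernel h ((x, t) - z)))] : 0 < t < T.
  by have [_] := KQ (conj K1z tI); rewrite /= in_itv.
have /[swap]/[apply] : test_function U (fun x => kernel h ((x, t) - z)).
  by apply: test_function_kernel_slice => // x /zxK[/K1U].
rewrite integral_mkcond [in X in _ = X -> _]integral_mkcond.
have o x : ~ K (x, t) -> h < `|z - (x, t)| by exact: outside.
move=> E; transitivity (\int[lebesgue_rV n]_x
  ((fun x => (u (x, t) * 'D_(delta_mx ord0 i) (fun x => kernel h ((x, t) - z)) x)%:E) \_ U) x)%E.
  apply: eq_integral => x _; rewrite patchE derive_kernel_slice /local_sol patchE.
  case: ifPn => xK; first by rewrite (mem_set (K1U (set_mem xK).1)).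
  have ox := o x (fun k => negP xK (mem_set k)).
  by rewrite derive_kernel_out// !mulr0; case: ifPn.
rewrite E; congr (- _)%E; apply: eq_integral => x _; rewrite patchE /local_grad.
case: (boolP ((x, t) \in K)) => xK; first by rewrite (mem_set (K1U (set_mem xK).1)).
have ox := o x (fun k => negP xK (mem_set k)).
by rewrite kernel_shift_out// !mulr0; case: ifPn.
Qed.

End one_kernel.

End mollified_solution.

(** * Comparison with a classical supersolution *)

Section positive_part_power.
Context {R : realType}.

(** At 0 the difference quotient is max(h, 0)^(m+1), which tends to 0 as the exponent m + 2 is at
    least 2. *)
Lemma is_derive_max0X (m : nat) (s : R) :
  is_derive s 1 (fun s : R => Num.max s 0 ^+ m.+2) (m.+2%:R * Num.max s 0 ^+ m.+1).
Proof.
have [s0|s0|->] := ltgtP s 0.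
- apply: (@is_derive_near _ _ (cst 0)).
    near=> y; have y0 : y < 0 by near: y; exact: lt_nbhsl.
    by rewrite /= (max_r (ltW y0)) expr0n.
  rewrite expr0n mulr0; exact: is_derive_cst.
- apply: (@is_derive_near _ _ (fun s : R => s ^+ m.+2)).
    near=> y; have y0 : 0 < y by near: y; exact: lt_nbhsr.
    by rewrite (max_l (ltW y0)).
  have := @is_deriveX _ _ id m.+2 s 1 1 (is_derive_id _ _).
  rewrite [_%:A]mulr1 => D.
  have -> : (fun s : R => s ^+ m.+2) = (id : R -> R) ^+ m.+2.
    by apply/funext => y; rewrite exprfctE.
  exact: D.
rewrite expr0n mulr0.
have C : (fun h : R => h^-1 *: (((fun s : R => Num.max s 0 ^+ m.+2) \o shift 0) (h *: 1) -
    Num.max 0 0 ^+ m.+2)) @ 0^' --> (0 : R).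
  have c : (fun h : R => Num.max h 0 ^+ m.+1) @ 0^' --> (0 : R).
    apply: cvg_trans (_ : (fun h : R => Num.max h 0 ^+ m.+1) @ 0 --> 0).
      by apply: cvg_app; exact: nbhs_dnbhs.
    have : {for 0, continuous (fun h : R => Num.max h 0 ^+ m.+1)}.
      apply: (@continuous_comp _ _ _ (fun h : R => Num.max h 0) (fun x => x ^+ m.+1)).
        by apply: continuous_max; [exact: cvg_id|exact: cvg_cst].
      exact: exprn_continuous.
    by rewrite {1}/prop_for /continuous_at (maxxx (0 : R)) expr0n.
  apply: cvg_trans c; apply: near_eq_cvg; near=> h.
  have h0 : h != 0 by near: h; exact: nbhs_dnbhs_neq.
  rewrite /= addr0 [_%:A]mulr1 maxxx expr0n subr0 [_ *: _]mulrC.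
  have [hp|hn] := leP h 0; first by rewrite !expr0n mul0r.
  by rewrite [in RHS]exprSr mulfK.
apply: DeriveDef; first exact: cvgP C.
exact: cvg_lim C.
Unshelve. all: by end_near.
Qed.

Lemma continuous_max0X (m : nat) : continuous (fun s : R => Num.max s 0 ^+ m).
Proof.
move=> s; apply: (@continuous_comp _ _ _ (fun h : R => Num.max h 0) (fun x => x ^+ m)).
  by apply: continuous_max; [exact: cvg_id|exact: cvg_cst].
exact: exprn_continuous.
Qed.

End positive_part_power.

(** * Extension by zero from a neighbourhood of a compact set *)

Section cut_off.
Context {R : realType} {n : nat}.
Notation Z := ('rV[R]_n * R)%type.
Notation mZ := ('rV[R]_n * measurableTypeR R)%type.
Variables (S : set Z) (rho : R).
Hypotheses (cS : compact S) (rho0 : 0 < rho).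
Implicit Types f g : Z -> R.

Definition thickening : set Z := [set z | exists2 s, S s & `|s - z| < 2 * rho].

(* A function that vanishes at the [far] points of the [thickening] stays as
   regular as it was there when it is extended by zero. *)
Definition far (z : Z) := forall s, S s -> rho <= `|s - z|.

Definition cut f (z : Z) : R := if z \in thickening then f z else 0.

Lemma cut_in f z : thickening z -> cut f z = f z.
Proof. by move=> Uz; rewrite /cut (mem_set Uz). Qed.

Lemma thickening_near z : thickening z -> \forall y \near z, thickening y.
Proof.
move=> [s Ss sz].
have N : nbhs z (ball z (2 * rho - `|s - z|)) by apply: nbhsx_ballx; rewrite subr_gt0.
apply: filterS N => y; rewrite -ball_normE /ball_/= => zy; exists s => //.
rewrite -(subrK z s) -addrA (le_lt_trans (ler_normD _ _))//.
by rewrite -ltrBrDl.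
Qed.

(** A point outside the thickening is at least 2 rho away from [S], so every point within rho of it
    is [far]. *)
Lemma cut_near_out f z : (forall y, thickening y -> far y -> f y = 0) ->
  ~ thickening z -> \forall y \near z, cut f y = 0.
Proof.
move=> f0 Uz; have N : nbhs z (ball z rho) by exact: nbhsx_ballx.
apply: filterS N => y; rewrite -ball_normE /ball_/= => zy.
rewrite /cut; case: ifPn => // /set_mem Uy; apply: f0 => // s Ss.
rewrite leNgt; apply/negP => sy; apply: Uz; exists s => //.
rewrite -(subrK y s) -addrA (le_lt_trans (ler_normD _ _))//.
by rewrite mulrDl mul1r ltrD// distrC.
Qed.

Lemma continuous_cut f : (forall z, thickening z -> {for z, continuous f}) ->
  (forall y, thickening y -> far y -> f y = 0) -> continuous (cut f).
Proof.
move=> cf f0 z; have [Uz|Uz] := pselect (thickening z).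
  rewrite /continuous_at cut_in//; apply: cvg_trans (cf z Uz).
  apply: near_eq_cvg; apply: filterS (thickening_near Uz) => y Uy.
  by rewrite cut_in.
have N := cut_near_out f0 Uz.
rewrite /continuous_at (nbhs_singleton N).
apply: (@cvg_trans _ ((cst 0 : Z -> R) @ z)); last first.
  exact: (@cvg_cst _ (0 : R) _ (nbhs z) _).
apply: near_eq_cvg; by apply: filterS N => y ->.
Qed.

Lemma is_derive_cut f f' z v :
  (forall y, thickening y -> is_derive y v f (f' y)) ->
  (forall y, thickening y -> far y -> f y = 0) ->
  is_derive z v (cut f) (cut f' z).
Proof.
move=> df f0; have [Uz|Uz] := pselect (thickening z).
  rewrite cut_in//; apply: is_derive_near (df z Uz).
  by apply: filterS (thickening_near Uz) => y Uy; rewrite cut_in.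
rewrite {2}/cut; case: ifPn => [/set_mem//|_].
have D0 : is_derive z v (fun _ : Z => 0 : R) 0 by exact: is_derive_cst.
apply: is_derive_near D0.
by apply: filterS (cut_near_out f0 Uz) => y ->.
Qed.

Lemma cut_bounded_support : exists r, forall f z, r <= `|z| -> cut f z = 0.
Proof.
have [M [_ SM]] := compact_bounded cS.
exists (M + 1 + 2 * rho) => f z zr; rewrite /cut; case: ifPn => // /set_mem[s Ss sz].
have : `|s| <= M + 1 by apply: SM => //; rewrite ltrDl.
have : `|z| <= `|s| + `|s - z| by rewrite -{1}(subKr s z) (le_trans (ler_normB _ _)).
move: zr sz; lra.
Qed.

Variable mu : {sigma_finite_measure set mZ -> \bar R}.
Hypothesis mu_translate : forall (a : mZ) (f : mZ -> \bar R),
  measurable_fun setT f -> (forall z, 0 <= f z)%E ->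
  (\int[mu]_z f (z + a)%R = \int[mu]_z f z)%E.
Hypothesis mu_ball : forall r, (mu [set y : Z | `|0 - y| <= r]%R < +oo)%E.

Lemma summable_cut f : (forall z, thickening z -> {for z, continuous f}) ->
  (forall y, thickening y -> far y -> f y = 0) -> summable_fun mu (cut f).
Proof.
move=> cf f0; have [r Hr] := cut_bounded_support.
apply: (summable_compact_support mu_ball (continuous_cut cf f0) (r := r)).
exact: Hr.
Qed.

Lemma integral_cut_derive0 f f' v :
  (forall z, thickening z -> {for z, continuous f}) ->
  (forall z, thickening z -> {for z, continuous f'}) ->
  (forall y, thickening y -> far y -> f y = 0) ->
  (forall y, thickening y -> far y -> f' y = 0) ->
  (forall y, thickening y -> is_derive y v f (f' y)) ->
  \int[mu]_z cut f' z = 0.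
Proof.
move=> cf cf' f0 f'0 df; have [r Hr] := cut_bounded_support.
apply: (@Rintegral_derive0 _ _ mu mu_translate mu_ball (cut f) (cut f') v r).
- exact: continuous_cut.
- exact: continuous_cut.
- exact: Hr.
- exact: Hr.
- by move=> z; exact: is_derive_cut.
Qed.

End cut_off.

(** * Normalised kernel averages *)

Section kernel_average.
Context {R : realType} {n : nat}.
Notation Z := ('rV[R]_n * R)%type.
Notation mZ := ('rV[R]_n * measurableTypeR R)%type.
Variable mu : {sigma_finite_measure set mZ -> \bar R}.
Hypothesis mu_translate : forall (a : mZ) (f : mZ -> \bar R),
  measurable_fun setT f -> (forall z, 0 <= f z)%E ->
  (\int[mu]_z f (z + a)%R = \int[mu]_z f z)%E.
Hypothesis mu_ball : forall r, (mu [set y : Z | `|0 - y| <= r]%R < +oo)%E.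
Hypothesis mu_pos : forall (z : Z) e, 0 < e -> (0 < mu (ball z e))%E.
Variable h : R.
Hypothesis h0 : 0 < h.
Implicit Types f g : mZ -> R.

Definition kernel_mass : R := \int[mu]_y kernel h (y : Z).

Definition average f (z : Z) : R := kernel_mass^-1 * mollify mu (kernel h) f z.

Definition average_derive (v : Z) f (z : Z) : R :=
  - (kernel_mass^-1 * mollify mu ('D_v (kernel h : Z -> R)) f z).

Let ck : continuous (kernel h : Z -> R) := @continuous_kernel0 R n h.

Let ko (z : Z) : h <= `|z| -> kernel h z = 0.
Proof. exact: kernel_out. Qed.

Let cdk v : continuous ('D_v (kernel h : Z -> R)).
Proof. by apply: smooth_continuous; apply: smooth_derive; exact: smooth_kernel0. Qed.

Let dko v (z : Z) : h + 1 <= `|z| -> 'D_v (kernel h : Z -> R) z = 0.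
Proof.
move=> hz; apply: (@derive_out _ _ _ _ _ h) => [y|]; first exact: ko.
by rewrite (lt_le_trans _ hz)// ltrDl.
Qed.

(** The kernel exceeds half of its value at 0 on a small ball, which has positive measure. *)
Lemma kernel_mass_gt0 : 0 < kernel_mass.
Proof.
have k0 := @kernel0_gt0 R n h.
have Ik : summable_fun mu (kernel h) := summable_compact_support mu_ball ck ko.
have [d d0 Hd] := compact_support_uniform ck ko (divr_gt0 k0 (ltr0Sn R 1)).
have mB : measurable (ball (0 : Z) d : set mZ) := measurable_ball_spacetime _ _.
have Bd : (mu (ball (0%R : Z) d) < +oo)%E.
  apply: le_lt_trans (mu_ball d); apply: le_measure.
  - exact: mem_set.
  - by apply: mem_set; apply: closed_measurable_spacetime; exact: closed_normball.
  - by move=> y; rewrite -ball_normE/= => /ltW.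
have Bp := @mu_pos 0 d d0.
have I1 : summable_fun mu (\1_(ball (0 : Z) d : set mZ)).
  apply/integrableP; split; first exact/measurable_EFinP/measurable_indic.
  under eq_integral do rewrite /= ger0_norm//.
  by rewrite (integral_indic _ measurableT mB) setIT.
apply: (@lt_le_trans _ _ (\int[mu]_y (kernel h (0 : Z) / 2 * \1_(ball (0 : Z) d : set mZ) y))).
  rewrite (@RintegralZl _ _ _ mu _ _ _ measurableT I1).
  rewrite mulr_gt0 ?divr_gt0//.
  rewrite /Rintegral (integral_indic _ measurableT mB) setIT.
  by rewrite fine_gt0// Bp.
apply: le_Rintegral => //; first exact: summableZ.
move=> y _; rewrite indicE; case: (boolP (y \in _)) => [/set_mem|_]; last first.
  by rewrite mulr0 kernel_ge0.
rewrite -ball_normE /ball_/= mulr1 => /Hd /ltr_normlW; lra.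
Qed.

Let mass0 : 0 <= kernel_mass^-1.
Proof. by rewrite invr_ge0 ltW// kernel_mass_gt0. Qed.

Section at_point.
Variable z : Z.

(** Integrability is asked against the kernel at [z] only, so that constants, which may fail to be
    summable over the whole space, belong to the domain of the functional. *)
Let A : set (mZ -> R) := fun f => summable_fun mu (fun y => f y * kernel h (y - z : Z)).

Let AS f : summable_fun mu f -> A f.
Proof. by move=> If; exact: (summable_mollify ck ko z If). Qed.

Let A1 : A (cst 1).
Proof.
have [Ik _] := integral_kernel_shift mu_translate mu_ball z ck ko.
by rewrite /A; under eq_fun do rewrite mul1r.
Qed.

Let AD f g : A f -> A g -> A (fun y => f y + g y).
Proof.
move=> Af Ag; have := summableD Af Ag; congr (summable_fun mu).
by apply/funext => y; rewrite mulrDl.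
Qed.

Let AZ k f : A f -> A (fun y => k * f y).
Proof.
move=> Af; have := summableZ k Af; congr (summable_fun mu).
by apply/funext => y; rewrite mulrA.
Qed.

Let E1 : average (cst 1) z = 1.
Proof.
rewrite /average /mollify; under eq_Rintegral do rewrite mul1r.
have [_ ->] := integral_kernel_shift mu_translate mu_ball z ck ko.
by rewrite mulVf// gt_eqF// kernel_mass_gt0.
Qed.

Let ED f g : A f -> A g -> average (fun y => f y + g y) z = average f z + average g z.
Proof.
move=> Af Ag; rewrite /average /mollify; under eq_Rintegral do rewrite mulrDl.
by rewrite RintegralD// mulrDr.
Qed.

Let EZ k f : A f -> average (fun y => k * f y) z = k * average f z.
Proof.
move=> Af; rewrite /average /mollify; under eq_Rintegral do rewrite -mulrA.
by rewrite RintegralZl// mulrCA.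
Qed.

Let Ele f g : A f -> A g -> (forall y : mZ, `|z - y : Z| <= h -> f y <= g y) ->
  average f z <= average g z.
Proof.
move=> Af Ag fg; rewrite /average ler_wpM2l//.
apply: le_Rintegral => // y _.
have [zy|zy] := leP `|z - y : Z| h; first by rewrite ler_wpM2r ?kernel_ge0// fg.
by rewrite kernel_shift_out// !mulr0.
Qed.

Lemma average_dist_le f (c e : R) : summable_fun mu f ->
  (forall y : mZ, `|z - y : Z| <= h -> `|f y - c| <= e) -> `|average f z - c| <= e.
Proof.
move=> If fc; have Ac k : A (cst k).
  by have := AZ k A1; congr (A _); apply/funext => y; rewrite /= mulr1.
have Ec k : average (cst k) z = k.
  rewrite -[RHS]mulr1 -E1 -EZ//; congr (average _ z).
  by apply/funext => y; rewrite /= mulr1.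
rewrite ler_distl; apply/andP; split.
  rewrite -(Ec (c - e)); apply: Ele (Ac _) (AS If) _ => y /fc.
  by rewrite ler_distl => /andP[].
rewrite -(Ec (c + e)); apply: Ele (AS If) (Ac _) _ => y /fc.
by rewrite ler_distl => /andP[].
Qed.

(** Replaces, for averages, the monotonicity of the flux: the average of the flux is not the flux of
    the average, and the loss is measured by [psi] and [k]. *)
Lemma average_flux_pairing p (a : mZ -> 'rV[R]_n) (xi : 'rV[R]_n) (psi : mZ -> R) k :
  2 < p ->
  (forall i, summable_fun mu (fun y => a y ord0 i)) ->
  (forall i, summable_fun mu (fun y => pflux p (a y) i)) ->
  summable_fun mu (fun y => enorm (a y) `^ p) ->
  summable_fun mu psi ->
  (forall y y' : mZ, `|z - y : Z| <= h -> `|z - y' : Z| <= h ->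
    \sum_(i < n) (a y ord0 i - a y' ord0 i) * (pflux p (a y) i - pflux p (a y') i)
      <= psi y + psi y' + k) ->
  - (average psi z + k / 2) <=
  \sum_(i < n) (average (fun y => a y ord0 i) z - xi ord0 i) *
    (average (fun y => pflux p (a y) i) z - pflux p xi i).
Proof.
move=> p2 Ia IF IG Ipsi H.
apply: (@expectation_monotone_pairing _ _ A (fun f => average f z)
  [set y | `|z - y : Z| <= h] A1 AD AZ E1 ED EZ Ele n _ _ (fun y => enorm (a y) `^ p)
  psi (fun i => xi ord0 i) (pflux p xi) k).
- by move=> i; exact: AS.
- by move=> i; exact: AS.
- exact: AS.
- exact: AS.
- by move=> y; rewrite pflux_pairing.
- exact: H.
- by move=> y _; exact: pflux_monotone.
Qed.

End at_point.

Lemma is_derive_average (v z : Z) f : summable_fun mu f ->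
  is_derive z v (average f) (average_derive v f z).
Proof.
move=> If.
have D := @is_derive_mollify _ _ mu _ _ v z (h + 1) f If ck _ (@cdk v) (@dko v) _.
have {}D : is_derive z v (mollify mu (kernel h) f)
    (- mollify mu ('D_v (kernel h : Z -> R)) f z).
  apply: D => [y hy|y]; first by rewrite ko// (le_trans _ hy)// lerDl.
  by apply: derivableP; apply: smooth_derivable; exact: smooth_kernel0.
apply: is_derive_eqr (is_derive_mulr (is_derive_cst kernel_mass^-1 z v) D) _.
by rewrite mulr0 addr0 mulrN.
Qed.

Lemma continuous_average f : summable_fun mu f -> continuous (average f).
Proof.
move=> If z; apply: cvgM; first exact: cvg_cst.
exact: (continuous_mollify ck ko If).
Qed.

Lemma continuous_average_derive v f : summable_fun mu f ->
  continuous (average_derive v f).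
Proof.
move=> If z; apply: cvgN; apply: cvgM; first exact: cvg_cst.
exact: (continuous_mollify (@cdk v) (@dko v) If).
Qed.

Lemma integral_average f : summable_fun mu f -> (forall z, 0 <= f z) ->
  [/\ summable_fun mu (average f), forall z, 0 <= average f z &
    \int[mu]_z average f z = \int[mu]_z f z].
Proof.
move=> If f0.
have [I E] := integral_mollify mu_translate mu_ball ck ko (@kernel_ge0 R n h)
  (@kernelN R n h) If f0.
split.
- exact: summableZ.
- move=> z; rewrite mulr_ge0//; apply: Rintegral_ge0 => y _.
  by rewrite mulr_ge0// kernel_ge0.
- by rewrite /average RintegralZl// E mulKf// gt_eqF// kernel_mass_gt0.
Qed.

End kernel_average.

Section pointwise_continuity.
Context {R : realType} {V : topologicalType}.
Implicit Types (f g : V -> R).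

Lemma contD f g z : {for z, continuous f} -> {for z, continuous g} ->
  {for z, continuous (fun y => f y + g y)}.
Proof. by move=> cf cg; exact: cvgD. Qed.

Lemma contB f g z : {for z, continuous f} -> {for z, continuous g} ->
  {for z, continuous (fun y => f y - g y)}.
Proof. by move=> cf cg; exact: cvgB. Qed.

Lemma contM f g z : {for z, continuous f} -> {for z, continuous g} ->
  {for z, continuous (fun y => f y * g y)}.
Proof. by move=> cf cg; exact: cvgM. Qed.

Lemma cont_cst (k : R) z : {for z, continuous (fun _ : V => k)}.
Proof. exact: cvg_cst. Qed.

Lemma cont_max0X f z m : {for z, continuous f} ->
  {for z, continuous (fun y => Num.max (f y) 0 ^+ m)}.
Proof.
move=> cf; apply: (@continuous_comp _ _ _ f (fun s : R => Num.max s 0 ^+ m)) => //.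
exact: continuous_max0X.
Qed.

End pointwise_continuity.

(** * The energy inequality for the averaged solution *)

Section energy_inequality.
Context {R : realType} {n : nat}.
Notation Z := ('rV[R]_n * R)%type.
Notation mZ := ('rV[R]_n * measurableTypeR R)%type.
Variable mu : {sigma_finite_measure set mZ -> \bar R}.
Hypothesis mu_translate : forall (a : mZ) (f : mZ -> \bar R),
  measurable_fun setT f -> (forall z, 0 <= f z)%E ->
  (\int[mu]_z f (z + a)%R = \int[mu]_z f z)%E.
Hypothesis mu_ball : forall r, (mu [set y : Z | `|0 - y| <= r]%R < +oo)%E.
Hypothesis mu_pos : forall (z : Z) e, 0 < e -> (0 < mu (ball z e))%E.

Variables (p : R) (u : mZ -> R) (a : mZ -> 'rV[R]_n) (h : R).
Hypotheses (h0 : 0 < h) (Iu : summable_fun mu u).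
Hypothesis Ia : forall i, summable_fun mu (fun z => a z ord0 i).
Hypothesis IF : forall i, summable_fun mu (fun z => pflux p (a z) i).

Variables (S : set Z) (rho tau : R).
Hypotheses (cS : compact S) (rho0 : 0 < rho).
Let U1 := thickening S rho.

Let F i (z : mZ) := pflux p (a z) i.
Let J := average mu h u.
Let Ja i := average mu h (fun z => a z ord0 i).
Let JF i := average mu h (F i).
Let e i : Z := (delta_mx ord0 i, 0).

Hypothesis eq_time : forall z, U1 z ->
  average_derive mu h (0, 1) u z = \sum_(i < n) average_derive mu h (e i) (F i) z.
Hypothesis eq_space : forall z i, U1 z -> average_derive mu h (e i) u z = Ja i z.

Variables (v : Z -> R) (xi : Z -> 'rV[R]_n) (vt : Z -> R) (q : 'I_n -> Z -> R).
Let P i (z : Z) := pflux p (xi z) i.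
Hypothesis cv : forall z, U1 z -> {for z, continuous v}.
Hypothesis cxi : forall z i, U1 z -> {for z, continuous (fun z => xi z ord0 i)}.
Hypothesis cvt : forall z, U1 z -> {for z, continuous vt}.
Hypothesis cP : forall z i, U1 z -> {for z, continuous (P i)}.
Hypothesis cq : forall z i, U1 z -> {for z, continuous (q i)}.
Hypothesis dvt : forall z, U1 z -> is_derive z (0, 1) v (vt z).
Hypothesis dvx : forall z i, U1 z -> is_derive z (e i) v (xi z ord0 i).
Hypothesis dP : forall z i, U1 z -> is_derive z (e i) (P i) (q i z).
Hypothesis supersol : forall z, U1 z -> z.2 <= tau -> \sum_(i < n) q i z <= vt z.

Hypothesis vanish : forall z, U1 z -> far S rho z -> J z - v z <= 0 \/ tau <= z.2.

Variables (psi : mZ -> R) (k N r : R).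
Hypotheses (Ipsi : summable_fun mu psi) (psi0 : forall z, 0 <= psi z) (k0 : 0 < k) (N0 : 0 <= N).
Hypothesis Ur : forall z, U1 z -> `|z| <= r.

Let m (z : Z) := Num.max (J z - v z) 0.
Let c (z : Z) := Num.max (tau - z.2) 0.

Hypothesis pairing : forall z, U1 z ->
  - (average mu h psi z + k / 2) <=
  \sum_(i < n) (Ja i z - xi z ord0 i) * (JF i z - P i z).
Hypothesis weight : forall z, U1 z -> 6 * m z * c z ^+ 2 <= N.

Let mc0 z : U1 z -> far S rho z -> m z = 0 \/ c z = 0.
Proof.
by move=> Uz /(vanish Uz)[H|H]; [left; apply: max_r|right; apply: max_r; rewrite subr_le0].
Qed.

(** [tf] is to be differentiated in time, and [sf i] along the i-th axis. The derivatives keep the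
    shape in which the product and chain rules deliver them, whence the factors -1 and 0 from the
    derivatives of tau - t. *)
Let tf z := m z ^+ 3 * c z ^+ 2.
Let dtf z := m z ^+ 3 * (2 * c z * -1) +
  c z ^+ 2 * (3 * m z ^+ 2 * (average_derive mu h (0, 1) u z - vt z)).
Let sf i z := (m z ^+ 2 * c z ^+ 2) * (JF i z - P i z).
Let dsf i z := (m z ^+ 2 * c z ^+ 2) * (average_derive mu h (e i) (F i) z - q i z) +
  (JF i z - P i z) * (m z ^+ 2 * (2 * c z * 0) +
     c z ^+ 2 * (2 * m z * (Ja i z - xi z ord0 i))).

Let cm (j : nat) z : U1 z -> {for z, continuous (fun z => m z ^+ j)}.
Proof.
move=> Uz; apply: cont_max0X; apply: contB; last exact: cv.
exact: (continuous_average h0 Iu).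
Qed.

Let cc (j : nat) (z : Z) : {for z, continuous (fun z => c z ^+ j)}.
Proof.
apply: cont_max0X; apply: contB; first exact: cont_cst.
exact: cvg_snd.
Qed.

Let dc1 j (z : Z) : is_derive z (0, 1) (fun z => c z ^+ j.+2) (j.+2%:R * c z ^+ j.+1 * -1).
Proof.
apply: (@is_derive_comp _ _ (fun s => Num.max s 0 ^+ j.+2) (fun z : Z => tau - z.2)).
  by apply: is_derive_affine => x /=; rewrite [x%:A]mulr1; ring.
exact: is_derive_max0X.
Qed.

Let dc0 j (z : Z) i : is_derive z (e i) (fun z => c z ^+ j.+2) (j.+2%:R * c z ^+ j.+1 * 0).
Proof.
apply: (@is_derive_comp _ _ (fun s => Num.max s 0 ^+ j.+2) (fun z : Z => tau - z.2)).
  by apply: is_derive_affine => x /=; rewrite scaler0 add0r mulr0 add0r.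
exact: is_derive_max0X.
Qed.

Let dm j (z w : Z) dJ dv : is_derive z w J dJ -> is_derive z w v dv ->
  is_derive z w (fun z => m z ^+ j.+2) (j.+2%:R * m z ^+ j.+1 * (dJ - dv)).
Proof.
move=> HJ Hv.
apply: (@is_derive_comp _ _ (fun s => Num.max s 0 ^+ j.+2) (fun z : Z => J z - v z)).
exact: is_derive_max0X.
Qed.

Let int_t : summable_fun mu (cut S rho dtf) /\ \int[mu]_z cut S rho dtf z = 0.
Proof.
have ct z : U1 z -> {for z, continuous dtf}.
  move=> Uz; apply: contD.
    apply: contM; first exact: cm.
    by apply: contM; last exact (@cont_cst _ _ _ _); apply: contM (@cont_cst _ _ _ _) (@cc 1%N z).
  apply: contM; first exact: cc.
  apply: contM; first by apply: contM (@cont_cst _ _ _ _) (@cm 2%N z Uz).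
  apply: contB; last exact: cvt.
  exact: (continuous_average_derive h0 Iu).
have t0 y : U1 y -> far S rho y -> dtf y = 0.
  by rewrite /dtf => Uy /(mc0 Uy)[->|->]; rewrite !(expr0n, mul0r, mulr0, addr0).
split; first exact: summable_cut.
apply: (@integral_cut_derive0 _ _ S rho cS rho0 mu mu_translate mu_ball tf dtf (0, 1)) => //.
- by move=> z Uz; apply: contM (@cm 3%N z Uz) (@cc 2%N z).
- by rewrite /tf => y Uy /(mc0 Uy)[->|->]; rewrite !(expr0n, mul0r, mulr0, addr0).
- move=> y Uy; apply: is_derive_eqr.
    apply: (is_derive_mulr _ (dc1 0 y)).
    exact: (dm 1 (is_derive_average h0 _ _ Iu) (dvt Uy)).
  by [].
Qed.

Let int_s i : summable_fun mu (cut S rho (dsf i)) /\ \int[mu]_z cut S rho (dsf i) z = 0.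
Proof.
have cs z : U1 z -> {for z, continuous (dsf i)}.
  move=> Uz; have cJP : {for z, continuous (fun z => JF i z - P i z)}.
    by apply: contB; last exact (@cP z i Uz); exact: (continuous_average h0 (IF i)).
  apply: contD.
    apply: contM; first by apply: contM (@cm 2%N z Uz) (@cc 2%N z).
    by apply: contB; last exact (@cq z i Uz); exact: (continuous_average_derive h0 (IF i)).
  apply: contM cJP _; apply: contD.
    apply: contM (@cm 2%N z Uz) _; apply: contM; last exact (@cont_cst _ _ _ _).
    by apply: contM (@cont_cst _ _ _ _) (@cc 1%N z).
  apply: contM (@cc 2%N z) _; apply: contM.
    by apply: contM (@cont_cst _ _ _ _) (@cm 1%N z Uz).
  by apply: contB; last exact (@cxi z i Uz); exact: (continuous_average h0 (Ia i)).
have s0 y : U1 y -> far S rho y -> dsf i y = 0.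
  by rewrite /dsf => Uy /(mc0 Uy)[->|->]; rewrite !(expr0n, mul0r, mulr0, addr0).
split; first exact: summable_cut.
apply: (@integral_cut_derive0 _ _ S rho cS rho0 mu mu_translate mu_ball (sf i) (dsf i) (e i)) => //.
- move=> z Uz; apply: contM; first by apply: contM (@cm 2%N z Uz) (@cc 2%N z).
  by apply: contB; last exact (@cP z i Uz); exact: (continuous_average h0 (IF i)).
- by rewrite /sf => y Uy /(mc0 Uy)[->|->]; rewrite !(expr0n, mul0r, mulr0, addr0).
- move=> y Uy; apply: is_derive_eqr.
    apply: is_derive_mulr.
      apply: (is_derive_mulr _ (dc0 0 y i)).
      apply: (dm 0 _ (dvx i Uy)).
      exact: (is_derive_average h0 (e i) y Iu).
    apply: (is_derive_subr _ (dP i Uy)).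
    exact: (is_derive_average h0 (e i) y (IF i)).
  by rewrite /dsf (eq_space i Uy) !expr1.
Qed.

Let B : set mZ := [set y : Z | `|0 - y| <= r].

Let mB : measurable B.
Proof. by apply: closed_measurable_spacetime; exact: closed_normball. Qed.

Let IB : summable_fun mu (\1_B) := summable_indic_ball mu_ball r.

Let L z := 2 * m z ^+ 3 * c z.

(** The divergence of the averaged flux is replaced by the time derivative of the average, which is
    the averaged equation. *)
Let dsfE z : U1 z -> \sum_(i < n) dsf i z =
  m z ^+ 2 * c z ^+ 2 *
    (average_derive mu h (0, 1) u z - \sum_(i < n) q i z) +
  2 * m z * c z ^+ 2 * \sum_(i < n) (Ja i z - xi z ord0 i) * (JF i z - P i z).
Proof.
move=> Uz; rewrite (eq_time Uz) -sumrB !mulr_sumr -big_split/=.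
by apply: eq_bigr => i _; rewrite /dsf; ring.
Qed.

Let D z := cut S rho dtf z - 3 * \sum_(i < n) cut S rho (dsf i) z.

(** Outside the thickening every cut function is 0 and the error term is nonnegative. Inside, -D
    equals L plus a nonnegative term from the supersolution and a weighted pairing that may be
    negative. *)
Let pointwise z : cut S rho L z <=
  N * (average mu h psi z + k / 2 * \1_B z) - D z.
Proof.
have [_ /(_ z) a0 _] := integral_average mu_translate mu_ball mu_pos h0 Ipsi psi0.
have k20 : 0 <= k / 2 by rewrite divr_ge0// ltW.
have [Uz|Uz] := pselect (U1 z); last first.
  have C0 f : cut S rho f z = 0 by rewrite /cut; case: ifPn => // /set_mem.
  rewrite /D !C0 big1 => [|i _]; last exact: C0.
  by rewrite mulr0 !subr0 mulr_ge0// addr_ge0// mulr_ge0.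
rewrite /D !cut_in//; under eq_bigr do rewrite cut_in//.
rewrite dsfE// indicE mem_set; last by rewrite /B/= sub0r normrN Ur.
rewrite mulr1 /L /dtf.
have m0 : 0 <= m z by rewrite le_max lexx orbT.
have := pairing Uz; have := weight Uz; have W0 : 0 <= 6 * m z * c z ^+ 2.
  by apply: mulr_ge0; [exact: mulr_ge0|exact: sqr_ge0].
set SP := \sum_(i < n) _; set Sq := \sum_(i < n) _; set w := 6 * m z * c z ^+ 2 => wN pSP.
(* The weight 6 m c^2, which is 3 from [D] times 2 from differentiating m^2, is bounded by N. *)
have H1 : - (w * SP) <= N * (average mu h psi z + k / 2).
  apply: (@le_trans _ _ (w * (average mu h psi z + k / 2))).
    by rewrite -mulrN ler_wpM2l// lerNl.
  by rewrite ler_wpM2r// addr_ge0.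
(* The supersolution inequality is known up to time tau; afterwards c = 0. *)
have H2 : 3 * (m z ^+ 2 * c z ^+ 2) * (Sq - vt z) <= 0.
  have [zt|tz] := leP z.2 tau.
    rewrite mulr_ge0_le0 ?subr_le0 ?supersol//; apply: mulr_ge0 => //.
    by apply: mulr_ge0; exact: sqr_ge0.
  by rewrite (_ : c z = 0) ?expr0n/= ?(mulr0, mul0r)// /c max_r ?subr_le0 ?ltW.
move: H1 H2; rewrite /w.
set A := average mu h psi z; set At := average_derive _ _ _ _ _; set V := vt z.
set X := m z; set Y := c z; set NA := N * _.
(* The time derivative [At] cancels between the two parts of [D]; the factor 3 before the sum was
   chosen for this. *)
have -> : NA - (X ^+ 3 * (2 * Y * -1) + Y ^+ 2 * (3 * X ^+ 2 * (At - V)) -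
   3 * (X ^+ 2 * Y ^+ 2 * (At - Sq) + 2 * X * Y ^+ 2 * SP)) =
  NA + 2 * X ^+ 3 * Y - 3 * (X ^+ 2 * Y ^+ 2) * (Sq - V) + 6 * X * Y ^+ 2 * SP.
  by ring.
lra.
Qed.

(* [D] integrates to zero, as a derivative in time minus a divergence; the
   supersolution inequality and [pairing] bound it from above by the negative
   term [- L] and a small error. *)
Lemma mollified_energy_inequality : summable_fun mu (cut S rho L) /\
  \int[mu]_z cut S rho L z <= N * (\int[mu]_z psi z + k / 2 * fine (mu B)).
Proof.
have [IA A0 EA] := integral_average mu_translate mu_ball mu_pos h0 Ipsi psi0.
have Is := summable_sum (index_enum 'I_n) (fun i => (int_s i).1).
have [It Et] := int_t.
have ID : summable_fun mu D by apply: summableB => //; exact: summableZ.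
have ED : \int[mu]_z D z = 0.
  rewrite RintegralB//; last exact: summableZ.
  rewrite RintegralZl// Rintegral_sum => [|i]; last exact: (int_s i).1.
  by rewrite Et big1 ?mulr0 ?subr0// => i _; exact: (int_s i).2.
have IR : summable_fun mu (fun z => average mu h psi z + k / 2 * \1_B z).
  by apply: summableD => //; exact: summableZ.
have IL : summable_fun mu (cut S rho L).
  apply: summable_cut => // z Uz; last first.
    by rewrite /L => /(mc0 Uz)[->|->]; rewrite !(expr0n, mul0r, mulr0).
  by apply: contM; last exact (@cc 1%N z); apply: contM (@cont_cst _ _ _ _) (@cm 3%N z Uz).
split => //.
apply: (@le_trans _ _ (\int[mu]_z (N * (average mu h psi z + k / 2 * \1_B z) - D z))).
  apply: le_Rintegral => //; apply: summableB => //; exact: summableZ.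
rewrite RintegralB//; last exact: summableZ.
rewrite ED subr0 RintegralZl// RintegralD//; last exact: summableZ.
by rewrite EA RintegralZl// /Rintegral (integral_indic _ measurableT mB) setIT.
Qed.

End energy_inequality.

(** * Comparison near the contact set, by vanishing mollification *)

Section comparison.
Context {R : realType} {n : nat}.
Notation Z := ('rV[R]_n * R)%type.
Notation mZ := ('rV[R]_n * measurableTypeR R)%type.
Variable mu : {sigma_finite_measure set mZ -> \bar R}.
Hypothesis mu_translate : forall (a : mZ) (f : mZ -> \bar R),
  measurable_fun setT f -> (forall z, 0 <= f z)%E ->
  (\int[mu]_z f (z + a)%R = \int[mu]_z f z)%E.
Hypothesis mu_ball : forall r, (mu [set y : Z | `|0 - y| <= r]%R < +oo)%E.
Hypothesis mu_pos : forall (z : Z) e, 0 < e -> (0 < mu (ball z e))%E.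
Hypothesis mu_dense : forall (D : set mZ) (f : mZ -> R), measurable D ->
  (mu D < +oo)%E -> measurable_fun setT f ->
  mu.-integrable D (EFin \o f) ->
  forall e, 0 < e -> exists2 g : Z -> R, continuous g &
    (\int[mu]_(z in D) (`|f z - g z|)%:E <= e%:E)%E.

Variables (p : R) (u : mZ -> R) (a : mZ -> 'rV[R]_n).
Hypotheses (p2 : 2 < p) (Iu : summable_fun mu u) (ma : measurable_fun setT a).
Hypothesis IE : summable_fun mu (fun z => enorm (a z) `^ p).
Hypothesis Ia : forall i, summable_fun mu (fun z => a z ord0 i).
Hypothesis IF : forall i, summable_fun mu (fun z => pflux p (a z) i).

Let e i : Z := (delta_mx ord0 i, 0).

Variable K : set Z.
Hypothesis weak_time : forall h z, 0 < h -> [set y : Z | `|z - y| <= h] `<=` K ->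
  \int[mu]_y (u y * 'D_(0, 1) (fun y => kernel h (y - z)) y) =
  \sum_(i < n) \int[mu]_y (pflux p (a y) i * 'D_(e i) (fun y => kernel h (y - z)) y).
Hypothesis weak_space : forall h z, 0 < h -> [set y : Z | `|z - y| <= h] `<=` K ->
  forall i, \int[mu]_y (u y * 'D_(e i) (fun y => kernel h (y - z)) y) =
  - \int[mu]_y (a y ord0 i * kernel h (y - z)).

Variables (S : set Z) (rho tau : R).
Hypotheses (cS : compact S) (rho0 : 0 < rho).
Hypothesis SK : forall s y, S s -> `|s - y| < 4 * rho -> K y.
Hypothesis cu : forall s y : Z, S s -> `|s - y| < 4 * rho -> {for y, continuous (u : Z -> R)}.

Variables (v : Z -> R) (xi : Z -> 'rV[R]_n) (vt : Z -> R) (q : 'I_n -> Z -> R).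
Let P i (z : Z) := pflux p (xi z) i.
Hypothesis cv : forall z, K z -> {for z, continuous v}.
Hypothesis cxi : forall z i, K z -> {for z, continuous (fun z => xi z ord0 i)}.
Hypothesis cvt : forall z, K z -> {for z, continuous vt}.
Hypothesis cP : forall z i, K z -> {for z, continuous (P i)}.
Hypothesis cq : forall z i, K z -> {for z, continuous (q i)}.
Hypothesis dvt : forall z, K z -> is_derive z (0, 1) v (vt z).
Hypothesis dvx : forall z i, K z -> is_derive z (e i) v (xi z ord0 i).
Hypothesis dP : forall z i, K z -> is_derive z (e i) (P i) (q i z).
Hypothesis supersol : forall z, K z -> z.2 <= tau -> \sum_(i < n) q i z <= vt z.
Hypothesis below : forall s y : Z, S s -> `|s - y| < 4 * rho -> ~ S y ->
  y.2 <= tau -> u y < v y.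

Let U1 := thickening S rho.
(** The closed counterpart of [U1]: compact, so [u] is uniformly continuous around it. Kernels of
    radius below rho centred in [U1] stay within 3 rho of [S], hence in [K]. *)
Let L : set Z := [set z | exists2 s, S s & `|s - z| <= 2 * rho].

Let U1L : U1 `<=` L.
Proof. by move=> z [s Ss sz]; exists s => //; exact: ltW. Qed.

Let lt24 (x : R) : x <= 2 * rho -> x < 4 * rho.
Proof. by have := rho0; lra. Qed.

Let LK : L `<=` K.
Proof. by move=> z [s Ss sz]; apply: (SK Ss); exact: lt24. Qed.

Let cL : compact L.
Proof.
rewrite (_ : L = (fun x : Z * Z => x.1 - x.2) @` (S `*` [set y : Z | `|0 - y| <= 2 * rho])).
  apply: continuous_compact; last by apply: compact_setX => //; exact: compact_normball.
  by apply: continuous_subspaceT => x; apply: cvgB; [exact: cvg_fst|exact: cvg_snd].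
apply/seteqP; split => [z [s Ss sz]|z [[s y] [/= Ss sy] <-]].
  exists (s, s - z) => /=; last by rewrite subKr.
  by split => //; rewrite /= sub0r normrN.
by exists s => //; rewrite subKr -normrN -sub0r.
Qed.

Let cLu z : L z -> {for z, continuous (u : Z -> R)}.
Proof. by move=> [s Ss sz]; apply: (cu Ss); exact: lt24. Qed.

(** Far points are not in [S], so v - u is positive on the compact set they form in [L] up to time
    tau; the bound on its inverse gives eta. This margin absorbs the error of averaging. *)
Let gap : exists2 eta, 0 < eta & forall z, U1 z -> far S rho z -> z.2 <= tau ->
  u z - v z <= - eta.
Proof.
pose C : set Z := L `&` (far S rho `&` [set z | z.2 <= tau]).
have cC : compact C.
  apply: compact_closedI => //; apply: closedI.
    rewrite (_ : far S rho = \bigcap_(s in S) [set z : Z | rho <= `|s - z|])//.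
    apply: closed_bigI => s _.
    apply: (@closed_comp _ _ (fun z : Z => `|s - z|) [set x : R | rho <= x]).
      move=> z _; apply: (@continuous_comp _ _ _ (fun z : Z => s - z) (fun z : Z => `|z|)).
        by apply: cvgB; [exact: cvg_cst|exact: cvg_id].
      exact: norm_continuous.
    exact: closed_ge.
  apply: (@closed_comp _ _ (fun z : Z => z.2) [set x : R | x <= tau]).
    by move=> z _; exact: cvg_snd.
  exact: closed_le.
have Cpos z : C z -> 0 < v z - u z.
  move=> [[s Ss sz] [Fz zt]]; rewrite subr_gt0.
  apply: (below Ss) => //; first exact: lt24.
  by move=> /Fz; rewrite subrr normr0 leNgt rho0.
have cg z : C z -> {for z, continuous (fun z : Z => (v z - u z)^-1)}.
  move=> Cz; apply: cvgV; first by rewrite gt_eqF// Cpos.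
  by apply: contB; [exact: cv (LK Cz.1)|exact: cLu Cz.1].
have [M M0 HM] := compact_continuous_bounded cC cg.
have M1 : 0 < M + 1 by rewrite ltr_wpDl.
exists (M + 1)^-1; first by rewrite invr_gt0.
move=> z Uz Fz zt; have Cz : C z by split => //; exact: U1L.
rewrite -opprB lerN2 -[leRHS]invrK lef_pV2 ?posrE ?invr_gt0 ?Cpos//.
by rewrite (le_trans (ler_norm _))// (le_trans (HM z Cz))// lerDl.
Qed.

Let approx e1 : 0 < e1 -> exists2 d, 0 < d & forall h, 0 < h -> h < d ->
  forall z, L z -> `|average mu h u z - u z| <= e1.
Proof.
move=> e10; have [d d0 Hd] := compact_uniform_continuity cL cLu e10.
exists d => // h h0 hd z Lz.
apply: (average_dist_le mu_translate mu_ball mu_pos h0 Iu) => y zy.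
by rewrite distrC ltW// Hd// (le_lt_trans zy).
Qed.

Let near_ball (z0 : Z) d th : S z0 -> d < u z0 - v z0 -> th < tau - z0.2 ->
  exists2 r0, 0 < r0 & forall y, `|z0 - y| < r0 ->
    [/\ U1 y, d < u y - v y & th < tau - y.2].
Proof.
move=> Sz hd ht.
have z00 : `|z0 - z0| < 2 * rho by rewrite subrr normr0 mulr_gt0.
have Uz : U1 z0 by exists z0.
have N1 : \forall y \near z0, d < u y - v y.
  have c : {for z0, continuous (fun z : Z => u z - v z)}.
    by apply: contB; [exact: cLu (U1L Uz)|exact: cv (LK (U1L Uz))].
  exact: (cvgr_gt _ c).
have N2 : \forall y \near z0, th < tau - y.2.
  have c : {for z0, continuous (fun z : Z => tau - z.2)}.
    by apply: contB; [exact: cont_cst|exact: cvg_snd].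
  exact: (cvgr_gt _ c).
have /nbhs_ballP[r0 /= r00 Hr] : nbhs z0 [set y | [/\ U1 y, d < u y - v y & th < tau - y.2]].
  by apply: filterS3 (thickening_near Uz) N1 N2 => y; split.
by exists r0 => // y zy; apply: Hr; rewrite -ball_normE.
Qed.

Let eq_time h z : 0 < h -> h < rho -> U1 z ->
  average_derive mu h (0, 1) u z =
  \sum_(i < n) average_derive mu h (e i) (fun y => pflux p (a y) i) z.
Proof.
move=> h0 hr [s Ss sz]; have zK : [set y : Z | `|z - y| <= h] `<=` K.
  move=> y /= zy; apply: (SK Ss); rewrite -(subrK z s) -addrA.
  by rewrite (le_lt_trans (ler_normD _ _))//; move: rho0; lra.
have E f w : mollify mu ('D_w (kernel h : Z -> R)) f z =
    \int[mu]_y (f y * 'D_w (fun y => kernel h (y - z)) y).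
  by apply: eq_Rintegral => y _; rewrite derive_kernel.
transitivity (- ((kernel_mass mu h)^-1 * \sum_(i < n)
    \int[mu]_y (pflux p (a y) i * 'D_(e i) (fun y => kernel h (y - z)) y))).
  congr (- (_ * _)); rewrite E; exact: weak_time h0 zK.
rewrite mulr_sumr -sumrN; apply: eq_bigr => i _.
exact: (congr1 (fun t => - ((kernel_mass mu h)^-1 * t)) (esym (E _ _))).
Qed.

Let eq_space h z i : 0 < h -> h < rho -> U1 z ->
  average_derive mu h (e i) u z = average mu h (fun y => a y ord0 i) z.
Proof.
move=> h0 hr [s Ss sz]; have zK : [set y : Z | `|z - y| <= h] `<=` K.
  move=> y /= zy; apply: (SK Ss); rewrite -(subrK z s) -addrA.
  by rewrite (le_lt_trans (ler_normD _ _))//; move: rho0; lra.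
have E : mollify mu ('D_(e i) (kernel h : Z -> R)) u z =
    - mollify mu (kernel h) (fun y => a y ord0 i) z.
  rewrite -[RHS](weak_space h0 zK); apply: eq_Rintegral => y _.
  by rewrite derive_kernel.
by rewrite /average_derive E mulrN opprK.
Qed.

Lemma comparison z0 : S z0 -> z0.2 < tau -> u z0 <= v z0.
Proof.
move=> Sz zt; rewrite leNgt; apply/negP => vu.
(* Around z0 one keeps u - v > d / 2 and tau - t > th, half of the values at z0. *)
pose d := u z0 - v z0; pose th := (tau - z0.2) / 2.
have d0 : 0 < d by rewrite subr_gt0.
have th0 : 0 < th by rewrite divr_gt0// subr_gt0.
have [|//|r0 r00 Hr0] := @near_ball z0 (d / 2) th Sz; first by rewrite -/d; lra.
  by rewrite /th; move: zt; lra.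
have [eta eta0 Heta] := gap.
(* The part eta keeps the average below v at far points; d / 4 keeps it at least d / 4 above v near
   z0. *)
pose e1 := Num.min eta (d / 4).
have e10 : 0 < e1 by rewrite lt_min eta0 divr_gt0.
have [e1eta e1d] : e1 <= eta /\ e1 <= d / 4 by rewrite !ge_min !lexx orbT.
have [d1 d10 Hd1] := approx e10.
(* The weight is bounded with u + e1 in place of the average, so that N does not depend on h. *)
have [N N0 HN] : exists2 N, 0 <= N & forall z, L z ->
    `|6 * (Num.max (u z - v z + e1) 0 ^+ 1) * (Num.max (tau - z.2) 0 ^+ 2)| <= N.
  apply: (compact_continuous_bounded cL) => z Lz.
  apply: contM.
    apply: contM; first exact: cont_cst.
    apply: cont_max0X; apply: contD; last exact: cont_cst.
    by apply: contB; [exact: cLu|exact: cv (LK Lz)].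
  apply: cont_max0X; apply: contB; first exact: cont_cst.
  exact: cvg_snd.
have [r Hr] := cut_bounded_support rho cS.
have Ur z : U1 z -> `|z| <= r.
  move=> Uz; rewrite leNgt; apply/negP => /ltW/(Hr (cst 1))/eqP.
  by rewrite cut_in//= oner_eq0.
pose B : set mZ := [set y : Z | `|0 - y| <= r].
have mB0 : 0 <= fine (mu B) by rewrite fine_ge0.
have mA : measurable (ball z0 r0 : set mZ) := measurable_ball_spacetime _ _.
have Aoo : (mu (ball z0 r0) < +oo)%E.
  apply: le_lt_trans (mu_ball r); apply: le_measure.
  - exact: mem_set.
  - by apply: mem_set; apply: closed_measurable_spacetime; exact: closed_normball.
  - move=> y; rewrite -ball_normE/= => /Hr0[Uy _ _].
    by rewrite sub0r normrN; exact: Ur.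
pose b := fine (mu (ball z0 r0)).
have b0 : 0 < b by rewrite fine_gt0// mu_pos.
pose c0 := 2 * (d / 4) ^+ 3 * th.
have c00 : 0 < c0 by rewrite mulr_gt0// mulr_gt0// exprn_gt0// divr_gt0.
have N10 : 0 < N + 1 by rewrite ltr_wpDl.
have B10 : 0 < fine (mu B) + 1 by rewrite ltr_wpDl.
(* [eps] and [k] are fixed before h, and make each of the two errors in the energy inequality at
   most c0 b / 4. *)
pose eps := c0 * b / (4 * (N + 1)).
have eps0 : 0 < eps by rewrite divr_gt0// mulr_gt0.
pose k := c0 * b / (2 * (N + 1) * (fine (mu B) + 1)).
have k0 : 0 < k by apply: divr_gt0; apply: mulr_gt0 => //; exact: mulr_gt0.
have [psi [Ipsi psi0 psie Hpsi]] := pflux_modulus p2 mu_dense mu_ball ma IE (r + 1) eps0.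
have [d2 d20 Hd2] := Hpsi k k0.
(* In order: the average is within e1 of u; two points of one kernel support are closer than d2;
   these points have norm at most r + 1; and the averaged equations hold on [U1]. *)
pose h := Num.min (Num.min (d1 / 2) (d2 / 4)) (Num.min 1 (rho / 2)).
have h0 : 0 < h by rewrite !lt_min !divr_gt0//= ltr01.
have [hd1 hd2 h1 hr] : [/\ h <= d1 / 2, h <= d2 / 4, h <= 1 & h <= rho / 2].
  by split; rewrite /h !ge_min lexx ?orbT.
have {}Hd1 z : L z -> `|average mu h u z - u z| <= e1.
  by apply: Hd1 => //; move: d10; lra.
have {}hr : h < rho by move: rho0; lra.
have vanish z : U1 z -> far S rho z -> average mu h u z - v z <= 0 \/ tau <= z.2.
  move=> Uz Fz; have [zt'|/ltW] := leP z.2 tau; last by right.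
  left; have := Heta z Uz Fz zt'; have := Hd1 z (U1L Uz).
  by move=> /ler_normlW; lra.
have pairing z : U1 z -> - (average mu h psi z + k / 2) <=
    \sum_(i < n) (average mu h (fun y => a y ord0 i) z - xi z ord0 i) *
      (average mu h (fun y => pflux p (a y) i) z - P i z).
  move=> Uz; apply: (average_flux_pairing mu_translate mu_ball mu_pos h0) => //.
  move=> y y' zy zy'; apply: Hd2.
  - rewrite -(subKr z y) (le_trans (ler_normB _ _))// lerD ?Ur//.
    exact: le_trans zy h1.
  - rewrite -(subKr z y') (le_trans (ler_normB _ _))// lerD ?Ur//.
    exact: le_trans zy' h1.
  - rewrite (_ : y - y' = (z - y') - (z - y)); last by rewrite opprB [RHS]addrC addrA subrK.
    rewrite (le_lt_trans (ler_normB _ _))//.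
    by move: zy zy' hd2 d20; rewrite /=; lra.
have weight z : U1 z ->
    6 * Num.max (average mu h u z - v z) 0 * Num.max (tau - z.2) 0 ^+ 2 <= N.
  move=> Uz; apply: le_trans (HN z (U1L Uz)); rewrite expr1.
  apply: le_trans (ler_norm _); rewrite ler_wpM2r ?sqr_ge0// ler_wpM2l//.
  rewrite ge_max !le_max lexx orbT andbT; apply/orP; left.
  by have /ler_normlW := Hd1 z (U1L Uz); lra.
have [IL] := @mollified_energy_inequality R n mu mu_translate mu_ball mu_pos p u a h
  h0 Iu Ia IF S rho tau cS rho0 (fun z Uz => eq_time h0 hr Uz)
  (fun z i Uz => eq_space i h0 hr Uz) v xi vt q
  (fun z Uz => @cv z (LK (U1L Uz))) (fun z i Uz => @cxi z i (LK (U1L Uz)))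
  (fun z Uz => @cvt z (LK (U1L Uz))) (fun z i Uz => @cP z i (LK (U1L Uz)))
  (fun z i Uz => @cq z i (LK (U1L Uz))) (fun z Uz => @dvt z (LK (U1L Uz)))
  (fun z i Uz => @dvx z i (LK (U1L Uz))) (fun z i Uz => @dP z i (LK (U1L Uz)))
  (fun z Uz => supersol (LK (U1L Uz))) vanish psi k N r Ipsi psi0 k0 N0 Ur
  pairing weight.
rewrite leNgt => /negP; apply.
(* On the ball around z0 the integrand is at least c0 = 2 (d / 4)^3 th, so its integral is at least
   c0 b, while the errors add up to at most half of that. *)
apply: (@lt_le_trans _ _ (c0 * b)); last first.
  have I1 : summable_fun mu (\1_(ball z0 r0 : set mZ)).
    apply/integrableP; split; first exact/measurable_EFinP/measurable_indic.
    under eq_integral do rewrite /= ger0_norm//.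
    by rewrite (integral_indic _ measurableT mA) setIT.
  have -> : c0 * b = \int[mu]_z (c0 * \1_(ball z0 r0 : set mZ) z).
    rewrite (@RintegralZl _ _ _ mu _ _ _ measurableT I1).
    by rewrite /Rintegral (integral_indic _ measurableT mA) setIT.
  apply: le_Rintegral => //; first exact: summableZ.
  move=> z _; rewrite indicE; case: (boolP (z \in _)) => [/set_mem|_]; last first.
    rewrite mulr0 /cut; case: ifP => // _.
    by apply: mulr_ge0; [apply: mulr_ge0 => //; apply: exprn_ge0|];
      rewrite le_max lexx orbT.
  rewrite -ball_normE/= => /Hr0[Uz dz tz]; rewrite cut_in// mulr1 /c0.
  have Hm : d / 4 <= Num.max (average mu h u z - v z) 0.
    rewrite le_max; apply/orP; left.
    have := Hd1 z (U1L Uz); rewrite distrC => /ler_normlW; move: e1d dz; lra.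
  have Ht : th <= Num.max (tau - z.2) 0 by rewrite le_max (ltW tz).
  rewrite ler_pM ?(ltW th0)//.
    by rewrite mulr_ge0// exprn_ge0// divr_ge0// ltW.
  have d40 : 0 <= d / 4 by rewrite divr_ge0// ltW.
  by rewrite ler_wpM2l//; apply: lerXn2r => //; rewrite nnegrE// (le_trans d40 Hm).
have E1 : (N + 1) * eps = c0 * b / 4.
  by rewrite /eps; field; rewrite gt_eqF.
have E2 : (N + 1) * (k / 2 * (fine (mu B) + 1)) = c0 * b / 4.
  by rewrite /k; field; rewrite !gt_eqF.
have H1 : N * (\int[mu]_z psi z) <= c0 * b / 4.
  rewrite -E1; apply: ler_pM => //; last by rewrite lerDl.
  by apply: Rintegral_ge0 => y _.
have H2 : N * (k / 2 * fine (mu B)) <= c0 * b / 4.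
  have k20 : 0 <= k / 2 by rewrite divr_ge0// ltW.
  rewrite -E2; apply: ler_pM => //; first exact: mulr_ge0.
    by rewrite lerDl.
  by rewrite ler_wpM2l// lerDl.
have cb : 0 < c0 * b by rewrite mulr_gt0.
by rewrite mulrDr; move: H1 H2 cb; lra.
Qed.

End comparison.

(** * The barrier *)

Section barrier.
Context {R : realType} {n : nat}.
Notation Z := ('rV[R]_n * R)%type.
Variables (p delta A lambda eps : R) (w : 'rV[R]_n).
Hypotheses (p2 : 2 < p) (delta0 : 0 < delta) (A0 : 0 < A) (lambda0 : 0 < lambda).

Let e i : Z := (delta_mx ord0 i, 0).

Lemma is_derive_bigsum (I : Type) (s : seq I) (f : I -> Z -> R) (df : I -> R) (z v : Z) :
  (forall i, is_derive z v (f i) (df i)) ->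
  is_derive z v (fun y => \sum_(i <- s) f i y) (\sum_(i <- s) df i).
Proof.
move=> H; elim: s => [|i s IH].
  by rewrite big_nil; under eq_fun do rewrite big_nil; exact: is_derive_cst.
rewrite big_cons; under eq_fun do rewrite big_cons.
exact: is_derive_addr.
Qed.

Definition sqdist (z : Z) : R := \sum_(i < n) (z.1 ord0 i - w ord0 i) ^+ 2.

Definition growth (z : Z) : R := A * (1 + lambda * z.2).

Definition barrier (z : Z) : R := growth z * sqdist z `^ (delta / 2) + eps.

Definition barrier_slope (z : Z) : R := growth z * (delta * sqdist z `^ (delta / 2 - 1)).

Definition barrier_grad (z : Z) : 'rV[R]_n := barrier_slope z *: (z.1 - w).

Definition barrier_dt (z : Z) : R := A * lambda * sqdist z `^ (delta / 2).

(** Half of the power of |x - w| in the flux of the barrier, which is c |x - w|^(2m) (x - w) with c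
    depending on time only. *)
Definition flux_exponent : R := ((delta - 1) * (p - 1) - 1) / 2.

Let m := flux_exponent.

Let c (z : Z) : R := (growth z * delta) `^ (p - 1).

Definition barrier_dflux (i : 'I_n) (z : Z) : R :=
  c z * (sqdist z `^ m +
    (z.1 ord0 i - w ord0 i) *
      (m * sqdist z `^ (m - 1) * (2 * (z.1 ord0 i - w ord0 i)))).

Let good (z : Z) := 0 < sqdist z /\ 0 < growth z.

Lemma sqdist_enorm z : sqdist z = enorm (z.1 - w) ^+ 2.
Proof. by rewrite enorm_sqr; apply: eq_bigr => i _; rewrite !mxE. Qed.

Lemma powR_sqdist z d : sqdist z `^ (d / 2) = enorm (z.1 - w) `^ d.
Proof.
rewrite sqdist_enorm -powR_mulrn ?enorm_ge0// -powRrM.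
by congr (_ `^ _); field.
Qed.

Let ccoord (i : 'I_n) : continuous (fun z : Z => z.1 ord0 i - w ord0 i).
Proof. by move=> z; apply: contB; [exact: continuous_coord1|exact: cont_cst]. Qed.

Lemma continuous_sqdist : continuous sqdist.
Proof.
move=> z; rewrite /sqdist; elim: (index_enum _) => [|i s IH].
  by under eq_fun do rewrite big_nil; exact: cvg_cst.
under eq_fun do rewrite big_cons.
have C : {for z, continuous (fun z : Z => (z.1 ord0 i - w ord0 i) ^+ 2)}.
  by apply: contM; exact: ccoord.
exact: (contD C IH).
Qed.

Lemma continuous_growth : continuous growth.
Proof.
move=> z; have : {for z, continuous growth}; last by [].
apply: contM; first exact: cont_cst.
apply: contD; first exact: cont_cst.
by apply: contM; [exact: cont_cst|exact: cvg_snd].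
Qed.

Let cont_powR (f : Z -> R) (b : R) z : {for z, continuous f} -> 0 < f z ->
  {for z, continuous (fun z => f z `^ b)}.
Proof.
move=> cf fz; apply: (@continuous_comp _ _ _ f (fun s : R => s `^ b)) => //.
apply: differentiable_continuous; apply/derivable1_diffP.
by have [] := is_derive1_powR b fz.
Qed.

Let cont_sqdist b z : good z -> {for z, continuous (fun z => sqdist z `^ b)}.
Proof. by move=> [z0 _]; apply: cont_powR => //; exact: continuous_sqdist. Qed.

Lemma barrier_slope_continuous z : good z -> {for z, continuous barrier_slope}.
Proof.
move=> gz; apply: contM; first exact: continuous_growth.
by apply: contM; [exact: cont_cst|exact: cont_sqdist].
Qed.

Lemma barrier_grad_continuous z i : good z ->
  {for z, continuous (fun z => barrier_grad z ord0 i)}.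
Proof.
move=> gz; rewrite (_ : (fun z => _) =
    fun z : Z => barrier_slope z * (z.1 ord0 i - w ord0 i)).
  by apply: contM; [exact: barrier_slope_continuous|exact: ccoord].
by apply/funext => y; rewrite !mxE.
Qed.

Lemma barrier_dt_continuous z : good z -> {for z, continuous barrier_dt}.
Proof. by move=> gz; apply: contM; [exact: cont_cst|exact: cont_sqdist]. Qed.

Let c_continuous z : good z -> {for z, continuous c}.
Proof.
move=> [_ gz]; apply: cont_powR; last by rewrite mulr_gt0.
by apply: contM; [exact: continuous_growth|exact: cont_cst].
Qed.

Lemma barrier_dflux_continuous z i : good z -> {for z, continuous (barrier_dflux i)}.
Proof.
move=> gz; apply: contM; first exact: c_continuous.
apply: contD; first exact: cont_sqdist.
apply: contM; first exact: ccoord.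
apply: contM.
  by apply: contM; [exact: cont_cst|exact: cont_sqdist].
by apply: contM; [exact: cont_cst|exact: ccoord].
Qed.

Lemma flux_barrier_grad z i : good z ->
  pflux p (barrier_grad z) i =
  c z * (sqdist z `^ m * (z.1 ord0 i - w ord0 i)).
Proof.
move=> [sz gz]; rewrite /pflux.
have bz : 0 < barrier_slope z by rewrite mulr_gt0// mulr_gt0// powR_gt0.
have -> : enorm (barrier_grad z) = barrier_slope z * sqdist z `^ (2^-1).
  rewrite /enorm /barrier_grad.
  under eq_bigr do rewrite mxE exprMn.
  rewrite -mulr_sumr sqrtrM ?sqr_ge0// sqrtr_sqr gtr0_norm//.
  rewrite powR12_sqrt ?ltW//; congr (_ * Num.sqrt _).
  by apply: eq_bigr => j _; rewrite !mxE.
rewrite powRM ?powR_ge0 ?ltW// -powRrM !mxE.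
rewrite [LHS](_ : _ = barrier_slope z `^ (p - 1) * sqdist z `^ (2^-1 * (p - 2)) *
    (z.1 ord0 i - w ord0 i)); last first.
  rewrite -(@mulr_powRB1 _ (barrier_slope z) (p - 1)) ?ltW//; last by have := p2; lra.
  by rewrite (_ : p - 1 - 1 = p - 2); [ring|lra].
rewrite /barrier_slope mulrA powRM ?powR_ge0//; last by rewrite mulr_ge0 ?ltW.
rewrite -/(c z) -powRrM -!mulrA; congr (_ * _); rewrite mulrA; congr (_ * _).
rewrite -powRD; last by rewrite (gt_eqF sz) implybT.
by congr (_ `^ _); rewrite /m /flux_exponent; field.
Qed.

Let near_good z : good z -> \forall y \near z, good y.
Proof.
move=> [sz gz]; apply: filterS2 (cvgr_gt _ (@continuous_sqdist z) _ sz)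
  (cvgr_gt _ (@continuous_growth z) _ gz) => y sy gy; by split.
Qed.

Lemma barrier_flux_continuous z i : good z ->
  {for z, continuous (fun z => pflux p (barrier_grad z) i)}.
Proof.
move=> gz.
have C : {for z, continuous (fun z : Z => c z * (sqdist z `^ m * (z.1 ord0 i - w ord0 i)))}.
  apply: contM; first exact: c_continuous.
  by apply: contM; [exact: cont_sqdist|exact: ccoord].
rewrite /prop_for /continuous_at flux_barrier_grad//; apply: cvg_trans C.
apply: near_eq_cvg; apply: filterS (near_good gz) => y gy.
by rewrite flux_barrier_grad.
Qed.

Let d_coord z i j : is_derive z (e i) (fun z : Z => z.1 ord0 j - w ord0 j) (i == j)%:R.
Proof.
by apply: is_derive_affine => h; rewrite /= !mxE eqxx/= eq_sym; ring.
Qed.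

Lemma is_derive_sqdist z i :
  is_derive z (e i) sqdist (2 * (z.1 ord0 i - w ord0 i)).
Proof.
have := is_derive_bigsum (index_enum 'I_n)
  (fun j => is_derive_mulr (d_coord z i j) (d_coord z i j)).
move=> /is_derive_eqr; apply.
rewrite (bigD1 i)//= eqxx big1 ?addr0 => [|j /negbTE].
  by rewrite mulr1 -mulr2n mulr_natl.
by rewrite eq_sym => ->; rewrite !mulr0 addr0.
Qed.

Let d_powR_sqdist b z i : good z ->
  is_derive z (e i) (fun z => sqdist z `^ b)
    (b * sqdist z `^ (b - 1) * (2 * (z.1 ord0 i - w ord0 i))).
Proof.
move=> [sz _].
exact: (is_derive_comp (is_derive_sqdist z i) (is_derive1_powR b sz)).
Qed.

Let d_space0 (f : R -> R) z i : is_derive z (e i) (fun z : Z => f z.2) 0.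
Proof.
by apply: is_derive_affine => h; rewrite /= scaler0 add0r mulr0 add0r.
Qed.

Lemma is_derive_barrier_dt (z : Z) : is_derive z (0, 1) barrier (barrier_dt z).
Proof.
have D1 : is_derive z (0, 1) growth (A * lambda).
  by apply: is_derive_affine => h; rewrite /growth/= [h%:A]mulr1; ring.
have D2 : is_derive z (0, 1) (fun z => sqdist z `^ (delta / 2)) 0.
  by apply: is_derive_affine => h; rewrite /sqdist/= scaler0 add0r mulr0 add0r.
apply: is_derive_eqr (is_derive_addr (is_derive_mulr D1 D2)
  (is_derive_cst (eps : R) z (0, 1))) _.
by rewrite /barrier_dt; ring.
Qed.

Lemma is_derive_barrier_grad z i : good z ->
  is_derive z (e i) barrier (barrier_grad z ord0 i).
Proof.
move=> gz; have D1 := d_space0 (fun t => A * (1 + lambda * t)) z i.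
apply: is_derive_eqr (is_derive_addr (is_derive_mulr D1 (d_powR_sqdist (delta / 2) i gz))
  (is_derive_cst (eps : R) z (e i))) _.
by rewrite !mxE /barrier_slope /growth; field.
Qed.

Lemma is_derive_barrier_flux z i : good z ->
  is_derive z (e i) (fun z => pflux p (barrier_grad z) i) (barrier_dflux i z).
Proof.
move=> gz; have D1 := d_space0 (fun t => (A * (1 + lambda * t) * delta) `^ (p - 1)) z i.
have D := is_derive_mulr D1 (is_derive_mulr (d_powR_sqdist m i gz) (d_coord z i i)).
apply: (@is_derive_near _ _ (fun z => c z * (sqdist z `^ m * (z.1 ord0 i - w ord0 i)))).
  by apply: filterS (near_good gz) => y gy; rewrite flux_barrier_grad.
apply: is_derive_eqr D _.
by rewrite eqxx mulr1 mulr0 addr0.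
Qed.

(** With y = x - w, the divergence of |y|^(2m) y is (n + 2m) |y|^(2m). *)
Lemma barrier_divergence z : good z ->
  \sum_(i < n) barrier_dflux i z = c z * sqdist z `^ m * (n%:R + 2 * m).
Proof.
move=> [sz _]; rewrite /barrier_dflux -mulr_sumr -mulrA; congr (_ * _).
rewrite big_split/= sumr_const card_ord -[_ *+ n]mulr_natr mulrDr; congr (_ + _).
rewrite (eq_bigr (fun i => 2 * m * sqdist z `^ (m - 1) *
    (z.1 ord0 i - w ord0 i) ^+ 2)); last by move=> i _; ring.
rewrite -mulr_sumr -/(sqdist z) -mulrA [_ `^ _ * _]mulrC.
rewrite -{1}(powRr1 (ltW sz)) -powRD; last by rewrite (gt_eqF sz) implybT.
by rewrite addrC subrK mulrC.
Qed.

Hypothesis delta_ge : p / (p - 2) <= delta.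

Lemma flux_exponent_gt0 : 0 < flux_exponent.
Proof.
have p20 : 0 < p - 2 by rewrite subr_gt0.
have H : p <= delta * (p - 2) by rewrite -ler_pdivrMr.
rewrite /flux_exponent divr_gt0//.
have -> : (delta - 1) * (p - 1) - 1 = delta * (p - 2) - p + delta by ring.
by have := delta0; lra.
Qed.

(** Since 2m = delta + (delta (p - 2) - p), a factor |x - w|^delta common with [barrier_dt] splits
    off. The remaining power has a nonnegative exponent by [delta_ge], so it is largest at distance
    r; lambda t <= 1 bounds the growth factor by 2A. *)
Lemma barrier_supersolution r z : 0 < r -> good z -> enorm (z.1 - w) <= r ->
  0 <= z.2 -> lambda * z.2 <= 1 ->
  (2 * A * delta) `^ (p - 1) * (n%:R + 2 * m) * r `^ (delta * (p - 2) - p)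
    <= A * lambda ->
  \sum_(i < n) barrier_dflux i z <= barrier_dt z.
Proof.
move=> r0 gz zr t0 t1 H; rewrite barrier_divergence// /barrier_dt.
have [sz g0] := gz; have m0 := flux_exponent_gt0.
have p20 : 0 < p - 2 by rewrite subr_gt0.
have dp : p <= delta * (p - 2) by rewrite -ler_pdivrMr.
have -> : sqdist z `^ m = sqdist z `^ (delta / 2) *
    enorm (z.1 - w) `^ (delta * (p - 2) - p).
  rewrite -powR_sqdist -powRD; last by rewrite (gt_eqF sz) implybT.
  by congr (_ `^ _); rewrite /m /flux_exponent; field.
have hc : c z <= (2 * A * delta) `^ (p - 1).
  apply: ge0_ler_powR; rewrite ?nnegrE.
  - by have := p2; lra.
  - by rewrite mulr_ge0// ltW.
  - by rewrite mulr_ge0 ?mulr_ge0// ltW.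
  - rewrite ler_wpM2r ?(ltW delta0)// /growth [2 * A]mulrC ler_wpM2l ?(ltW A0)//.
    by lra.
have hr : enorm (z.1 - w) `^ (delta * (p - 2) - p) <= r `^ (delta * (p - 2) - p).
  by apply: ge0_ler_powR; rewrite ?nnegrE ?enorm_ge0 ?subr_ge0// ltW.
have nm : 0 <= n%:R + 2 * m by rewrite addr_ge0// mulr_ge0// ltW.
set X := enorm _ `^ _; set Y := _ `^ (delta / 2).
rewrite [leLHS](_ : _ = c z * (n%:R + 2 * m) * X * Y); last by ring.
rewrite ler_wpM2r ?powR_ge0// (le_trans _ H)//.
apply: ler_pM => //; rewrite ?powR_ge0//.
  by rewrite mulr_ge0// powR_ge0.
by rewrite ler_wpM2r.
Qed.

End barrier.

(** * Comparison for weak solutions *)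

Section solution_comparison.
Context {R : realType} {n : nat}.
Notation Z := ('rV[R]_n * R)%type.
Notation mZ := ('rV[R]_n * measurableTypeR R)%type.

(** The indicator of the open set is continuous at the points of [S]; uniform continuity with
    tolerance 1 forbids a jump from 1 to 0 within distance d. *)
Lemma compact_open_margin (S Q : set Z) : compact S -> open Q -> S `<=` Q ->
  exists2 d, 0 < d & forall s y, S s -> `|s - y| < d -> Q y.
Proof.
move=> cS oQ SQ.
have c s : S s -> {for s, continuous (\1_Q : Z -> R)}.
  move=> /SQ Qs; have N := open_nbhs_nbhs (conj oQ Qs).
  rewrite /prop_for /continuous_at indicE mem_set//.
  apply: (@cvg_trans _ ((cst 1 : Z -> R) @ s)); last first.
    exact: (@cvg_cst _ (1 : R) _ (nbhs s) _).
  by apply: near_eq_cvg; apply: filterS N => y Qy; rewrite indicE mem_set.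
have [d d0 Hd] := compact_uniform_continuity cS c (ltr01 : 0 < 1 :> R).
exists d => // s y Ss sy; have := Hd s y Ss sy.
rewrite !indicE (mem_set (SQ s Ss)); case: (boolP (y \in Q)) => [/set_mem//|_].
by rewrite subr0 normr1 ltxx.
Qed.

Lemma solution_comparison (p : R) (U : set 'rV[R]_n) (T M tau : R) (u : Z -> R)
    (v : Z -> R) (xi : Z -> 'rV[R]_n) (vt : Z -> R) (q : 'I_n -> Z -> R) (S : set Z) :
  let Q := (U `*` `]0, T[)%classic in
  2 < p -> open U -> p_parabolic_solution p U T u ->
  (forall z, Q z -> `|u z| <= M) -> (forall z, Q z -> {for z, continuous u}) ->
  (forall z, Q z -> {for z, continuous v}) ->
  (forall z i, Q z -> {for z, continuous (fun z => xi z ord0 i)}) ->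
  (forall z, Q z -> {for z, continuous vt}) ->
  (forall z i, Q z -> {for z, continuous (fun z => pflux p (xi z) i)}) ->
  (forall z i, Q z -> {for z, continuous (q i)}) ->
  (forall z : Z, Q z -> is_derive z (0, 1) v (vt z)) ->
  (forall (z : Z) i, Q z -> is_derive z (delta_mx ord0 i, 0) v (xi z ord0 i)) ->
  (forall (z : Z) i, Q z ->
    is_derive z (delta_mx ord0 i, 0) (fun z => pflux p (xi z) i) (q i z)) ->
  (forall z, Q z -> z.2 <= tau -> \sum_(i < n) q i z <= vt z) ->
  compact S -> S `<=` Q ->
  (forall y, Q y -> ~ S y -> y.2 <= tau -> u y < v y) ->
  forall z, S z -> z.2 < tau -> u z <= v z.
Proof.
move=> Q p2 oU [Du Wu weq] uM cu cv cxi cvt cP cq dvt dvx dP super cS SQ below z0 Sz zt.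
have oQ : open Q by apply: open_setX => //; exact: interval_open.
have [d d0 Hd] := compact_open_margin cS oQ SQ.
(* Points of [S] have times further than 7 rho from 0 and T, as 7 rho < d; so their 4 rho-neighbours
   have times in [3 rho, T - 3 rho], the interval of the compact cylinder [K]. *)
pose rho := d / 8; have rho0 : 0 < rho by rewrite divr_gt0.
have dE : d = 8 * rho by rewrite /rho; field.
pose K1 : set 'rV[R]_n := [set x | exists2 s, S s & `|s.1 - x| <= 4 * rho].
have cK1 : compact K1.
  rewrite (_ : K1 = (fun x : Z * Z => (x.1 - x.2).1) @`
      (S `*` [set y : Z | `|0 - y| <= 4 * rho])).
    apply: continuous_compact; last by apply: compact_setX => //; exact: compact_normball.
    apply: continuous_subspaceT => x.
    apply: (@continuous_comp _ _ _ (fun x : Z * Z => x.1 - x.2) (fst : Z -> _)).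
      by apply: cvgB; [exact: cvg_fst|exact: cvg_snd].
    exact: cvg_fst.
  apply/seteqP; split => [x [s Ss sx]|x [[s y] [/= Ss sy] <-]].
    exists (s, (s.1 - x, 0)) => /=; last by rewrite subKr.
    split => //; rewrite /= sub0r normrN prod_normE/= ge_max sx normr0.
    by rewrite mulr_ge0// ltW.
  exists s => //; rewrite opprB addrCA subrr addr0.
  by move: sy; rewrite sub0r normrN prod_normE ge_max => /andP[].
have K1U : K1 `<=` U.
  move=> x [s Ss sx]; have [] : Q (x, s.2) => //; apply: (Hd s) => //.
  rewrite prod_normE/= subrr normr0 gt_max d0 andbT.
  by move: sx rho0; rewrite dE; lra.
have t10 : 0 < 3 * rho by rewrite mulr_gt0.
have t2T : T - 3 * rho < T by rewrite gtrBl.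
pose K : set Z := K1 `*` `[3 * rho, T - 3 * rho].
have SK s y : S s -> `|s - y| < 4 * rho -> K y.
  move=> Ss sy; move: (sy); rewrite prod_normE gt_max => /andP[sy1 sy2].
  split; first by exists s => //; exact: ltW.
  have Hs t : `|s.2 - t| < d -> 0 < t < T.
    move=> st; have [_] : Q (s.1, t); last by rewrite /= in_itv.
    by apply: (Hd s) => //; rewrite prod_normE/= subrr normr0 gt_max d0.
  have := Hs (s.2 - 7 * rho); have := Hs (s.2 + 7 * rho).
  rewrite subKr opprD addNKr normrN !gtr0_norm ?mulr_gt0//.
  have r87 : 7 * rho < d by rewrite dE; move: rho0; lra.
  move=> /(_ r87)/andP[_ H2] /(_ r87)/andP[H1 _].
  rewrite /= in_itv/=; move: sy2; rewrite ltr_distl => /andP[].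
  by move: H1 H2 rho0; lra.
have KQ : K `<=` Q.
  move=> z [Kz] /=; rewrite !in_itv/= => /andP[t1z zt2]; split; first exact: K1U.
  by rewrite /= in_itv/= (lt_le_trans t10 t1z) (le_lt_trans zt2 t2T).
have uMK z : K z -> `|u z| <= M by move=> /KQ; exact: uM.
pose us := local_sol u K1 (3 * rho) (T - 3 * rho).
pose a := local_grad Du K1 (3 * rho) (T - 3 * rho).
have usE z : K z -> us z = u z by move=> Kz; rewrite /us /local_sol patchE mem_set.
have cus s y : S s -> `|s - y| < 4 * rho -> {for y, continuous (us : Z -> R)}.
  move=> Ss sy; have Ky := SK s y Ss sy.
  rewrite /prop_for /continuous_at usE//; apply: cvg_trans (cu y (KQ y Ky)).
  apply: near_eq_cvg.
  have N : nbhs y (ball y (4 * rho - `|s - y|)) by apply: nbhsx_ballx; rewrite subr_gt0.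
  apply: filterS N => y'; rewrite -ball_normE /ball_/= => yy'.
  rewrite usE//; apply: (SK s) => //.
  rewrite -(subrK y s) -addrA (le_lt_trans (ler_normD _ _))//.
  by rewrite -ltrBrDl.
have mpos (z : Z) e : 0 < e -> (0 < @dspace_time R n (ball z e))%E.
  by move=> e0; rewrite dspace_time_ball// lte_fin exprn_gt0// mulrn_wgt0.
have mball r : (@dspace_time R n [set y : Z | `|0 - y| <= r]%R < +oo)%E.
  by apply: compact_spacetime_lty; exact: compact_normball.
have below' s y : S s -> `|s - y| < 4 * rho -> ~ S y -> y.2 <= tau -> us y < v y.
  move=> Ss sy; have Ky := SK s y Ss sy.
  by rewrite usE//; apply: below; exact: KQ.
rewrite -(usE z0); last by apply: (SK z0) => //; rewrite subrr normr0 mulr_gt0.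
apply: (@comparison R n (@dspace_time R n) (@ge0_integral_translate R n) mball mpos
  (@continuous_L1_dense R n) p us a p2
  (local_sol_summable Wu oU cK1 K1U t10 t2T uMK)
  (@local_grad_measurable R n p U T u Du Wu K1 _ _ oU cK1 K1U t10 t2T)
  (local_grad_energy p2 Wu oU cK1 K1U t10 t2T)
  (local_grad_summable p2 Wu oU cK1 K1U t10 t2T)
  (local_flux_summable p2 Wu oU cK1 K1U t10 t2T) K
  (fun h z h0 zK => local_weak_time p2 Wu weq oU cK1 K1U t10 t2T uMK h0 zK)
  (fun h z h0 zK i => local_weak_space p2 Wu oU cK1 K1U t10 t2T uMK h0 zK i)
  S rho tau cS rho0 SK cus v xi vt q) => //.
- by move=> z /KQ; exact: cv.
- by move=> z i /KQ; exact: cxi.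
- by move=> z /KQ; exact: cvt.
- by move=> z i /KQ; exact: cP.
- by move=> z i /KQ; exact: cq.
- by move=> z /KQ; exact: dvt.
- by move=> z i /KQ; exact: dvx.
- by move=> z i /KQ; exact: dP.
- by move=> z /KQ; exact: super.
Qed.

End solution_comparison.

Section euclidean_norm.
Context {R : realType} {n : nat}.
Implicit Types (x w : 'rV[R]_n).

Lemma continuous_enorm_sub w : continuous (fun x => enorm (x - w)).
Proof.
move=> x.
rewrite (_ : (fun x => _) = fun x : 'rV[R]_n => Num.sqrt (sqdist w (x, 0 : R))).
  apply: (@continuous_comp _ _ _ (fun x : 'rV[R]_n => sqdist w (x, 0 : R)) Num.sqrt).
    apply: (@continuous_comp _ _ _ (fun x : 'rV[R]_n => (x, 0 : R)) (sqdist w)).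
      exact: (cvg_pair (@cvg_id _ (nbhs x)) (@cvg_cst _ (0 : R) _ (nbhs x) _)).
    exact: continuous_sqdist.
  exact: sqrt_continuous.
apply/funext => y.
by rewrite sqdist_enorm sqrtr_sqr ger0_norm// enorm_ge0.
Qed.

Lemma enorm_gt0 x : x != 0 -> 0 < enorm x.
Proof.
rewrite lt0r enorm_ge0 andbT; apply: contra_neq => x0.
apply/rowP => i; apply/eqP; rewrite mxE -normr_le0.
by rewrite -x0 coord_le_enorm.
Qed.

Lemma open_eball w r : open (eball w r).
Proof.
apply: (@open_comp _ _ (fun x => enorm (x - w)) [set s : R | s < r]).
  by move=> x _; exact: continuous_enorm_sub.
exact: open_lt.
Qed.

End euclidean_norm.

Section barrier_at_centre.
Context {R : realType} {n : nat}.
Notation Z := ('rV[R]_n * R)%type.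

Lemma continuous_powR_ge0 (V : topologicalType) (f : V -> R) (b : R) : 0 < b ->
  continuous f -> (forall z, 0 <= f z) -> continuous (fun z => f z `^ b).
Proof.
move=> b0 cf f0 z; have := f0 z; rewrite le_eqVlt => /predU1P[fz|fz]; last first.
  apply: (@continuous_comp _ _ _ f (fun s : R => s `^ b)); first exact: cf.
  apply: differentiable_continuous; apply/derivable1_diffP.
  by have [] := is_derive1_powR b fz.
apply/cvgrPdist_lt => e e0; rewrite -fz powR0 ?gt_eqF//.
have eb : 0 < e `^ b^-1 by rewrite powR_gt0.
have fe : f z < e `^ b^-1 by rewrite -fz.
apply: filterS (cvgr_lt _ (cf z) _ fe) => y fy.
rewrite sub0r normrN ger0_norm ?powR_ge0//.
have -> : e = (e `^ b^-1) `^ b by rewrite -powRrM mulVf ?gt_eqF// powRr1// ltW.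
by rewrite gt0_ltr_powR// nnegrE// ltW.
Qed.

(** Includes the centre w: in the application w lies in the closure of the base of the cylinder,
    where the contact set is formed, while derivatives are taken away from it. *)
Lemma continuous_barrier (delta A lambda eps : R) (w : 'rV[R]_n) : 0 < delta ->
  continuous (barrier delta A lambda eps w).
Proof.
move=> d0 z.
have : {for z, continuous (barrier delta A lambda eps w)}; last by [].
apply: contD; last exact: cont_cst.
apply: contM; first exact: continuous_growth.
apply: continuous_powR_ge0; first by rewrite divr_gt0.
  exact: continuous_sqdist.
by move=> y; apply: sumr_ge0 => i _; exact: sqr_ge0.
Qed.

End barrier_at_centre.

(** * The contact set and the conclusion *)

Section contact_set.
Context {R : realType} {n : nat}.
Notation Z := ('rV[R]_n * R)%type.

Lemma within_continuous_near (V : topologicalType) (A : set V) (u : V -> R) z (P : set R) :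
  {within A, continuous u} -> A z -> nbhs (u z) P ->
  \forall y \near z, A y -> P (u y).
Proof.
by move=> /subspace_continuousP cu Az Pu; exact: (cu z Az P Pu).
Qed.

Lemma within_continuous_closure_le (V : topologicalType) (A : set V) (u : V -> R) M z :
  {within closure A, continuous u} -> (forall y, A y -> u y <= M) ->
  closure A z -> u z <= M.
Proof.
move=> cu uM Az; rewrite leNgt; apply/negP => Mu.
have N : nbhs (u z) [set s | M < s] by apply: open_nbhs_nbhs; split => //; exact: open_gt.
have [y [Ay Hy]] := Az _ (within_continuous_near cu Az N).
by have := Hy (subset_closure Ay); rewrite /= ltNge uM.
Qed.

Lemma closed_contact_set (V : topologicalType) (A : set V) (u v : V -> R) :
  closed A -> {within A, continuous u} -> continuous v ->
  closed [set z | A z /\ v z <= u z].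
Proof.
move=> cA cu cv z Sz; have Az : A z.
  by rewrite ((closure_id A).1 cA); apply: closure_subset Sz => y [].
split => //; rewrite leNgt; apply/negP => uv.
have [a /andP[ua av]] : exists a, u z < a < v z.
  by exists ((u z + v z) / 2); rewrite !midf_lt.
have N : nbhs (u z) [set s | s < a] by apply: open_nbhs_nbhs; split => //; exact: open_lt.
have N2 : \forall y \near z, a < v y by exact: (cvgr_gt _ (cv z)).
have [y [[Ay vu] [Hu Hv]]] := Sz _ (filterI (within_continuous_near cu Az N) N2).
by have := lt_trans (Hu Ay) Hv; rewrite ltNge vu.
Qed.

End contact_set.

(* The equality case of the condition in [barrier_supersolution]: it fixes the
   constant [C], through [C^(p-2) = 1 / D]. *)
Lemma barrier_rate (R : realType) (p delta D r M : R) : 2 < p -> 0 < delta ->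
  0 < D -> 0 < r -> 0 < M ->
  let A := M / r `^ delta in
  let That := (D `^ (- (p - 2)^-1) / M) `^ (p - 2) * r `^ p in
  0 < That /\ A `^ (p - 1) * D * r `^ (delta * (p - 2) - p) = A * That^-1.
Proof.
move=> p2 d0 D0 r0 M0 A That.
have p20 : 0 < p - 2 by rewrite subr_gt0.
have rd0 : 0 < r `^ delta by rewrite powR_gt0.
have A0 : 0 < A by rewrite divr_gt0.
have ThatE : That = D^-1 * (M `^ (p - 2))^-1 * r `^ p.
  rewrite /That powRM ?powR_ge0 ?invr_ge0 ?ltW//; congr (_ * _ * _).
    by rewrite -powRrM mulNr mulVf ?gt_eqF// powR_inv1// ltW.
  by rewrite -powR_inv1 ?ltW// -powRrM mulN1r powRN.
have That0 : 0 < That by rewrite mulr_gt0 ?powR_gt0// divr_gt0// powR_gt0.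
split => //.
have -> : A `^ (p - 1) = A * A `^ (p - 2).
  rewrite -[LHS](@mulr_powRB1 _ A (p - 1)) ?(ltW A0)//; last by lra.
  by rewrite (_ : p - 1 - 1 = p - 2)//; lra.
have ME : M `^ (p - 2) = A `^ (p - 2) * r `^ (delta * (p - 2)).
  by rewrite powRrM -powRM ?ltW// /A divfK// gt_eqF.
have rp : r `^ (delta * (p - 2) - p) = r `^ (delta * (p - 2)) / r `^ p.
  by rewrite powRB// (gt_eqF r0) implybT.
rewrite ThatE ME rp; field.
by rewrite !gt_eqF ?powR_gt0.
Qed.

Theorem theorem4p2 (R : realType) (p : R) (hp : 2 < p) :
  exists2 c0 : R, 0 < c0 &
  forall (n : nat) (delta : R), p / (p - 2) <= delta ->
  exists2 C : R, 0 < C &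
  forall (Omega : set 'rV[R]_n) (w : 'rV[R]_n) (r T M : R)
    (u : 'rV[R]_n * R -> R),
    domain Omega -> bounded_set Omega -> boundary Omega w ->
    0 < r -> 0 < T -> 0 < M ->
    let E := Omega `&` eball w r in
    let ET := E `*` [set t | 0 < t < T] in
    {within closure ET, continuous u} ->
    (forall z, ET z -> 0 <= u z) ->
    p_parabolic_solution p E T u ->
    (forall x t, boundary Omega x -> eball w r x -> 0 <= t < T ->
      u (x, t) = 0) ->
    (forall z, ET z -> u z <= M) ->
    (forall x, E x -> u (x, 0) <= M * (enorm (x - w) `^ delta / r `^ delta)) ->
    let That := (C / M) `^ (p - 2) * r `^ p in
    let Ttilde := Num.min (That / 2) T in
    forall x t, E x -> 0 < t < Ttilde ->
      u (x, t) <= c0 * M * (enorm (x - w) `^ delta / r `^ delta).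
Proof.
(* [2] bounds the factor [1 + t / That]. *)
exists 2 => // n delta hd.
have p20 : 0 < p - 2 by rewrite subr_gt0.
have d0 : 0 < delta by apply: lt_le_trans hd; rewrite divr_gt0// (lt_trans _ hp).
have m0 := flux_exponent_gt0 hp d0 hd.
(* What is left of the coefficient in [barrier_supersolution] once A^(p-1) is factored out of (2 A
   delta)^(p-1); it depends on p, delta and n only. *)
pose D := (2 * delta) `^ (p - 1) * (n%:R + 2 * flux_exponent p delta).
have D0 : 0 < D.
  by rewrite mulr_gt0 ?powR_gt0 ?mulr_gt0// ltr_wpDl// mulr_gt0.
exists (D `^ (- (p - 2)^-1)); first by rewrite powR_gt0.
move=> Omega w r T M u [_ oO _] bO bw r0 T0 M0 E ET cu u0 sol ubd uM uinit That Tt.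
move=> x t Ex /andP[t0 tT].
have [That0 HA] := barrier_rate hp d0 D0 r0 M0.
rewrite -/That in That0 HA.
pose A := M / r `^ delta; rewrite -/A in HA; pose lambda := That^-1.
have A0 : 0 < A by rewrite divr_gt0// powR_gt0.
have l0 : 0 < lambda by rewrite invr_gt0.
have wO : ~ Omega w.
  by case: bw => _ nw Ow; apply: nw; exact: open_nbhs_nbhs.
have oE : open E by apply: openI => //; exact: open_eball.
have QE : ET = (E `*` `]0, T[)%classic.
  by apply/seteqP; split => z [Ez zt]; split => //; move: zt; rewrite /= in_itv.
have oET : open ET by rewrite QE; apply: open_setX => //; exact: interval_open.
have clsub (X : set ('rV[R]_n * R)) : closed X -> ET `<=` X -> closure ET `<=` X.
  by move=> cX EX; rewrite ((closure_id X).1 cX); exact: closure_subset.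
have cl_r z : closure ET z -> enorm (z.1 - w) <= r.
  apply: (clsub [set z | enorm (z.1 - w) <= r]) => [|y [[_ /ltW]]//].
  apply: (@closed_comp _ _ (fun z : 'rV[R]_n * R => enorm (z.1 - w)) [set s : R | s <= r]); last exact: closed_le.
  move=> y _; apply: (@continuous_comp _ _ _ (fst : 'rV[R]_n * R -> _) (fun x => enorm (x - w))).
    exact: cvg_fst.
  exact: continuous_enorm_sub.
have cl_t z : closure ET z -> 0 <= z.2.
  apply: (clsub [set z | 0 <= z.2]) => [|y [_ /andP[/ltW]]//].
  apply: (@closed_comp _ _ (snd : 'rV[R]_n * R -> R) [set s : R | 0 <= s]); last exact: closed_ge.
  by move=> y _; exact: cvg_snd.
have cl_O z : closure ET z -> closure Omega z.1.
  apply: (clsub [set z | closure Omega z.1]) => [|y [[Oy _] _]]; last exact: subset_closure.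
  apply: (@closed_comp _ _ (fst : 'rV[R]_n * R -> _) (closure Omega)); last exact: closed_closure.
  by move=> y _; exact: cvg_fst.
have cl_M z : closure ET z -> u z <= M by exact: within_continuous_closure_le.
have Ew y : E y -> 0 < enorm (y - w).
  by move=> [Oy _]; apply: enorm_gt0; apply: contra_notN wO; rewrite subr_eq0 => /eqP <-.
have good z : ET z -> 0 < sqdist w z /\ 0 < growth A lambda z.
  move=> [Ez /andP[z0 _]]; split; first by rewrite sqdist_enorm exprn_gt0// Ew.
  by rewrite mulr_gt0// ltr_wpDr// mulr_ge0// ltW.
suff main eps : 0 < eps -> u (x, t) <= barrier delta A lambda eps w (x, t).
  apply/ler_addgt0Pr => eps eps0; apply: le_trans (main eps eps0) _.
  rewrite /barrier powR_sqdist /growth lerD2r/=.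
  rewrite [leRHS](_ : _ = A * 2 * enorm (x - w) `^ delta); last first.
    by rewrite /A; field; rewrite gt_eqF// powR_gt0.
  rewrite ler_wpM2r ?powR_ge0// ler_wpM2l ?(ltW A0)//.
  have : lambda * t <= 1.
    rewrite /lambda mulrC ler_pdivrMr// mul1r.
    by move: tT; rewrite lt_min => /andP[+ _]; move: That0; lra.
  lra.
move=> eps0; pose tau := (t + Tt) / 2.
have [tau1 tau2] : t < tau /\ tau < Tt by rewrite !midf_lt.
have [tauT ltau] : tau < T /\ lambda * tau <= 1.
  move: tau2; rewrite lt_min => /andP[tau2 ->]; split => //.
  by rewrite /lambda mulrC ler_pdivrMr// mul1r; move: That0 tau2; lra.
set v := barrier delta A lambda eps w.
have cv : continuous v by exact: continuous_barrier.
pose B := closure ET `&` [set z | z.2 <= tau].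
have cB : closed B.
  apply: closedI; first exact: closed_closure.
  apply: (@closed_comp _ _ (snd : 'rV[R]_n * R -> R) [set s : R | s <= tau]); last exact: closed_le.
  by move=> y _; exact: cvg_snd.
pose S := [set z | B z /\ v z <= u z].
have vge z : 0 <= z.2 -> A * enorm (z.1 - w) `^ delta < v z.
  move=> z0; rewrite /v /barrier powR_sqdist /growth ltr_pwDr//.
  by rewrite ler_wpM2r ?powR_ge0// ler_peMr ?(ltW A0)// lerDl mulr_ge0// ltW.
(* Contact is excluded on each piece of the parabolic boundary, where v > A |x - w|^delta: on the
   sphere this is M, on the boundary of Omega u vanishes, and at time 0 it is the bound on the
   initial data. *)
have SET : S `<=` ET.
  move=> [y s] [[cz /= st] vu]; have y0 := cl_t _ cz; have yr := cl_r _ cz.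
  have yO := cl_O _ cz; rewrite /= in y0 yr yO.
  have {}vu : A * enorm (y - w) `^ delta < u (y, s) :=
    lt_le_trans (vge (y, s) y0) vu.
  have er : enorm (y - w) < r.
    rewrite ltNge; apply/negP => ry.
    have E1 : enorm (y - w) = r by apply/eqP; rewrite eq_le yr.
    by have := cl_M _ cz; rewrite leNgt (le_lt_trans _ vu)// E1 /A divfK// gt_eqF// powR_gt0.
  have sT : s < T by exact: le_lt_trans st tauT.
  have v0 : 0 <= A * enorm (y - w) `^ delta by rewrite mulr_ge0 ?powR_ge0// ltW.
  have Oy : Omega y.
    apply: contrapT => nOy; have : u (y, s) = 0.
      apply: ubd => //; last by rewrite y0.
      by split => // /interior_subset.
    by move=> u00; move: vu; rewrite u00 ltNge v0.
  split => //=; rewrite sT andbT lt0r y0 andbT; apply/eqP => s0.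
  have /uinit : E y by [].
  by rewrite -s0 leNgt mulrCA mulrC (le_lt_trans _ vu)// /A; lra.
have cS : compact S.
  have [b [_ Hb]] := bO.
  apply: (@subclosed_compact _ _ [set z : 'rV[R]_n * R | `|0 - z| <= Num.max (b + 1) T]).
  - apply: closed_contact_set cB _ cv.
    by apply: continuous_subspaceW cu => z [].
  - exact: compact_normball.
  - move=> z /SET[[Oz _] /andP[z0 zT]].
    rewrite /= sub0r normrN prod_normE ge_max !le_max; apply/andP; split; apply/orP.
      by left; apply: Hb => //; rewrite ltrDl.
    by right; rewrite gtr0_norm// ltW.
(* Outside the contact set, and up to time tau, u < v by definition. *)
have [Sxt|nS] := pselect (S (x, t)); last first.
  have [//|uv] := leP (u (x, t)) (v (x, t)).
  exfalso; apply: nS; split; last exact: ltW.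
  split; last exact: ltW.
  apply: subset_closure; split => //=; rewrite t0 (lt_trans tau1)//.
apply: (@solution_comparison R n p E T M tau u v (barrier_grad delta A lambda w)
  (barrier_dt delta A lambda w) (barrier_dflux p delta A lambda w) S hp oE sol) => //;
  rewrite -?QE.
- by move=> z Qz; rewrite ger0_norm; [exact: uM|exact: u0].
- move=> z Qz; have := continuous_subspaceW (@subset_closure _ ET) cu.
  by rewrite continuous_open_subspace// => /(_ z (mem_set Qz)).
- by move=> z _; exact: cv.
- by move=> z i /good gz; exact: barrier_grad_continuous.
- by move=> z /good gz; exact: barrier_dt_continuous.
- by move=> z i /good gz; exact: barrier_flux_continuous.
- by move=> z i /good gz; exact: barrier_dflux_continuous.
- by move=> z _; exact: is_derive_barrier_dt.
- by move=> z i /good gz; exact: is_derive_barrier_grad.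
- by move=> z i /good gz; exact: is_derive_barrier_flux.
- move=> z Qz ztau; apply: (barrier_supersolution hp d0 A0 hd r0) => //.
  + exact: good.
  + by case: Qz => -[_ /ltW].
  + by case: Qz => _ /andP[/ltW].
  + apply: le_trans ltau; rewrite ler_wpM2l// ltW//.
  + rewrite le_eqVlt; apply/orP; left; apply/eqP; rewrite -HA /D.
    have dd0 : 0 <= 2 * delta by rewrite mulr_ge0// ltW.
    rewrite (_ : 2 * A * delta = A * (2 * delta)); last by ring.
    by rewrite (powRM _ (ltW A0) dd0); ring.
- move=> y Qy nSy yt; rewrite ltNge; apply/negP => vu; apply: nSy; split => //.
  by split => //; exact: subset_closure.
Qed.
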